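(* Let $(M^{6},g,J)$ be a 6-dimensional (strict) nearly Kähler manifold endowed with its characteristic connection $\nabla^{c}=\nabla^{g}+\frac12T$. Then, for each choice of sign $\pm$ (with signs matched throughout), the following classes of spinor fields coincide: (1) twistor spinors with torsion with respect to the family $\{\nabla^{s}:s\in\mathbb{R}\setminus\{1/4\}\}$, lying in $\Sigma_{\pm2\|T\|}$; (2) Killing spinors with torsion with respect to the family $\{\nabla^{s}:s\in\mathbb{R}\setminus\{0,1/4\}\}$, with Killing number $\zeta=\mp\frac{4s-1}{4}\|T\|$; (3) Riemannian Killing spinors (the class spanned by $\varphi^{\pm}$); (4) $\nabla^{c}$-parallel spinors (the class spanned by $\varphi^{\pm}$).
   Context: A nearly Kähler manifold is an almost Hermitian manifold with $(\nabla^{g}_{X}J)X=0$; strict means $\nabla^gJ\neq0$. Such a 6-manifold is spin, and its characteristic connection is $\nabla^{c}=\nabla^{g}+\frac12T$ with $T(X,Y)=(\nabla^{g}_{X}J)JY$ totally skew-symmetric and $\nabla^{c}T=0$. For $s\in\mathbb{R}$, $\nabla^{s}=\nabla^{g}+2sT$. $\Sigma$ is the spinor bundle, ''$\cdot$'' is Clifford multiplication with $X\cdot Y+Y\cdot X=-2g(X,Y)$; forms act by Clifford multiplication; on $\Sigma$, $\nabla^{s}_{X}\varphi=\nabla^{g}_{X}\varphi+s(X\lrcorner T)\cdot\varphi$ and $D^{s}(\varphi)=\sum_{i}e_{i}\cdot\nabla^{s}_{e_{i}}\varphi$. $\|T\|^{2}=\frac13\sum_{i<j}g(T(e_{i},e_{j}),T(e_{i},e_{j}))$,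 and $\Sigma_{\gamma}$ is the $\gamma$-eigenbundle of the Clifford action of $T$. A twistor spinor with torsion w.r.t. $\nabla^s$ satisfies $\nabla^{s}_{X}\varphi+\frac16X\cdot D^{s}(\varphi)=0$ for all $X$; a Killing spinor with torsion with Killing number $\zeta$ satisfies $\nabla^{s}_{X}\varphi=\zeta X\cdot\varphi$ for all $X$; a Riemannian Killing spinor with Killing number $\kappa\ne 0$ satisfies $\nabla^{g}_{X}\varphi=\kappa X\cdot\varphi$ for all $X$. The paper works with the standing facts/conventions that the spaces of Riemannian Killing spinors for the two signs of the Killing number are one-dimensional, spanned by spinors $\varphi^{+}$ and $\varphi^{-}$ respectively (Killing numbers $\pm\|T\|/4$), that $T\cdot\varphi^{\pm}=\pm2\|T\|\varphi^{\pm}$, and that $\varphi^{\pm}$ exhaust (span) the $\nabla^{c}$-parallel spinors. *)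

(* Defs.v *)
From mathcomp Require Import all_boot all_order all_algebra.
From mathcomp Require Import all_classical all_reals all_analysis.
From mathcomp Require Import complex.
Set Implicit Arguments.
Unset Strict Implicit.
Unset Printing Implicit Defensive.
Import Order.TTheory GRing.Theory Num.Theory.
Import numFieldNormedType.Exports.
Local Open Scope classical_set_scope.
Local Open Scope ring_scope.

(** ** Smooth functions on open subsets of R^n *)

Definition partial (R : realType) (n : nat) (i : 'I_n) (f : 'rV[R]_n -> R)
  : 'rV[R]_n -> R := fun x => 'D_(delta_mx 0 i) f x.

(* Only meaningful for an open set U, so that the values of f outside U do not
   matter. *)
Fixpoint Ck_on (R : realType) (n k : nat) (U : set 'rV[R]_n)
    (f : 'rV[R]_n -> R) {struct k} : Prop :=
  (forall x, U x -> {for x, continuous f}) /\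
  (if k is k'.+1 then forall i : 'I_n,
     (forall x, U x -> derivable f x (delta_mx 0 i)) /\ Ck_on k' U (partial i f)
   else True).

Definition smooth_on (R : realType) (n : nat) (U : set 'rV[R]_n)
  (f : 'rV[R]_n -> R) : Prop := forall k, Ck_on k U f.

(** ** Smooth manifolds *)

(* [chart_map] is a homeomorphism from the open set [chart_dom] onto its open
   image, with inverse [chart_inv]. *)
Record chart (R : realType) (n : nat) (M : topologicalType) := Chart {
  chart_dom : set M;
  chart_map : M -> 'rV[R]_n;
  chart_inv : 'rV[R]_n -> M;
  chart_dom_open : open chart_dom;
  chart_image_open : open (chart_map @` chart_dom);
  chart_mapK : forall p, chart_dom p -> chart_inv (chart_map p) = p;
  chart_map_continuous : forall p, chart_dom p -> {for p, continuous chart_map};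
  chart_inv_continuous : forall p, chart_dom p ->
    {for chart_map p, continuous chart_inv}
}.

Record manifold (R : realType) (n : nat) := Manifold {
  points :> topologicalType;
  points_hausdorff : hausdorff_space points;
  points_second_countable : @second_countable points;
  points_connected : connected [set: points];
  atlas : Type;
  chart_at : atlas -> chart R n points;
  atlas_cover : forall p, exists c, chart_dom (chart_at c) p;
  atlas_smooth : forall c d (i : 'I_n),
    smooth_on (chart_map (chart_at c) @`
                 (chart_dom (chart_at c) `&` chart_dom (chart_at d)))
      (fun x => chart_map (chart_at d) (chart_inv (chart_at c) x) 0 i)
}.

Section Calculus.
Variables (R : realType) (n : nat) (M : manifold R n).
Implicit Types (c d : atlas M) (p : M) (f : M -> R) (X Y : 'rV[R]_n).

Definition smooth_fun (U : set M) f : Prop :=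
  forall c, smooth_on (chart_map (chart_at c) @` (chart_dom (chart_at c) `&` U))
                      (f \o chart_inv (chart_at c)).

Definition smooth_mx (m k : nat) (U : set M) (A : M -> 'M[R]_(m, k)) : Prop :=
  forall i j, smooth_fun U (fun p => A p i j).

(* The partial derivative of f at p with respect to the i-th coordinate of c *)
Definition pd c (i : 'I_n) f p : R :=
  partial i (f \o chart_inv (chart_at c)) (chart_map (chart_at c) p).

(* A tangent vector at p is represented by the row vector of its components
   in a chart c around p, and [deriv_along c X f p] is its action on f. *)
Definition deriv_along c X f p : R := \sum_i X 0 i * pd c i f p.

(* X : components in c  |->  X *m jacobian c d p : components in d *)
Definition jacobian c d p : 'M[R]_n :=
  \matrix_(i, j) pd c i (fun q => chart_map (chart_at d) q 0 j) p.

Definition smooth_cmx (m k : nat) (U : set M) (A : M -> 'M[R[i]]_(m, k)) :=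
  smooth_mx U (fun p => map_mx (@complex.Re R) (A p)) /\
  smooth_mx U (fun p => map_mx (@complex.Im R) (A p)).

Definition deriv_along_cmx (m k : nat) c X (A : M -> 'M[R[i]]_(m, k)) p
  : 'M[R[i]]_(m, k) :=
  \matrix_(i, j) (deriv_along c X (fun q => complex.Re (A q i j)) p +i*
                  deriv_along c X (fun q => complex.Im (A q i j)) p)%C.

End Calculus.

(** ** Almost Hermitian structures *)

(* The matrices (g_ij) of a Riemannian metric in all charts *)
Record riemannian_metric (R : realType) (n : nat) (M : manifold R n) := Metric {
  gram :> atlas M -> M -> 'M[R]_n;
  gram_smooth : forall c, smooth_mx (chart_dom (chart_at c)) (gram c);
  gram_sym : forall c p, chart_dom (chart_at c) p -> (gram c p)^T = gram c p;
  gram_pos : forall c p (X : 'rV[R]_n), chart_dom (chart_at c) p -> X != 0 ->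
    0 < (X *m gram c p *m X^T) 0 0;
  gram_change : forall c d p,
    chart_dom (chart_at c) p -> chart_dom (chart_at d) p ->
    gram c p = jacobian c d p *m gram d p *m (jacobian c d p)^T
}.

(* The matrices of an almost complex structure in all charts; since tangent
   vectors are row vectors, J X is X *m acs c p. *)
Record almost_complex (R : realType) (n : nat) (M : manifold R n) :=
  AlmostComplex {
  acs :> atlas M -> M -> 'M[R]_n;
  acs_smooth : forall c, smooth_mx (chart_dom (chart_at c)) (acs c);
  acs_sqr : forall c p, chart_dom (chart_at c) p -> acs c p *m acs c p = - 1%:M;
  acs_change : forall c d p,
    chart_dom (chart_at c) p -> chart_dom (chart_at d) p ->
    acs c p *m jacobian c d p = jacobian c d p *m acs d p
}.

Section AlmostHermitian.
Variables (R : realType) (n : nat) (M : manifold R n).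
Variables (g : riemannian_metric M) (J : almost_complex M).
Implicit Types (c : atlas M) (p : M) (X Y : 'rV[R]_n).

Definition inner c p X Y : R := (X *m g c p *m Y^T) 0 0.

Definition christoffel c p (i j k : 'I_n) : R :=
  2^-1 * \sum_l invmx (g c p) l k *
    (pd c i (fun q => g c q j l) p + pd c j (fun q => g c q i l) p
     - pd c l (fun q => g c q i j) p).

(* The Levi-Civita derivative at p of the vector field with components Y in c *)
Definition nabla_g c X (Y : M -> 'rV[R]_n) p : 'rV[R]_n :=
  \row_k (deriv_along c X (fun q => Y q 0 k) p +
          \sum_i \sum_j X 0 i * Y p 0 j * christoffel c p i j k).

Definition almost_hermitian : Prop :=
  forall c p X Y, chart_dom (chart_at c) p ->
    inner c p (X *m J c p) (Y *m J c p) = inner c p X Y.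

(* (nabla_X J) Y = nabla_X (J Y) - J (nabla_X Y), where Y is extended to a
   vector field with constant components in the chart c. *)
Definition nablaJ c p X Y : 'rV[R]_n :=
  nabla_g c X (fun q => Y *m J c q) p - nabla_g c X (fun=> Y) p *m J c p.

Definition nearly_kahler : Prop :=
  almost_hermitian /\
  forall c p X, chart_dom (chart_at c) p -> nablaJ c p X X = 0.

Definition strict_nearly_kahler : Prop :=
  nearly_kahler /\
  exists c p X Y, chart_dom (chart_at c) p /\ nablaJ c p X Y <> 0.

(* The torsion T(X, Y) = (nabla_X J) J Y of the characteristic connection *)
Definition torsion c p X Y : 'rV[R]_n := nablaJ c p X (Y *m J c p).

(* T(X, Y, Z) = g(T(X, Y), Z) *)
Definition torsion3 c p X Y (Z : 'rV[R]_n) : R := inner c p (torsion c p X Y) Z.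

End AlmostHermitian.

(** ** Clifford algebra and spin structures *)

Section Clifford.
Variables (R : realType) (n N : nat) (gamma : 'I_n -> 'M[R[i]]_N).

(* gamma i is the Clifford action of the i-th vector of the standard
   orthonormal basis of R^n; x y + y x = - 2 <x, y>. *)
Definition clifford_rep : Prop :=
  forall i j, gamma i *m gamma j + gamma j *m gamma i =
              (- (2 *+ (i == j)))%:M.

Definition cl1 (w : 'I_n -> R) : 'M[R[i]]_N :=
  \sum_i (w i)%:C%C *: gamma i.

Definition cl2 (w : 'I_n -> 'I_n -> R) : 'M[R[i]]_N :=
  \sum_(i < n) \sum_(j < n | (i < j)%N) (w i j)%:C%C *: (gamma i *m gamma j).

Definition cl3 (w : 'I_n -> 'I_n -> 'I_n -> R) : 'M[R[i]]_N :=
  \sum_(i < n) \sum_(j < n | (i < j)%N) \sum_(k < n | (j < k)%N)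
    (w i j k)%:C%C *: (gamma i *m gamma j *m gamma k).

(* Spin(n): products of an even number of unit vectors *)
Definition in_spin (h : 'M[R[i]]_N) : Prop :=
  exists s : seq 'rV[R]_n,
    [/\ forall v, v \in s -> \sum_i v 0 i ^+ 2 = 1,
        ~~ odd (size s) &
        h = \big[mulmx/1%:M]_(v <- s) cl1 (fun i => v 0 i)].

End Clifford.

(* A spin structure as a Spin(n)-valued cocycle: the manifold is covered by
   open sets carrying orthonormal frames, whose change of frame is lifted to
   Spin(n).  Row i of [patch_frame a p] holds the components of e_i in the
   chart [patch_chart a].  With A the matrix of the g(e^a_i, e^b_j), so that
   e^a_i = \sum_j A i j e^b_j, [patch_lift_covers] says that
   h^-1 e_i h = \sum_j A i j e_j, i.e. that h covers this change of frame. *)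
Record spin_structure (R : realType) (n N : nat) (M : manifold R n)
    (g : riemannian_metric M) (gamma : 'I_n -> 'M[R[i]]_N) := SpinStructure {
  spin_patch : Type;
  patch_dom : spin_patch -> set M;
  patch_chart : spin_patch -> atlas M;
  patch_frame : spin_patch -> M -> 'M[R]_n;
  patch_lift : spin_patch -> spin_patch -> M -> 'M[R[i]]_N;
  patch_dom_open : forall a, open (patch_dom a);
  patch_dom_sub : forall a,
    patch_dom a `<=` chart_dom (chart_at (patch_chart a));
  patch_dom_cover : forall p, exists a, patch_dom a p;
  patch_frame_smooth : forall a, smooth_mx (patch_dom a) (patch_frame a);
  patch_frame_orthonormal : forall a p, patch_dom a p ->
    patch_frame a p *m g (patch_chart a) p *m (patch_frame a p)^T = 1%:M;
  patch_lift_smooth : forall a b,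
    smooth_cmx (patch_dom a `&` patch_dom b) (patch_lift a b);
  patch_lift_spin : forall a b p, patch_dom a p -> patch_dom b p ->
    in_spin gamma (patch_lift a b p);
  patch_lift_cocycle : forall a b c p,
    patch_dom a p -> patch_dom b p -> patch_dom c p ->
    patch_lift a b p *m patch_lift b c p = patch_lift a c p;
  patch_lift_covers : forall a b p,
    patch_dom a p -> patch_dom b p -> forall i,
    gamma i *m patch_lift a b p =
    patch_lift a b p *m
      cl1 gamma (fun j =>
        (patch_frame a p *m jacobian (patch_chart a) (patch_chart b) p
         *m g (patch_chart b) p *m (patch_frame b p)^T) i j)
}.

(** ** Spinor fields *)

Section Spinors.
Variables (R : realType) (n N : nat) (M : manifold R n) (g : riemannian_metric M).
Variables (J : almost_complex M) (gamma : 'I_n -> 'M[R[i]]_N).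
Variable S : spin_structure g gamma.
Implicit Types (a : spin_patch S) (p : M) (X : 'rV[R]_n) (s : R).

(* A section of the spinor bundle is represented by its components in all
   patches; only the values of [phi a] on [patch_dom a] are relevant. *)
Definition spinor := spin_patch S -> M -> 'cV[R[i]]_N.
Implicit Types phi psi : spinor.

Definition spinor_field phi : Prop :=
  (forall a, smooth_cmx (patch_dom a) (phi a)) /\
  (forall a b p, patch_dom a p -> patch_dom b p ->
     phi a p = patch_lift a b p *m phi b p).

Definition frame_vec a (i : 'I_n) p : 'rV[R]_n := row i (patch_frame a p).

Definition cl_vec a p X : 'M[R[i]]_N :=
  cl1 gamma (fun i => inner g (patch_chart a) p X (frame_vec a i p)).

Definition torsion_frame a p (i j k : 'I_n) : R :=
  torsion3 g J (patch_chart a) p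
    (frame_vec a i p) (frame_vec a j p) (frame_vec a k p).

Definition torsion_norm a p : R :=
  Num.sqrt (3^-1 * \sum_(i < n) \sum_(j < n | (i < j)%N)
    let Tij := torsion g J (patch_chart a) p (frame_vec a i p) (frame_vec a j p) in
    inner g (patch_chart a) p Tij Tij).

Definition cl_torsion a p : 'M[R[i]]_N := cl3 gamma (torsion_frame a p).

(* Clifford action of the 2-form X _| T *)
Definition cl_contract_torsion a p X : 'M[R[i]]_N :=
  cl2 gamma (fun i j => torsion3 g J (patch_chart a) p X
                          (frame_vec a i p) (frame_vec a j p)).

(* nabla^g_X phi = X(phi) + 1/2 \sum_(i < j) g(nabla_X e_i, e_j) e_i e_j phi *)
Definition nabla_spin phi a p X : 'cV[R[i]]_N :=
  deriv_along_cmx (patch_chart a) X (phi a) p +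
  (2^-1)%:C%C *: (cl2 gamma (fun i j => inner g (patch_chart a) p
       (nabla_g g (patch_chart a) X (frame_vec a i) p) (frame_vec a j p))
     *m phi a p).

Definition nabla_s s phi a p X : 'cV[R[i]]_N :=
  nabla_spin phi a p X + s%:C%C *: (cl_contract_torsion a p X *m phi a p).

Definition dirac_s s phi a p : 'cV[R[i]]_N :=
  \sum_i gamma i *m nabla_s s phi a p (frame_vec a i p).

Definition twistor_torsion s phi : Prop :=
  forall a p X, patch_dom a p ->
    nabla_s s phi a p X
    + (n%:R^-1)%:C%C *: (cl_vec a p X *m dirac_s s phi a p) = 0.

Definition killing_torsion s (zeta : R) phi : Prop :=
  forall a p X, patch_dom a p ->
    nabla_s s phi a p X = zeta%:C%C *: (cl_vec a p X *m phi a p).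

Definition riemannian_killing (kappa : R) phi : Prop :=
  kappa <> 0 /\ forall a p X, patch_dom a p ->
    nabla_spin phi a p X = kappa%:C%C *: (cl_vec a p X *m phi a p).

(* The characteristic connection nabla^g + (1/2) T is nabla^s for s = 1/4. *)
Definition parallel_c phi : Prop :=
  forall a p X, patch_dom a p -> nabla_s 4^-1 phi a p X = 0.

Definition in_eigenbundle (lambda : R) phi : Prop :=
  forall a p, patch_dom a p ->
    cl_torsion a p *m phi a p = lambda%:C%C *: phi a p.

Definition nonzero_spinor phi : Prop :=
  exists a p, patch_dom a p /\ phi a p <> 0.

Definition in_line phi psi : Prop :=
  exists z : R[i], forall a p, patch_dom a p -> phi a p = z *: psi a p.

Definition in_span2 phi psi1 psi2 : Prop :=
  exists z w : R[i], forall a p, patch_dom a p ->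
    phi a p = z *: psi1 a p + w *: psi2 a p.

End Spinors.

(* The sign +1 or -1 attached to a choice of sign; true stands for +. *)
Definition sign_of (R : realType) (e : bool) : R := if e then 1 else -1.

(* Main.v *)
(* Write v = phi_e, v' = phi_(-e) and T_X for the Clifford action of X _| T.
   Being both Killing and nabla^c-parallel, v satisfies T_X v = - e tau X v,
   which turns its Killing equation for nabla^g into the one for every nabla^s.

   T is self-adjoint for a Hermitian form making the Clifford generators skew,
   and tr T^2 = 8 tau^2, because T is totally skew with norm tau.  The
   eigenvectors v and v' already account for this trace, so the eigenspaces for
   +-2 tau are the lines of v and v', and T vanishes on their orthogonal.

   A twistor spinor phi in the eigenbundle of v is therefore f v, where f is
   smooth since v, of locally constant norm on a connected manifold, has no zero;
   the twistor equation says that X(f) v + X grad(f) v / 6 = 0, whence df = 0.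

   If phi is a Killing spinor with torsion, the function <v', phi> has
   differential X |-> - 2 zeta <X v', phi>.  Its Hessian is symmetric, and as
   s <> 0 this says that (2 e tau - T) phi is orthogonal to all [X, Y] v';
   hence phi has no component in ker T, i.e. phi = z v + w v'.  The products
   <v, phi> and <v', phi> are then locally constant, and the Killing equation
   forces w = 0. *)

Require Import Defs.
From mathcomp Require Import all_boot all_order all_algebra.
From mathcomp Require Import all_classical all_reals all_analysis.
From mathcomp Require Import complex spectral ring lra zify.
Set Implicit Arguments.
Unset Strict Implicit.
Unset Printing Implicit Defensive.
Import Order.TTheory GRing.Theory Num.Theory.
Import numFieldNormedType.Exports.
Local Open Scope classical_set_scope.
Local Open Scope sesquilinear_scope.
Local Open Scope ring_scope.

(** * Clifford algebra *)

Section FullSums.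
Variables (V : zmodType) (n : nat).

Lemma sum_offdiag2 (f : 'I_n -> 'I_n -> V) :
  (forall i j, f i j = f j i) -> (forall i, f i i = 0) ->
  \sum_i \sum_j f i j = (\sum_(i < n) \sum_(j < n | (i < j)%N) f i j) *+ 2.
Proof.
move=> fC f0.
have -> : \sum_(i < n) \sum_(j < n | (i < j)%N) f i j =
    \sum_(i < n) \sum_(j < n) (if (i < j)%N then f i j else 0).
  by apply: eq_bigr => i _; rewrite big_mkcond.
rewrite mulr2n [X in _ = _ + X]exchange_big -big_split /=; apply: eq_bigr => i _.
rewrite -big_split; apply: eq_bigr => j _ /=.
case: ltngtP => [_|_|/val_inj ->]; last by rewrite f0 addr0.
  by rewrite addr0.
by rewrite add0r fC.
Qed.

Lemma sum_offdiag3 (f : 'I_n -> 'I_n -> 'I_n -> V) :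
  (forall i j k, f i j k = f j i k) -> (forall i j k, f i j k = f i k j) ->
  (forall i k, f i i k = 0) ->
  \sum_i \sum_j \sum_k f i j k =
  (\sum_(i < n) \sum_(j < n | (i < j)%N) \sum_(k < n | (j < k)%N) f i j k) *+ 6.
Proof.
move=> f12 f23 f0.
have f01 i k : f i k k = 0 by rewrite f12 f23 f0.
have f02 i k : f i k i = 0 by rewrite f23 f0.
pose h (i j k : 'I_n) := if (i < j)%N && (j < k)%N then f i j k else 0.
have -> : \sum_(i < n) \sum_(j < n | (i < j)%N) \sum_(k < n | (j < k)%N) f i j k
    = \sum_i \sum_j \sum_k h i j k.
  apply: eq_bigr => i _; rewrite big_mkcond; apply: eq_bigr => j _.
  case: ifP => ij; first by rewrite big_mkcond; apply: eq_bigr => k _; rewrite /h ij.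
  by rewrite big1 // => k _; rewrite /h ij.
set S := (RHS in _ = RHS *+ 6).
have sw (F : 'I_n -> 'I_n -> 'I_n -> V) :
  \sum_i \sum_j \sum_k F i j k = \sum_i \sum_j \sum_k F i k j.
  by apply: eq_bigr => i _; rewrite exchange_big.
have tr (F : 'I_n -> 'I_n -> 'I_n -> V) :
  \sum_i \sum_j \sum_k F i j k = \sum_i \sum_j \sum_k F j i k.
  by rewrite exchange_big.
have e1 : S = \sum_i \sum_j \sum_k h i k j by rewrite /S sw.
have e2 : S = \sum_i \sum_j \sum_k h j i k by rewrite /S tr.
have e3 : S = \sum_i \sum_j \sum_k h j k i by rewrite e1 tr.
have e4 : S = \sum_i \sum_j \sum_k h k i j by rewrite e2 sw.
have e5 : S = \sum_i \sum_j \sum_k h k j i by rewrite e3 sw.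
have -> : S *+ 6 = S + S + S + S + S + S by rewrite !mulrS mulr0n addr0 !addrA.
rewrite {2}e1 {2}e2 {2}e3 {2}e4 {2}e5 /S.
rewrite -!big_split; apply: eq_bigr => i _; rewrite -!big_split.
apply: eq_bigr => j _; rewrite -!big_split; apply: eq_bigr => k _ /=.
rewrite /h; case: (ltngtP i j) => ij; case: (ltngtP j k) => jk;
  case: (ltngtP i k) => ik /=; rewrite ?addr0 ?add0r //; try lia;
  do ?[match goal with H : nat_of_ord _ = nat_of_ord _ |- _ => move/val_inj: H => H; subst end];
  rewrite ?f0 ?f01 ?f02 //.
all: first [done | by rewrite f23 | by rewrite f12 | by rewrite f12 f23 | by rewrite f23 f12 | by rewrite f12 f23 f12].
Qed.

End FullSums.

Section CliffordWords.
Variables (F : fieldType) (m n : nat) (g : 'I_n -> 'M[F]_m.+1).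
Hypothesis gC : forall i j, g i * g j + g j * g i = (- (2 *+ (i == j)))%:M.
Hypothesis F2 : (2%:R : F) != 0.

Lemma gen_swap i j : g i * g j = - 2%:R * (i == j)%:R *: 1 - g j * g i.
Proof.
have -> : - 2%:R * (i == j)%:R *: 1 = (- (2 *+ (i == j)))%:M :> 'M[F]_m.+1.
  by rewrite mulNr mulr_natr -scalemx1.
by rewrite -gC addrK.
Qed.

Lemma gen_sqr i : g i * g i = -1.
Proof.
have h := gen_swap i i; rewrite eqxx mulr1 in h.
have : 2%:R *: (g i * g i) = 2%:R *: (-1).
  rewrite scaler_nat mulr2n {2}h addrC subrK; apply/matrixP => a b; rewrite !mxE; ring.
by move/(scalerI F2).
Qed.

Lemma gen_comm i j : g i * g j = (-1) ^+ (i != j) *: (g j * g i).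
Proof.
case: eqVneq => [->|ij]; first by rewrite expr0 scale1r.
by rewrite gen_swap (negbTE ij) mulr0 scale0r add0r expr1 scaleN1r.
Qed.

Definition word3 i j k := g i * g j * g k.

Lemma word3_anticomm i j k l :
  word3 i j k * g l + g l * word3 i j k =
  - 2%:R *: ((i == l)%:R *: (g j * g k) - (j == l)%:R *: (g i * g k)
             + (k == l)%:R *: (g i * g j)).
Proof.
have -> : g l * word3 i j k = - 2%:R * (i == l)%:R *: (g j * g k)
   + 2%:R * (j == l)%:R *: (g i * g k) - 2%:R * (k == l)%:R *: (g i * g j)
   - word3 i j k * g l.
  rewrite /word3 mulrA mulrA (gen_swap l i) (eq_sym l).
  rewrite 2!mulrBl -!scalerAl mul1r -(mulrA (g i) (g l)) (gen_swap l j) (eq_sym l).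
  rewrite mulrBr mulrBl -scalerAr mulr1 -!scalerAl.
  rewrite -(mulrA (g i) (g j * g l)) -(mulrA (g j) (g l)) (gen_swap l k) (eq_sym l).
  rewrite (mulrBr (g j)) -scalerAr mulr1 (mulrBr (g i)) -scalerAr !mulrA.
  move: (g j * g k) (g i * g k) (g i * g j) (g i * g j * g k * g l) => a b c d.
  by apply/matrixP => x y; rewrite !mxE; ring.
move: (g j * g k) (g i * g k) (g i * g j) (word3 i j k * g l) => a b c d.
by apply/matrixP => x y; rewrite !mxE; ring.
Qed.

Lemma word2_comm k l i :
  g k * g l * g i - g i * (g k * g l) =
  2%:R *: ((k == i)%:R *: g l - (l == i)%:R *: g k).
Proof.
have -> : g i * (g k * g l) = - 2%:R * (k == i)%:R *: g l
    + 2%:R * (l == i)%:R *: g k + g k * g l * g i.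
  rewrite mulrA (gen_swap i k) (eq_sym i) mulrBl -scalerAl mul1r.
  rewrite -(mulrA (g k) (g i)) (gen_swap i l) (eq_sym i) mulrBr -scalerAr mulr1 mulrA.
  move: (g k * g l * g i) (g k) (g l) => a b c.
  by apply/matrixP => x y; rewrite !mxE; ring.
move: (g k * g l * g i) (g k) (g l) => a b c.
by apply/matrixP => x y; rewrite !mxE; ring.
Qed.

Definition sgn3 (l i j k : 'I_n) : nat := (l != i) + (l != j) + (l != k).

Lemma gen_word3 l i j k : g l * word3 i j k = (-1) ^+ sgn3 l i j k *: (word3 i j k * g l).
Proof.
rewrite /word3 mulrA mulrA (gen_comm l i) -!scalerAl -(mulrA (g i) (g l)) (gen_comm l j).
rewrite -scalerAr -scalerAl scalerA mulrA -(mulrA (g i * g j) (g l)) (gen_comm l k).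
by rewrite -scalerAr scalerA -!exprD !mulrA.
Qed.

Lemma word3_word3 i j k a b c : word3 i j k * word3 a b c =
  (-1) ^+ (sgn3 i a b c + sgn3 j a b c + sgn3 k a b c) *:
    (word3 a b c * word3 i j k).
Proof.
rewrite {1}/word3 -(mulrA (g i * g j)) gen_word3 -scalerAr mulrA -(mulrA (g i)) gen_word3.
rewrite -scalerAr -scalerAl scalerA mulrA gen_word3 -!scalerAl scalerA -!exprD.
rewrite /word3 !mulrA; congr (_ *: _); congr (_ ^+ _); lia.
Qed.

Lemma word3_sqr i j k : i != j -> j != k -> i != k -> word3 i j k * word3 i j k = 1.
Proof.
move=> ij jk ik; rewrite {2}/word3 !mulrA.
have -> : word3 i j k * g i = g i * word3 i j k.
  by rewrite gen_word3 /sgn3 eqxx ij ik expr2 mulrNN mulr1 scale1r.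
rewrite {1}/word3 !mulrA gen_sqr mulN1r !mulNr.
rewrite -(mulrA (g j)) (gen_comm k j) eq_sym jk expr1 scaleN1r mulrN !mulNr opprK.
by rewrite mulrA gen_sqr mulN1r mulNr gen_sqr opprK.
Qed.

End CliffordWords.

Section SquareOfThreeForm.
Variables (F : fieldType) (m : nat) (g : 'I_6 -> 'M[F]_m.+1).
Hypothesis gC : forall i j, g i * g j + g j * g i = (- (2 *+ (i == j)))%:M.
Hypothesis F2 : (2%:R : F) != 0.

Let tri : finType := ('I_6 * 'I_6 * 'I_6)%type.
Let srt (x : tri) := (x.1.1 < x.1.2)%N && (x.1.2 < x.2)%N.
Let wd (x : tri) := word3 g x.1.1 x.1.2 x.2.
Let sg (l : 'I_6) (x : tri) := sgn3 l x.1.1 x.1.2 x.2.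
Let sgw (x y : tri) := (sg x.1.1 y + sg x.1.2 y + sg x.2 y)%N.
Let nb (x y : tri) := count (fun l => odd (sg l x + sg l y)) (enum 'I_6).

(* The words of x and y commute when they share an odd number of letters; in
   dimension 6 the sum over l of the signs of g_l against their product is then
   6 if x = y, and -2 if they share one letter. *)
Lemma word3_sign_table (x y : tri) : srt x -> srt y -> 
  if x == y then nb x y = 0%N else (nb x y == 4%N) || odd (sgw x y).
Proof.
pose s (l i j k : nat) := ((l != i) + (l != j) + (l != k))%N.
pose r := iota 0 6.
have tab : all (fun i => all (fun j => all (fun k => (i < j)%N && (j < k)%N ==>
    all (fun a => all (fun b => all (fun c => (a < b)%N && (b < c)%N ==>
     (if [&& i == a, j == b & k == c] then
        count (fun l => odd (s l i j k + s l a b c)) r == 0%N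
      else (count (fun l => odd (s l i j k + s l a b c)) r == 4%N) ||
        odd (s i a b c + s j a b c + s k a b c)))
    r) r) r) r) r) r by vm_compute.
have memr (i : 'I_6) : (i : nat) \in r by rewrite mem_iota /= add0n.
move: x y => [[i j] k] [[a b] c]; rewrite /srt /= => xs ys.
have := allP (allP (allP tab _ (memr i)) _ (memr j)) _ (memr k).
rewrite xs => /allP /(_ _ (memr a)) /allP /(_ _ (memr b)) /allP /(_ _ (memr c)).
rewrite ys /= /nb /sgw /sg /sgn3 /s -!val_eqE /= !xpair_eqE -!val_eqE /= -andbA.
rewrite (_ : count _ (enum 'I_6) =
  count (fun l : nat => odd ((l != i :> nat) + (l != j :> nat) + (l != k :> nat) +
     ((l != a :> nat) + (l != b :> nat) + (l != c :> nat)))%N) r).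
  by case: ifP => // _ /eqP.
by rewrite /r -val_enum_ord count_map; apply: eq_count => l.
Qed.

Lemma sum_gen_sqr_three_form (t : 'I_6 -> 'I_6 -> 'I_6 -> F) :
  let T := \sum_(i < 6) \sum_(j < 6 | (i < j)%N) \sum_(k < 6 | (j < k)%N)
             t i j k *: (g i * g j * g k) in
  \sum_l g l * (T * T) * g l = 2%:R *: (T * T) -
   (8%:R * \sum_(i < 6) \sum_(j < 6 | (i < j)%N) \sum_(k < 6 | (j < k)%N)
    t i j k ^+ 2) *: 1.
Proof.
move=> T.
pose u (x : tri) := t x.1.1 x.1.2 x.2.
have tripE (V : nmodType) (f : 'I_6 -> 'I_6 -> 'I_6 -> V) :
  \sum_(i < 6) \sum_(j < 6 | (i < j)%N) \sum_(k < 6 | (j < k)%N) f i j k =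
  \sum_(x | srt x) f x.1.1 x.1.2 x.2.
  by rewrite pair_big_dep pair_big_dep.
have TE : T = \sum_(x | srt x) u x *: wd x by rewrite /T tripE.
rewrite tripE; clearbody T.
pose c x y : F := \sum_l (-1) ^+ (sg l x + sg l y).
have cE x y : c x y = 6%:R - 2%:R * (nb x y)%:R.
  rewrite /c /nb -sum1_count natr_sum big_enum_cond /= mulr_sumr [in RHS]big_mkcond /=.
  have -> : 6%:R = \sum_(l < 6) (1 : F) by rewrite sumr_const card_ord.
  rewrite -sumrB; apply: eq_bigr => l _; rewrite -signr_odd.
  by case: (odd _); rewrite ?expr1 ?expr0; ring.
have conjw x y : \sum_l g l * (wd x * wd y) * g l = - c x y *: (wd x * wd y).
  rewrite scaleNr /c scaler_suml -sumrN; apply: eq_bigr => l _.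
  rewrite mulrA (gen_word3 gC) // -scalerAl -(mulrA (wd x)) (gen_word3 gC) //.
  rewrite -scalerAr scalerA -!scalerAl -exprD -!mulrA (gen_sqr gC) //.
  by rewrite mulrN1 !mulrN scalerN /wd /word3 !mulrA.
have TT : T * T = \sum_(x | srt x) \sum_(y | srt y) (u x * u y) *: (wd x * wd y).
  rewrite TE mulr_suml; apply: eq_bigr => x _; rewrite mulr_sumr.
  by apply: eq_bigr => y _; rewrite -scalerAl -scalerAr scalerA.
pose off := \sum_(x | srt x) \sum_(y | srt y) (if x == y then 0 else
   (u x * u y * (- c x y - 2%:R)) *: (wd x * wd y)).
have off0 : off = 0.
  have offN : off = - off.
    rewrite {1}/off exchange_big /= -sumrN; apply: eq_bigr => x sx; rewrite -sumrN.
    apply: eq_bigr => y sy; rewrite eq_sym; case: eqP => [_|/eqP xy]; first by rewrite oppr0.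
    have := word3_sign_table sx sy; rewrite (negbTE xy) => /orP[/eqP n4|od].
      have e : - c x y - 2%:R = 0 by rewrite cE n4; ring.
      have e' : - c y x - 2%:R = 0.
        by rewrite -[RHS]e /c; under eq_bigr do rewrite addnC.
      by rewrite e e' !mulr0 !scale0r oppr0.
    rewrite [wd x * wd y](word3_word3 gC) // -signr_odd od expr1 scaleN1r scalerN opprK.
    congr (_ *: _); rewrite (mulrC (u y)); congr (_ * (- _ - _)).
    by apply: eq_bigr => l _; rewrite addnC.
  have : 2%:R *: off = 0 by rewrite scaler_nat mulr2n {1}offN addNr.
  by rewrite -[RHS](scaler0 _ 2%:R); move/(scalerI F2).
have -> : \sum_l g l * (T * T) * g l = \sum_(x | srt x) \sum_(y | srt y)
     (u x * u y) *: (- c x y *: (wd x * wd y)).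
  rewrite TT; under eq_bigr => l _.
    rewrite mulr_sumr mulr_suml; under eq_bigr => x _ do
      (rewrite mulr_sumr mulr_suml; under eq_bigr => y _ do rewrite -scalerAr -scalerAl).
    over.
  rewrite exchange_big; apply: eq_bigr => x _; rewrite exchange_big.
  by apply: eq_bigr => y _; rewrite -scaler_sumr conjw.
apply/esym/eqP; rewrite subr_eq addrC -subr_eq; apply/eqP.
rewrite TT scaler_sumr -sumrB mulr_sumr scaler_suml.
rewrite -[LHS]addr0 -[X in _ + X]off0 /off -big_split; apply: eq_bigr => x sx /=.
rewrite scaler_sumr -sumrB -big_split /= (bigD1 x) //= eqxx addr0 big1 => [|y].
  have xx : nb x x = 0%N by have := word3_sign_table sx sx; rewrite eqxx.
  case/andP: (sx) => lt1 lt2; have lt3 := ltn_trans lt1 lt2.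
  rewrite (word3_sqr gC) //; try by rewrite -val_eqE ltn_eqF.
  rewrite cE xx !scalerA -scalerBl addr0 /u; congr (_ *: _); ring.
rewrite eq_sym => /andP[sy /negbTE xy]; rewrite xy !scalerA -scalerBl -scalerDl.
by apply/eqP; rewrite scaler_eq0; apply/orP; left; apply/eqP; ring.
Qed.

End SquareOfThreeForm.

Section HermitianForm.
Variables (C : numClosedFieldType) (m : nat) (Q : 'M[C]_m).
Implicit Types (u v w : 'cV[C]_m) (B : 'M[C]_m).

Definition herm u v : C := ((Q *m u) ^t* *m (Q *m v)) 0 0.

Lemma hermE u v : herm u v = \sum_i ((Q *m u) i 0)^* * (Q *m v) i 0.
Proof. by rewrite /herm mxE; apply: eq_bigr => i _; rewrite !mxE. Qed.

Lemma hermDl u v w : herm (u + v) w = herm u w + herm v w.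
Proof. by rewrite /herm mulmxDr linearD /= map_mxD mulmxDl mxE. Qed.

Lemma hermDr u v w : herm w (u + v) = herm w u + herm w v.
Proof. by rewrite /herm !mulmxDr mxE. Qed.

Lemma hermZr a u v : herm u (a *: v) = a * herm u v.
Proof. by rewrite /herm -!scalemxAr mxE. Qed.

Lemma hermC u v : (herm u v)^* = herm v u.
Proof.
by rewrite !hermE rmorph_sum; apply: eq_bigr => i _; rewrite rmorphM /= conjCK mulrC.
Qed.

Lemma hermZl a u v : herm (a *: u) v = a^* * herm u v.
Proof. by rewrite -hermC hermZr rmorphM /= hermC. Qed.

Lemma hermNr u v : herm u (- v) = - herm u v.
Proof. by rewrite -scaleN1r hermZr mulN1r. Qed.

Lemma hermNl u v : herm (- u) v = - herm u v.
Proof. by rewrite -hermC hermNr rmorphN /= hermC. Qed.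

Lemma hermBr u v w : herm w (u - v) = herm w u - herm w v.
Proof. by rewrite hermDr hermNr. Qed.

Lemma hermBl u v w : herm (u - v) w = herm u w - herm v w.
Proof. by rewrite hermDl hermNl. Qed.

Lemma herm0r u : herm u 0 = 0.
Proof. by rewrite -(scale0r 0) hermZr mul0r. Qed.

Lemma herm0l u : herm 0 u = 0.
Proof. by rewrite -hermC herm0r rmorph0. Qed.

Lemma herm_sumr (I : Type) (s : seq I) (P : pred I) (f : I -> 'cV[C]_m) u :
  herm u (\sum_(i <- s | P i) f i) = \sum_(i <- s | P i) herm u (f i).
Proof. by elim/big_rec2: _ => [|i x y _ <-]; rewrite ?herm0r ?hermDr. Qed.

Lemma herm_suml (I : Type) (s : seq I) (P : pred I) (f : I -> 'cV[C]_m) u :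
  herm (\sum_(i <- s | P i) f i) u = \sum_(i <- s | P i) herm (f i) u.
Proof. by elim/big_rec2: _ => [|i x y _ <-]; rewrite ?herm0l ?hermDl. Qed.

Hypothesis Qu : Q \in unitmx.

Lemma herm_eq0 u : herm u u = 0 -> u = 0.
Proof.
rewrite hermE => /eqP; rewrite psumr_eq0 => [/allP h|i _]; last first.
  by rewrite mulrC mul_conjC_ge0.
have Qu0 : Q *m u = 0.
  apply/colP => i; have := h i (mem_index_enum i).
  by rewrite mulrC mul_conjC_eq0 [in RHS]mxE => /eqP.
by rewrite -[u](mulKmx Qu) Qu0 mulmx0.
Qed.

(* The two eigenvalues c and - c already exhaust the trace of B^2. *)
Lemma selfadjoint_spectrum B (c : C) (v v' : 'cV[C]_m) :
  (forall u w, herm (B *m u) w = herm u (B *m w)) ->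
  c \is Num.real -> c != 0 -> \tr (B *m B) = 2 * c ^+ 2 ->
  v != 0 -> B *m v = c *: v -> v' != 0 -> B *m v' = - c *: v' ->
  (forall u, B *m u = c *: u -> exists z, u = z *: v) /\
  B *m B *m B = c ^+ 2 *: B.
Proof.
move=> Bsa cR c0 trB v0 Bv v'0 Bv'.
have QB : (Q *m B) ^t* *m Q = Q ^t* *m (Q *m B).
  apply/matrixP => i j.
  have := Bsa (delta_mx i 0) (delta_mx j 0); rewrite /herm.
  have e (X Y : 'M[C]_m) : ((X *m delta_mx i (0 : 'I_1)) ^t* *m (Y *m delta_mx j (0 : 'I_1))) 0 0
      = (X ^t* *m Y) i j.
    rewrite !mxE; apply: eq_bigr => k _; rewrite -!colE !mxE //.
  by rewrite (mulmxA Q B (delta_mx i 0)) (mulmxA Q B (delta_mx j 0)) !e.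
pose B' := Q *m B *m invmx Q.
have B'h : B' \is hermsymmx.
  apply/is_hermitianmxP; rewrite expr0 scale1r /B' trmx_mul map_mxM.
  have QV : (invmx Q)^t* *m Q ^t* = 1%:M.
    by rewrite -map_mxM -trmx_mul mulmxV // trmx1 map_mx1.
  by apply: (canLR (mulmxK Qu)); rewrite -mulmxA QB (mulmxA (invmx Q ^t*)) QV mul1mx.
have /hermitian_normalmx /orthomx_spectralP := B'h.
have := hermitian_spectral_diag_real B'h.
have := spectral_unit B'.
move: (spectral_diag B') (spectralmx B') => d P Pu0 dR.
rewrite -/B' => B'E; pose W := P *m Q.
have Wu : W \in unitmx by rewrite unitmx_mul Pu0.
have BE : B = invmx W *m diag_mx d *m W.
  have WE : invmx W = invmx Q *m invmx P.
    apply: (canRL (mulKmx Qu)); rewrite -[RHS]mulmx1 -(mulmxV Wu) /W.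
    by rewrite -(mulmxA P) mulKmx.
  transitivity (invmx Q *m B' *m Q); last by rewrite {1}B'E WE /W !mulmxA.
  by rewrite /B' !mulmxA mulVmx // mul1mx mulmxKV.
clearbody W; have dsq i : 0 <= d 0 i ^+ 2 by rewrite real_exprn_even_ge0 // (mxOverP dR).
have eig (u : 'cV[C]_m) (a : C) i : B *m u = a *: u -> (W *m u) i 0 != 0 -> d 0 i = a.
  move=> Bu ui0; have : (W *m (B *m u)) i 0 = a * (W *m u) i 0.
    by rewrite Bu -scalemxAr mxE.
  rewrite BE -!mulmxA mulKVmx // mul_diag_mx mxE.
  exact: mulIf.
have nz (u : 'cV[C]_m) : u != 0 -> exists i, (W *m u) i 0 != 0.
  move=> u0; apply/existsP; apply: contra_neqT u0 => /existsPn h.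
  rewrite -[u](mulKmx Wu); rewrite (_ : W *m u = 0) ?mulmx0 //.
  by apply/colP => i; rewrite [RHS]mxE; apply/eqP; have := h i; rewrite negbK.
have [i0 vi0] := nz _ v0; have [j0 vj0] := nz _ v'0.
have di0 := eig _ _ _ Bv vi0; have dj0 := eig _ _ _ Bv' vj0.
have cN : c != - c by rewrite -addr_eq0 -mulr2n mulrn_eq0.
have ij0 : j0 != i0.
  by apply: contra_neq cN => ij; rewrite -dj0 ij di0.
have trd : \sum_i d 0 i ^+ 2 = 2 * c ^+ 2.
  rewrite -trB BE !mulmxA mulmxK // -[_ *m diag_mx d *m _ *m _]mulmxA mxtrace_mulC.
  rewrite mulmxA mulmxK // /mxtrace; apply: eq_bigr => i _.
  by rewrite mul_diag_mx !mxE eqxx mulr1n expr2.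
have d0 i : i != i0 -> i != j0 -> d 0 i = 0.
  move=> ii0 ij; move: trd; rewrite (bigD1 i0) //= (bigD1 j0) //= di0 dj0 sqrrN.
  rewrite mulr_natl mulr2n => /addrI; rewrite -[RHS]addr0 => /addrI.
  move=> /psumr_eq0P h; have := h (fun k _ => dsq k) i.
  by rewrite ii0 ij => /(_ isT)/eqP; rewrite sqrf_eq0 => /eqP.
split=> [u Bu|]; last first.
  have d3 : diag_mx d *m diag_mx d *m diag_mx d = c ^+ 2 *: diag_mx d.
    apply/matrixP => i j; rewrite !mulmx_diag !mxE.
    case: (eqVneq i i0) => [->|ii0]; first by rewrite di0; case: eqP => _; rewrite ?mulr1n ?mulr0n ?mulr0 //; ring.
    case: (eqVneq i j0) => [->|jj0]; first by rewrite dj0; case: eqP => _; rewrite ?mulr1n ?mulr0n ?mulr0 //; ring.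
    by rewrite d0 // !mul0r !mul0rn mulr0.
  rewrite BE !mulmxA mulmxK // mulmxK // -!mulmxA (mulmxA (diag_mx d) _ W) .
  by rewrite (mulmxA (diag_mx d)) mulmxA d3 -scalemxAl -scalemxAr !mulmxA.
have supp i : i != i0 -> (W *m u) i 0 = 0.
  move=> ii0; apply/eqP; apply: contraT => /(eig _ _ _ Bu) di.
  have [ij|ij] := eqVneq i j0; first by move: cN; rewrite -dj0 -ij di eqxx.
  by move: c0; rewrite -di (d0 _ ii0 ij) eqxx.
have suppv i : i != i0 -> (W *m v) i 0 = 0.
  move=> ii0; apply/eqP; apply: contraT => /(eig _ _ _ Bv) di.
  have [ij|ij] := eqVneq i j0; first by move: cN; rewrite -dj0 -ij di eqxx.
  by move: c0; rewrite -di (d0 _ ii0 ij) eqxx.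
exists ((W *m u) i0 0 / (W *m v) i0 0).
apply: (can_inj (mulKmx Wu)); apply/colP => i; rewrite -scalemxAr [RHS]mxE.
have [->|ii0] := eqVneq i i0; first by rewrite divfK.
by rewrite (supp i ii0) (suppv i ii0) mulr0.
Qed.

End HermitianForm.

Section Unitarization.
Variables (C : numClosedFieldType) (m n : nat) (g : 'I_n -> 'M[C]_m.+1).
Hypothesis gC : forall i j, g i * g j + g j * g i = (- (2 *+ (i == j)))%:M.
Implicit Types (H : 'M[C]_m.+1) (v : 'cV[C]_m.+1).

Let posdef H := H ^t* = H /\ forall v, v != 0 -> 0 < (v ^t* *m H *m v) 0 0.

Let two0 : (2%:R : C) != 0. Proof. by rewrite pnatr_eq0. Qed.

(* Adding g_i^* H g_i to H makes it invariant under g_i, since g_i^2 = -1, and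
   keeps the invariance under the generators already treated. *)
Lemma clifford_invariant_form :
  exists H, posdef H /\ forall i, (g i) ^t* *m H *m g i = H.
Proof.
suff /(_ (enum 'I_n)) [H [pH invH]] : forall s : seq 'I_n,
    exists H, posdef H /\ forall i, i \in s -> (g i) ^t* *m H *m g i = H.
  by exists H; split=> // i; apply: invH; rewrite mem_enum.
elim=> [|i s [H [[hH pH] invH]]].
  exists 1%:M; split=> //; split=> [|v v0]; first by rewrite trmx1 map_mx1.
  rewrite mulmx1 mxE lt0r; apply/andP; split; last first.
    by apply: sumr_ge0 => k _; rewrite !mxE mulrC mul_conjC_ge0.
  apply: contra v0; rewrite psumr_eq0 => [/allP h|k _]; last first.
    by rewrite !mxE mulrC mul_conjC_ge0.
  apply/eqP/colP => k; have := h k (mem_index_enum k).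
  by rewrite !mxE mulrC mul_conjC_eq0 => /eqP.
have adjM (A B : 'M[C]_m.+1) : (A *m B) ^t* = B ^t* *m A ^t*.
  by rewrite trmx_mul map_mxM.
have adjN (A : 'M[C]_m.+1) : (- A) ^t* = - A ^t*.
  by apply/matrixP => a b; rewrite !mxE rmorphN.
have adj1 : (1%:M : 'M[C]_m.+1) ^t* = 1%:M by rewrite trmx1 map_mx1.
exists (H + (g i) ^t* *m H *m g i); split; last first.
  move=> j; rewrite inE mulmxDr mulmxDl => js.
  have e : (g j)^t* *m ((g i)^t* *m H *m g i) *m g j =
           (g i *m g j)^t* *m H *m (g i *m g j) by rewrite adjM !mulmxA.
  rewrite e; have [ji|ji] := eqVneq j i.
    rewrite ji addrC; congr (_ + _).
    have -> : g i *m g i = - 1%:M by apply: (gen_sqr gC two0 i).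
    by rewrite adjN adj1 mulmxN mulNmx mul1mx mulmx1 opprK.
  move: js; rewrite (negbTE ji) /= => js; rewrite invH //; congr (_ + _).
  have -> : g i *m g j = - (g j *m g i).
    by apply/eqP; rewrite -addr_eq0 [X in X == 0](gC i j) (eq_sym i) (negbTE ji) mulr0n oppr0 raddf0.
  rewrite adjN mulmxN !mulNmx opprK adjM.
  by rewrite -{2}(invH j js) !mulmxA.
split=> [|v v0].
  by rewrite linearD /= map_mxD hH !adjM trmxCK hH !mulmxA.
rewrite mulmxDr mulmxDl mxE ltr_pwDl ?pH //.
have -> : v ^t* *m ((g i)^t* *m H *m g i) *m v = (g i *m v)^t* *m H *m (g i *m v).
  by rewrite trmx_mul map_mxM !mulmxA.
have [->|gv] := eqVneq (g i *m v) 0; first by rewrite mulmx0 mxE.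
exact/ltW/pH.
Qed.

Lemma clifford_skew_form :
  exists2 Q : 'M[C]_m.+1, Q \in unitmx &
    forall i u v, herm Q (g i *m u) v = - herm Q u (g i *m v).
Proof.
have [H [[hH pH] invH]] := clifford_invariant_form.
suff [Q Qu QH] : exists2 Q : 'M[C]_m.+1, Q \in unitmx & Q ^t* *m Q = H.
  exists Q => // i u v; rewrite /herm !trmx_mul !map_mxM.
  have e (a b : 'cV[C]_m.+1) : a ^t* *m Q ^t* *m (Q *m b) = a ^t* *m H *m b.
    by rewrite -QH !mulmxA.
  have -> : u ^t* *m (g i)^t* *m Q ^t* *m (Q *m v) = u ^t* *m ((g i)^t* *m H) *m v.
    by rewrite -QH !mulmxA.
  rewrite e; have -> : (g i)^t* *m H = - (H *m g i).
    have h := gen_sqr gC two0 i.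
    rewrite -{2}(invH i) -mulmxA; have -> : g i *m g i = - 1%:M by rewrite -h.
    by rewrite mulmxN mulmx1 opprK.
  by rewrite mulmxN mulNmx mxE !mulmxA.
have Hh : H \is hermsymmx.
  by apply/is_hermitianmxP; rewrite expr0 scale1r hH.
have /hermitian_normalmx /orthomx_spectralP := Hh.
have := hermitian_spectral_diag_real Hh; have := spectral_unitarymx H.
move: (spectral_diag H) (spectralmx H) => d P Pu dR HE.
have Pun := unitarymx_unit Pu.
have d_gt0 i : 0 < d 0 i.
  have e0 : (delta_mx i 0 : 'cV[C]_m.+1) != 0.
    by apply/eqP => /colP /(_ i); rewrite !mxE !eqxx => /eqP; rewrite oner_eq0.
  have v0 : invmx P *m (delta_mx i 0 : 'cV[C]_m.+1) != 0.
    by apply: contra e0 => /eqP h; rewrite -[delta_mx i 0](mulKVmx Pun) h mulmx0.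
  have := pH _ v0; rewrite HE invmx_unitary // trmx_mul map_mxM trmxCK.
  rewrite -!mulmxA (mulmxA P (P ^t*)) (unitarymxP Pu) mul1mx (mulmxA P (P ^t*)) (unitarymxP Pu) mul1mx.
  by rewrite mul_diag_mx mxE (bigD1 i) //= !mxE !eqxx mulr1 rmorph1 mul1r big1 ?addr0 // => k ki; rewrite !mxE (negbTE ki) mulr0 mulr0.
pose r := \row_i sqrtC (d 0 i).
exists (diag_mx r *m P).
  rewrite unitmx_mul Pun andbT unitmxE det_diag unitfE.
  apply/prodf_neq0 => i _; rewrite mxE sqrtC_eq0; exact: lt0r_neq0.
rewrite HE trmx_mul map_mxM invmx_unitary // !mulmxA; congr (_ *m _).
rewrite -mulmxA; congr (_ *m _); apply/matrixP => i j.
rewrite tr_diag_mx map_diag_mx mulmx_diag !mxE; case: eqVneq => [->|_]; rewrite ?mulr0n // !mulr1n.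
rewrite -[LHS]/((sqrtC (d 0 j))^* * sqrtC (d 0 j)).
have /CrealP -> : sqrtC (d 0 j) \is Num.real by rewrite realE sqrtC_ge0 ltW.
by rewrite -expr2 sqrtCK.
Qed.

End Unitarization.

Section CliffordForms.
Variables (R : realType) (n m : nat) (gamma : 'I_n -> 'M[R[i]]_m.+1).
Hypothesis Hgamma : clifford_rep gamma.

Let gC (i j : 'I_n) : gamma i * gamma j + gamma j * gamma i =
  (- (2 *+ (i == j)))%:M := Hgamma i j.

Lemma complex_two_neq0 : (2%:R : R[i]) != 0.
Proof. by rewrite pnatr_eq0. Qed.
Local Notation two0 := complex_two_neq0.

Lemma conjC_real (x : R) : (x%:C%C)^* = x%:C%C.
Proof. by apply/CrealP; apply/complex_realP; exists x. Qed.

Lemma complexR_eq0 (x : R) : (x%:C%C == 0 :> R[i]) = (x == 0).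
Proof. by rewrite -(inj_eq (@complexI R)) rmorph0. Qed.

Lemma gamma_anticomm i j : i != j -> gamma i * gamma j = - (gamma j * gamma i).
Proof.
move=> ij; apply/eqP; rewrite -addr_eq0 [X in X == 0]gC (negbTE ij) mulr0n.
by rewrite oppr0 raddf0.
Qed.

Lemma cl2_full (w : 'I_n -> 'I_n -> R) : (forall i j, w i j = - w j i) ->
  2%:R *: cl2 gamma w = \sum_i \sum_j (w i j)%:C%C *: (gamma i * gamma j).
Proof.
move=> wA; have w0 i : w i i = 0 by have h := wA i i; lra.
rewrite sum_offdiag2 ?scaler_nat // => [i j|i]; last by rewrite w0 scale0r.
have [->//|ij] := eqVneq i j.
by rewrite wA rmorphN scaleNr -scalerN -gamma_anticomm // eq_sym.
Qed.

Lemma sum_delta_scale (V : lmodType R[i]) i (f : 'I_n -> V) :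
  \sum_k (k == i)%:R *: f k = f i.
Proof.
rewrite (bigD1 i) //= eqxx scale1r big1 ?addr0 // => k /negbTE ->.
by rewrite scale0r.
Qed.

Lemma cl2_comm (w : 'I_n -> 'I_n -> R) i : (forall i j, w i j = - w j i) ->
  cl2 gamma w * gamma i - gamma i * cl2 gamma w = 2%:R *: cl1 gamma (w i).
Proof.
move=> wA; apply: (scalerI two0).
rewrite scalerBr scalerAl scalerAr (cl2_full wA) mulr_suml mulr_sumr -sumrB.
have -> : \sum_k (((\sum_j (w k j)%:C%C *: (gamma k * gamma j)) * gamma i) -
    gamma i * \sum_j (w k j)%:C%C *: (gamma k * gamma j)) =
  \sum_k \sum_j (w k j)%:C%C *: (2%:R *: ((k == i)%:R *: gamma j - (j == i)%:R *: gamma k)).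
  apply: eq_bigr => k _; rewrite mulr_suml mulr_sumr -sumrB; apply: eq_bigr => j _.
  by rewrite -scalerAl -scalerAr -scalerBr (word2_comm gC).
have -> : \sum_k \sum_j (w k j)%:C%C *:
      (2%:R *: ((k == i)%:R *: gamma j - (j == i)%:R *: gamma k)) =
   \sum_k \sum_j 2%:R *: ((k == i)%:R *: ((w k j)%:C%C *: gamma j)) -
   \sum_k \sum_j 2%:R *: ((j == i)%:R *: ((w k j)%:C%C *: gamma k)).
  rewrite -sumrB; apply: eq_bigr => k _; rewrite -sumrB; apply: eq_bigr => j _.
  move: (gamma j) (gamma k) => a b; apply/matrixP => x y; rewrite !mxE; ring.
have -> : \sum_k \sum_j 2%:R *: ((k == i)%:R *: ((w k j)%:C%C *: gamma j)) =
    2%:R *: cl1 gamma (w i).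
  under eq_bigr do rewrite -!scaler_sumr.
  by rewrite -scaler_sumr sum_delta_scale.
have -> : \sum_k \sum_j 2%:R *: ((j == i)%:R *: ((w k j)%:C%C *: gamma k)) =
    - (2%:R *: cl1 gamma (w i)).
  under eq_bigr do rewrite -scaler_sumr sum_delta_scale.
  rewrite -scaler_sumr -scalerN -sumrN; congr (_ *: _); apply: eq_bigr => k _.
  by rewrite (wA k i) rmorphN scaleNr.
by rewrite opprK -mulr2n -scaler_nat.
Qed.

Lemma cl3_full (t : 'I_n -> 'I_n -> 'I_n -> R) :
  (forall i j k, t i j k = - t j i k) -> (forall i j k, t i j k = - t i k j) ->
  6%:R *: cl3 gamma t =
  \sum_i \sum_j \sum_k (t i j k)%:C%C *: (gamma i * gamma j * gamma k).
Proof.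
move=> t12 t23; have t0 i k : t i i k = 0 by have h := t12 i i k; lra.
rewrite sum_offdiag3 ?scaler_nat // => [i j k|i j k|i k]; last by rewrite t0 scale0r.
  have [->//|ij] := eqVneq i j.
  by rewrite t12 rmorphN scaleNr -scalerN -mulNr -gamma_anticomm // eq_sym.
have [->//|ij] := eqVneq j k.
by rewrite t23 rmorphN scaleNr -scalerN -!mulrA -mulrN -gamma_anticomm // eq_sym.
Qed.

Lemma cl3_anticomm (t : 'I_n -> 'I_n -> 'I_n -> R) l :
  (forall i j k, t i j k = - t j i k) -> (forall i j k, t i j k = - t i k j) ->
  cl3 gamma t * gamma l + gamma l * cl3 gamma t = - 2%:R *: cl2 gamma (t l).
Proof.
move=> t12 t23; have six0 : (6%:R : R[i]) != 0 by rewrite pnatr_eq0.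
apply: (scalerI six0); rewrite scalerDr scalerAl scalerAr (cl3_full t12 t23).
have -> : 6%:R *: (- 2%:R *: cl2 gamma (t l)) =
    - 2%:R *: (3%:R *: (2%:R *: cl2 gamma (t l))).
  by rewrite !scalerA; congr (_ *: _); ring.
rewrite cl2_full; last by move=> i j; rewrite t23.
have tc i j k : t j k i = t i j k by rewrite t23 t12 opprK.
pose P j k := (t l j k)%:C%C *: (gamma j * gamma k).
rewrite !mulr_suml !mulr_sumr -big_split /=.
have -> : \sum_i (((\sum_j \sum_k (t i j k)%:C%C *: (gamma i * gamma j * gamma k)) * gamma l)
    + (gamma l * \sum_j \sum_k (t i j k)%:C%C *: (gamma i * gamma j * gamma k))) =
  \sum_i \sum_j \sum_k - 2%:R *:
     ((i == l)%:R *: ((t i j k)%:C%C *: (gamma j * gamma k)) -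
      (j == l)%:R *: ((t i j k)%:C%C *: (gamma i * gamma k)) +
      (k == l)%:R *: ((t i j k)%:C%C *: (gamma i * gamma j))).
  apply: eq_bigr => i _; rewrite !mulr_suml !mulr_sumr -big_split; apply: eq_bigr => j _.
  rewrite !mulr_suml !mulr_sumr -big_split; apply: eq_bigr => k _ /=.
  rewrite -scalerAl -scalerAr -scalerDr (word3_anticomm gC).
  move: (gamma j * gamma k) (gamma i * gamma k) (gamma i * gamma j) => a b c.
  by apply/matrixP => x y; rewrite !mxE; ring.
have Z3 a (f : 'I_n -> 'I_n -> 'I_n -> 'M[R[i]]_m.+1) :
    \sum_i \sum_j \sum_k a *: f i j k = a *: \sum_i \sum_j \sum_k f i j k.
  rewrite scaler_sumr; apply: eq_bigr => i _; rewrite scaler_sumr.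
  by apply: eq_bigr => j _; rewrite scaler_sumr.
have D3 (f1 f2 f3 : 'I_n -> 'I_n -> 'I_n -> 'M[R[i]]_m.+1) :
    \sum_i \sum_j \sum_k (f1 i j k - f2 i j k + f3 i j k) =
    \sum_i \sum_j \sum_k f1 i j k - \sum_i \sum_j \sum_k f2 i j k +
    \sum_i \sum_j \sum_k f3 i j k.
  rewrite -sumrB -big_split; apply: eq_bigr => i _.
  rewrite -sumrB -big_split; apply: eq_bigr => j _.
  by rewrite -sumrB -big_split.
rewrite Z3 D3; congr (_ *: _).
have -> : \sum_i \sum_j \sum_k (i == l)%:R *: ((t i j k)%:C%C *: (gamma j * gamma k)) =
    \sum_j \sum_k P j k.
  rewrite -(sum_delta_scale l (fun i => \sum_j \sum_k (t i j k)%:C%C *: (gamma j * gamma k))).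
  apply: eq_bigr => i _; rewrite scaler_sumr; apply: eq_bigr => j _.
  by rewrite scaler_sumr.
have -> : \sum_i \sum_j \sum_k (j == l)%:R *: ((t i j k)%:C%C *: (gamma i * gamma k)) =
    - \sum_j \sum_k P j k.
  rewrite -sumrN; apply: eq_bigr => i _.
  under eq_bigr do rewrite -scaler_sumr.
  rewrite sum_delta_scale -sumrN; apply: eq_bigr => k _.
  by rewrite t12 rmorphN scaleNr.
have -> : \sum_i \sum_j \sum_k (k == l)%:R *: ((t i j k)%:C%C *: (gamma i * gamma j)) =
    \sum_j \sum_k P j k.
  apply: eq_bigr => i _; apply: eq_bigr => j _.
  by rewrite sum_delta_scale /P tc.
by rewrite opprK scaler_nat !mulrS mulr0n addr0 addrA.
Qed.

End CliffordForms.

#[local] Opaque herm.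

Section SkewForms.
Variables (R : realType) (n m : nat) (gamma : 'I_n -> 'M[R[i]]_m.+1).
Variable Q : 'M[R[i]]_m.+1.
Hypothesis Hgamma : clifford_rep gamma.
Hypothesis Qskew : forall i u v, herm Q (gamma i *m u) v = - herm Q u (gamma i *m v).

Lemma herm_cl1 w u v : herm Q (cl1 gamma w *m u) v = - herm Q u (cl1 gamma w *m v).
Proof.
rewrite /cl1 !mulmx_suml herm_suml herm_sumr -sumrN; apply: eq_bigr => i _.
by rewrite -!scalemxAl hermZl hermZr conjC_real Qskew mulrN.
Qed.

Lemma herm_cl2 w u v : herm Q (cl2 gamma w *m u) v = - herm Q u (cl2 gamma w *m v).
Proof.
rewrite /cl2 !mulmx_suml herm_suml herm_sumr -sumrN; apply: eq_bigr => i _.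
rewrite !mulmx_suml herm_suml herm_sumr -sumrN; apply: eq_bigr => j ij.
rewrite -!scalemxAl hermZl hermZr conjC_real -!mulmxA !Qskew opprK -mulrN -hermNr.
rewrite !mulmxA -mulNmx -[gamma j *m gamma i]/(gamma j * gamma i).
by rewrite (gamma_anticomm Hgamma) // -val_eqE gtn_eqF.
Qed.

Lemma herm_cl3 t u v : herm Q (cl3 gamma t *m u) v = herm Q u (cl3 gamma t *m v).
Proof.
rewrite /cl3 !mulmx_suml herm_suml herm_sumr; apply: eq_bigr => i _.
rewrite !mulmx_suml herm_suml herm_sumr; apply: eq_bigr => j ij.
rewrite !mulmx_suml herm_suml herm_sumr; apply: eq_bigr => k jk.
rewrite -!scalemxAl hermZl hermZr conjC_real -!mulmxA !Qskew opprK -hermNr.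
congr (_ * herm Q _ _); rewrite !mulmxA -mulNmx; congr (_ *m _).
rewrite -[LHS]/(- (gamma k * gamma j * gamma i)) -[RHS]/(gamma i * gamma j * gamma k).
have anti := gamma_anticomm Hgamma.
rewrite -(mulrA (gamma k) (gamma j)) (anti j i) ?mulrN ?opprK; last by rewrite -val_eqE gtn_eqF.
rewrite (mulrA (gamma k)) (anti k i) ?mulNr; last by rewrite -val_eqE gtn_eqF // (ltn_trans ij).
rewrite -(mulrA (gamma i) (gamma k)) (anti k j) ?mulrN ?opprK ?mulrA //.
by rewrite -val_eqE gtn_eqF.
Qed.

End SkewForms.

Section Pointwise.
Variables (R : realType) (gamma : 'I_6 -> 'M[R[i]]_8) (Q : 'M[R[i]]_8).
Hypothesis Hgamma : clifford_rep gamma.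
Hypothesis Qu : Q \in unitmx.
Hypothesis Qskew : forall i u v, herm Q (gamma i *m u) v = - herm Q u (gamma i *m v).
Variables (t : 'I_6 -> 'I_6 -> 'I_6 -> R) (c : R).
Hypothesis c0 : c != 0.
Hypothesis tc : 4 * (\sum_(i < 6) \sum_(j < 6 | (i < j)%N) \sum_(k < 6 | (j < k)%N)
    t i j k ^+ 2) = c ^+ 2.

Let T : 'M[R[i]]_8 := cl3 gamma t.

Lemma sum_conj_sqr_three_form :
  \sum_l gamma l *m (T *m T) *m gamma l = 2%:R *: (T *m T) - (2 * c ^+ 2)%:C%C%:M.
Proof.
rewrite [LHS](sum_gen_sqr_three_form (m := 7) Hgamma (complex_two_neq0 R)
  (fun i j k => (t i j k)%:C%C)).
congr (_ - _); rewrite -[RHS]scalemx1; congr (_ *: _).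
rewrite -tc mulrA rmorphM rmorph_sum /=; congr (_ * _).
  by rewrite -natrM rmorph_nat.
apply: eq_bigr => i _; rewrite rmorph_sum; apply: eq_bigr => j _.
by rewrite rmorph_sum; apply: eq_bigr => k _; rewrite rmorphXn.
Qed.

Lemma trace_sqr_three_form : \tr (T *m T) = 2%:R * c%:C%C ^+ 2.
Proof.
have := congr1 mxtrace sum_conj_sqr_three_form.
rewrite linear_sum /= linearB linearZ /= mxtrace_scalar.
have -> : \sum_l \tr (gamma l *m (T *m T) *m gamma l) = - 6%:R * \tr (T *m T).
  transitivity (\sum_(l < 6) - \tr (T *m T)); last first.
    by rewrite sumr_const card_ord mulNrn mulNr mulr_natl.
  apply: eq_bigr => l _.
  rewrite mxtrace_mulC !mulmxA -[gamma l *m gamma l]/(gamma l * gamma l).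
  by rewrite (gen_sqr (m := 7) Hgamma (complex_two_neq0 R)) -mulmxA -[X in \tr X = _]/(-1 * (T * T)) mulN1r linearN.
move=> e; have : (- 8%:R) * \tr (T *m T) = - 8%:R * (2%:R * c%:C%C ^+ 2).
  have -> : - 8%:R = - 6%:R - 2%:R :> R[i] by ring.
  rewrite mulrBl e addrC addKr.
  by rewrite rmorphM rmorphXn rmorph_nat -mulr_natr; ring.
by apply: mulfI; rewrite oppr_eq0 pnatr_eq0.
Qed.

Lemma sum_conj_three_form : \sum_l gamma l *m T *m gamma l = 0.
Proof.
rewrite /T /cl3.
under eq_bigr do rewrite mulmx_sumr mulmx_suml.
rewrite exchange_big big1 // => i _.
under eq_bigr do rewrite mulmx_sumr mulmx_suml.
rewrite exchange_big big1 // => j ij.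
under eq_bigr do rewrite mulmx_sumr mulmx_suml.
rewrite exchange_big big1 // => k jk.
pose s (l : 'I_6) : R[i] := 2%:R * (l == i)%:R + 2%:R * (l == j)%:R + 2%:R * (l == k)%:R - 1.
have e l : gamma l *m ((t i j k)%:C%C *: (gamma i *m gamma j *m gamma k)) *m gamma l
   = - s l *: ((t i j k)%:C%C *: (gamma i *m gamma j *m gamma k)).
  rewrite -scalemxAr -scalemxAl scalerA mulrC -scalerA; congr (_ *: _).
  have := gen_word3 (m := 7) Hgamma l i j k; rewrite /word3.
  rewrite -[X in X = _]/(gamma l *m (gamma i *m gamma j *m gamma k)) => ->.
  rewrite -scalemxAl -[X in _ *: X]/(gamma i * gamma j * gamma k * gamma l * gamma l).
  rewrite -(mulrA _ (gamma l)) (gen_sqr (m := 7) Hgamma (complex_two_neq0 R)) mulrN1 scalerN -scaleNr.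
  congr (- _ *: _); rewrite /sgn3 /s.
  have ijF : (i == j) = false by rewrite -val_eqE ltn_eqF.
  have jkF : (j == k) = false by rewrite -val_eqE ltn_eqF.
  have ikF : (i == k) = false by rewrite -val_eqE ltn_eqF // (ltn_trans ij).
  have [->|li] := eqVneq l i; first by rewrite ijF ikF /=; ring.
  have [->|lj] := eqVneq l j; first by rewrite jkF /=; ring.
  by case: eqVneq => _ /=; ring.
under eq_bigr do rewrite e.
rewrite -scaler_suml sumrN /s !big_split /= sumrN -!mulr_sumr.
have d (a : 'I_6) : \sum_(l < 6) ((l == a)%:R : R[i]) = 1.
  by rewrite (bigD1 a) //= eqxx big1 ?addr0 // => l /negbTE ->.
rewrite !d sumr_const card_ord.
by rewrite (_ : - _ = 0) ?scale0r //; ring.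
Qed.

Lemma three_form_eigen (v v' : 'cV[R[i]]_8) :
  v != 0 -> T *m v = c%:C%C *: v -> v' != 0 -> T *m v' = - c%:C%C *: v' ->
  (forall u, T *m u = c%:C%C *: u -> exists z, u = z *: v) /\
  T *m T *m T = c%:C%C ^+ 2 *: T.
Proof.
move=> v0 Tv v'0 Tv'.
apply: (selfadjoint_spectrum Qu _ _ _ trace_sqr_three_form v0 Tv v'0 Tv').
- exact: herm_cl3 Hgamma Qskew t.
- by apply/complex_realP; exists c.
- by rewrite complexR_eq0.
Qed.

End Pointwise.

Section KillingAlgebra.
Variables (R : realType) (gamma : 'I_6 -> 'M[R[i]]_8) (Q : 'M[R[i]]_8).
Hypothesis Hgamma : clifford_rep gamma.
Hypothesis Qu : Q \in unitmx.
Hypothesis Qskew : forall i u v, herm Q (gamma i *m u) v = - herm Q u (gamma i *m v).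
Variables (t : 'I_6 -> 'I_6 -> 'I_6 -> R) (c : R).
Hypothesis c0 : c != 0.
Hypothesis tc : 4 * (\sum_(i < 6) \sum_(j < 6 | (i < j)%N) \sum_(k < 6 | (j < k)%N)
    t i j k ^+ 2) = c ^+ 2.
Let T : 'M[R[i]]_8 := cl3 gamma t.
Variables (v v' : 'cV[R[i]]_8).
Hypotheses (v0 : v != 0) (Tv : T *m v = c%:C%C *: v).
Hypotheses (v'0 : v' != 0) (Tv' : T *m v' = - c%:C%C *: v').

(* T^2 - c T is a multiple of the projection to the line of v', and
   - sum_l g_l (T^2 - c T) g_l is a multiple of the projection to the kernel of
   T; so a vector x for which all g_l x are orthogonal to v' has no component
   in this kernel. *)
Lemma three_form_no_kernel (phi : 'cV[R[i]]_8) :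
  (forall l, cl2 gamma (t l) *m v' = (c / 2)%:C%C *: (gamma l *m v')) ->
  (forall i j, herm Q ((c%:C%C%:M - T) *m (gamma i *m gamma j - gamma j *m gamma i) *m v')
                 phi = 0) ->
  T *m (T *m phi) = c%:C%C ^+ 2 *: phi.
Proof.
move=> Tl h; set C := c%:C%C.
have C0 : C != 0 by rewrite complexR_eq0.
have [_ T3] := three_form_eigen Hgamma Qu Qskew c0 tc v0 Tv v'0 Tv'.
rewrite -/T in T3.
have tc' : 4 * (\sum_(i < 6) \sum_(j < 6 | (i < j)%N) \sum_(k < 6 | (j < k)%N)
    t i j k ^+ 2) = (- c) ^+ 2 by rewrite tc sqrrN.
have cN0 : - c != 0 by rewrite oppr_eq0.
have [line' _] : (forall u, T *m u = (- c)%:C%C *: u -> exists z, u = z *: v') /\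
    T *m T *m T = (- c)%:C%C ^+ 2 *: T.
  apply: (three_form_eigen Hgamma Qu Qskew cN0 tc' v'0 _ v0) => //.
    by rewrite rmorphN.
  by rewrite rmorphN opprK.
have Tsa := herm_cl3 Hgamma Qskew t; rewrite -/T in Tsa.
pose eta := C *: phi - T *m phi.
have h1 i j : herm Q ((gamma i *m gamma j - gamma j *m gamma i) *m v') eta = 0.
  have := h i j; rewrite -mulmxA mulmxBl hermBl mul_scalar_mx hermZl conjC_real Tsa.
  by rewrite /eta hermBr hermZr.
have h2 (i j : 'I_6) : (i < j)%N -> herm Q (gamma i *m gamma j *m v') eta = 0.
  move=> ij; have := h1 i j.
  have -> : gamma j *m gamma i = - (gamma i *m gamma j).
    by apply: (gamma_anticomm (m := 7) Hgamma); rewrite -val_eqE gtn_eqF.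
  rewrite opprK mulmxDl hermDl -mulr2n => /eqP; rewrite mulrn_eq0 => /eqP //.
have h3 l : herm Q (gamma l *m v') eta = 0.
  have : herm Q (cl2 gamma (t l) *m v') eta = 0.
    rewrite /cl2 mulmx_suml herm_suml big1 // => i _.
    rewrite mulmx_suml herm_suml big1 // => j ij.
    by rewrite -scalemxAl hermZl h2 // mulr0.
  rewrite Tl hermZl conjC_real => /eqP; rewrite mulf_eq0.
  by rewrite complexR_eq0 mulf_eq0 (negbTE c0) invr_eq0 pnatr_eq0 => /eqP.
have P0 x : herm Q v' x = 0 -> T *m (T *m x) = C *: (T *m x).
  move=> vx; pose y := T *m (T *m x) - C *: (T *m x).
  have Ty : T *m y = - C *: y.
    rewrite /y mulmxBr -scalemxAr !mulmxA T3 -scalemxAl scalerBr scalerA mulNr -expr2.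
    by rewrite !scaleNr opprK addrC.
  have [z yz] : exists z, y = z *: v' by apply: line'; rewrite rmorphN.
  have : herm Q v' y = 0.
    by rewrite /y hermBr hermZr -!Tsa Tv' -scalemxAr Tv' !hermZl vx !mulr0 subrr.
  rewrite yz hermZr => /eqP; rewrite mulf_eq0 => /orP[/eqP z0|/eqP /(herm_eq0 Qu) e].
    by apply/eqP; rewrite -subr_eq0 -/y yz z0 scale0r.
  by move: v'0; rewrite e eqxx.
have key : 2%:R *: (T *m (T *m eta)) = (2 * c ^+ 2)%:C%C *: eta.
  have e1 := congr1 (fun X => X *m eta) (sum_conj_sqr_three_form Hgamma tc).
  have e2 := congr1 (fun X => X *m eta) (sum_conj_three_form Hgamma t).
  rewrite /= mul0mx mulmx_suml in e2; rewrite /= mulmxBl mul_scalar_mx mulmx_suml -scalemxAl in e1.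
  apply/eqP; rewrite -subr_eq0 !mulmxA -e1; apply/eqP.
  rewrite -[RHS](scaler0 _ C) -[in RHS]e2 scaler_sumr; apply: eq_bigr => l _.
  rewrite -!mulmxA -/T P0 ?scalemxAr //.
  by rewrite -[LHS]opprK -Qskew h3 oppr0.
have key' : T *m (T *m eta) = C ^+ 2 *: eta.
  apply: (scalerI (complex_two_neq0 R)); rewrite key scalerA; congr (_ *: _).
  by rewrite rmorphM rmorphXn rmorph_nat.
move: key'; rewrite /eta !mulmxBr -!scalemxAr [T *m (T *m (T *m phi))]mulmxA.
rewrite [T *m T *m (T *m phi)]mulmxA T3 -scalemxAl scalerBr => /addIr.
by rewrite scalerA mulrC -scalerA => /(scalerI C0).
Qed.

Lemma three_form_line (u : 'cV[R[i]]_8) : T *m u = c%:C%C *: u -> exists z, u = z *: v.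
Proof. exact: (three_form_eigen Hgamma Qu Qskew c0 tc v0 Tv v'0 Tv').1. Qed.

Lemma three_form_span (phi : 'cV[R[i]]_8) :
  T *m (T *m phi) = c%:C%C ^+ 2 *: phi -> exists z w, phi = z *: v + w *: v'.
Proof.
set C := c%:C%C => TT.
have C0 : C != 0 by rewrite complexR_eq0.
have tc' : 4 * (\sum_(i < 6) \sum_(j < 6 | (i < j)%N) \sum_(k < 6 | (j < k)%N)
    t i j k ^+ 2) = (- c) ^+ 2 by rewrite tc sqrrN.
have cN0 : - c != 0 by rewrite oppr_eq0.
have [line' _] : (forall u, T *m u = (- c)%:C%C *: u -> exists z, u = z *: v') /\
    T *m T *m T = (- c)%:C%C ^+ 2 *: T.
  apply: (three_form_eigen Hgamma Qu Qskew cN0 tc' v'0 _ v0) => //.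
    by rewrite rmorphN.
  by rewrite rmorphN opprK.
have [z Hz] : exists z, T *m phi + C *: phi = z *: v.
  apply: three_form_line; rewrite mulmxDr -scalemxAr TT scalerDr scalerA -expr2.
  by rewrite addrC.
have [w Hw] : exists w, T *m phi - C *: phi = w *: v'.
  apply: line'; rewrite rmorphN mulmxBr -scalemxAr TT scalerBr scalerA mulNr -expr2.
  by rewrite !scaleNr opprK addrC.
exists ((2%:R * C)^-1 * z), (- (2%:R * C)^-1 * w).
rewrite -!scalerA -Hz -Hw scaleNr -scalerBr opprB [X in _ *: (X + _)]addrC.
rewrite addrACA subrr addr0 -mulr2n.
by rewrite -[X in _ *: X]scaler_nat !scalerA -mulrA mulVf ?scale1r // mulf_neq0 // pnatr_eq0.
Qed.

End KillingAlgebra.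

(** * Calculus in charts *)

Section RowCalculus.
Variables (R : realType) (n : nat).
Implicit Types (f g : 'rV[R]_n -> R) (x y : 'rV[R]_n) (U : set 'rV[R]_n).

Local Notation e_ i := (delta_mx 0 i : 'rV[R]_n).

Lemma is_derive_line f x (v : 'rV[R]_n) (s : R) : derivable f (x + s *: v) v ->
  is_derive s 1 (fun r => f (x + r *: v)) ('D_v f (x + s *: v)).
Proof.
have e : (fun h : R => h^-1 *: (((fun r => f (x + r *: v)) \o shift s) (h *: 1) -
      f (x + s *: v))) =
    (fun h : R => h^-1 *: ((f \o shift (x + s *: v)) (h *: v) - f (x + s *: v))).
  apply/funext => h /=; congr (_ *: (f _ - _)).
  by rewrite [h%:A]mulr1 scalerDl addrCA.
move=> df; apply: DeriveDef; first by rewrite /derivable e.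
by rewrite /derive e.
Qed.

Lemma open_near U x (P : 'rV[R]_n -> Prop) : open U -> U x ->
  (forall y, U y -> P y) -> \forall y \near x, P y.
Proof.
move=> oU Ux UP; have : nbhs x U by apply: open_nbhs_nbhs.
exact: filterS.
Qed.

Lemma partial_eq U f g x i : open U -> U x -> (forall y, U y -> f y = g y) ->
  partial i f x = partial i g x.
Proof. by move=> oU Ux fg; apply: near_eq_derive; exact: open_near fg. Qed.

Lemma Ck_on_eq k U f g : open U -> (forall x, U x -> f x = g x) ->
  Ck_on k U f -> Ck_on k U g.
Proof.
move=> oU.
have eqc h h' : (forall x, U x -> h x = h' x) -> (forall x, U x -> {for x, continuous h}) ->
    forall x, U x -> {for x, continuous h'}.
  move=> hh' ch x Ux; have := ch x Ux; rewrite /continuous_at /prop_for (hh' x Ux) => c.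
  exact: cvg_trans (near_eq_cvg (open_near oU Ux hh')) c.
elim: k f g => [|k IH] f g fg [cf df].
  by split=> //; exact: eqc cf.
split=> [|i]; first exact: eqc cf.
have [dfi Ci] := df i; split=> [x Ux|].
  by apply: near_eq_derivable (dfi x Ux); exact: open_near oU Ux fg.
by apply: IH Ci => x Ux; exact: partial_eq oU Ux fg.
Qed.

Lemma Ck_on_cst k U (a : R) : Ck_on k U (fun=> a).
Proof.
elim: k a => [|k IH] a; first by split=> // x _; exact: cst_continuous.
split=> [x _|i]; first exact: cst_continuous.
split=> [x _|]; first exact: derivable_cst.
suff -> : partial i (fun=> a) = fun=> 0 by exact: IH.
by apply/funext => x; rewrite /partial derive_cst.
Qed.

Lemma Ck_onS k U f : Ck_on k.+1 U f -> Ck_on k U f.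
Proof.
elim: k f => [|k IH] f [cf df]; split=> // i.
by have [dfi Ci] := df i; split=> //; exact: IH.
Qed.

Lemma Ck_onD k U f g : open U -> Ck_on k U f -> Ck_on k U g ->
  Ck_on k U (fun x => f x + g x).
Proof.
move=> oU; elim: k f g => [|k IH] f g [cf df] [cg dg].
  by split=> // x Ux; apply: continuousD; [exact: cf|exact: cg].
split=> [x Ux|i]; first by apply: continuousD; [exact: cf|exact: cg].
have [dfi Cf] := df i; have [dgi Cg] := dg i; split=> [x Ux|].
  exact: derivableD (dfi x Ux) (dgi x Ux).
apply: (Ck_on_eq (f := fun x => partial i f x + partial i g x)) => //; last exact: IH.
by move=> x Ux; rewrite /partial -deriveD //; [exact: dfi|exact: dgi].
Qed.

Lemma Ck_onM k U f g : open U -> Ck_on k U f -> Ck_on k U g ->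
  Ck_on k U (fun x => f x * g x).
Proof.
move=> oU; elim: k f g => [|k IH] f g Hf Hg; have [cf df] := Hf; have [cg dg] := Hg.
  by split=> // x Ux; apply: continuousM; [exact: cf|exact: cg].
split=> [x Ux|i]; first by apply: continuousM; [exact: cf|exact: cg].
have [dfi Cf] := df i; have [dgi Cg] := dg i; split=> [x Ux|].
  exact: derivableM (dfi x Ux) (dgi x Ux).
apply: (Ck_on_eq (f := fun x => f x * partial i g x + g x * partial i f x)) => //.
  by move=> x Ux; rewrite /partial deriveM //; [exact: dfi|exact: dgi].
by apply: Ck_onD => //; apply: IH => //; exact: Ck_onS.
Qed.

Lemma smooth_on_cst U (a : R) : smooth_on U (fun=> a).
Proof. by move=> k; exact: Ck_on_cst. Qed.

Lemma smooth_onD U f g : open U -> smooth_on U f -> smooth_on U g ->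
  smooth_on U (fun x => f x + g x).
Proof. by move=> oU sf sg k; exact: Ck_onD. Qed.

Lemma smooth_onM U f g : open U -> smooth_on U f -> smooth_on U g ->
  smooth_on U (fun x => f x * g x).
Proof. by move=> oU sf sg k; exact: Ck_onM. Qed.

Lemma smooth_on_derivable U f x i : smooth_on U f -> U x -> derivable f x (e_ i).
Proof. by move=> /(_ 1%N) [_ /(_ i)[df _]] Ux; exact: df. Qed.

Lemma MVT_line f x (v : 'rV[R]_n) (h : R) : 0 < h ->
  (forall s, 0 <= s <= h -> derivable f (x + s *: v) v) ->
  exists2 s, 0 < s < h & f (x + h *: v) - f x = h * 'D_v f (x + s *: v).
Proof.
move=> h0 df; pose g r := f (x + r *: v).
have dg s : s \in `[0, h] -> is_derive s 1 g ('D_v f (x + s *: v)).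
  by rewrite in_itv /= => sh; apply: is_derive_line; exact: df.
have cg : {within `[0, h], continuous g}.
  by apply: derivable_within_continuous => s /dg [].
have dg' s : s \in `]0, h[ -> is_derive s 1 g ('D_v f (x + s *: v)).
  by move=> sh; apply: dg; exact: subset_itv_oo_cc sh.
have [s sh e] := MVT h0 dg' cg.
exists s; first by move: sh; rewrite in_itv.
by move: e; rewrite /g scale0r addr0 subr0 mulrC.
Qed.

Lemma derivable_translate f (w a v : 'rV[R]_n) :
  (derivable (fun y => f (y + w)) a v = derivable f (a + w) v) *
  ('D_v (fun y => f (y + w)) a = 'D_v f (a + w)).
Proof.
have e : (fun h : R => h^-1 *: (((fun y => f (y + w)) \o shift a) (h *: v) -
      f (a + w))) =
    (fun h : R => h^-1 *: ((f \o shift (a + w)) (h *: v) - f (a + w))).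
  by apply/funext => h /=; congr (_ *: (f _ - _)); rewrite addrA.
by split; rewrite /derivable /derive e.
Qed.

Lemma MVT_rectangle U f x i j (h : R) : 0 < h ->
  (forall s t, 0 <= s <= h -> 0 <= t <= h -> U (x + s *: e_ i + t *: e_ j)) ->
  (forall y, U y -> derivable f y (e_ i)) ->
  (forall y, U y -> derivable (partial i f) y (e_ j)) ->
  exists s t, [/\ 0 < s < h, 0 < t < h &
    f (x + h *: e_ i + h *: e_ j) - f (x + h *: e_ i) - (f (x + h *: e_ j) - f x) =
    h * (h * partial j (partial i f) (x + s *: e_ i + t *: e_ j))].
Proof.
move=> h0 HU df ddf.
have h_itv : 0 <= h <= h by rewrite lexx ltW.
have z_itv : 0 <= (0 : R) <= h by rewrite lexx ltW.
pose G y := f (y + h *: e_ j) - f y.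
have dGs s : 0 <= s <= h -> derivable (fun y => f (y + h *: e_ j)) (x + s *: e_ i) (e_ i).
  by move=> sh; rewrite derivable_translate; apply: df; exact: HU.
have df0 s : 0 <= s <= h -> derivable f (x + s *: e_ i) (e_ i).
  by move=> sh; apply: df; have := HU s 0 sh z_itv; rewrite scale0r addr0.
have [|s sh] := @MVT_line G x (e_ i) h h0.
  by move=> s sh; apply: derivableB; [exact: dGs|exact: df0].
have sh' : 0 <= s <= h by case/andP: sh => s0 s1; rewrite !ltW.
rewrite [X in _ = _ * X]deriveB; [|exact: dGs|exact: df0].
rewrite derivable_translate.
have [|t th] := @MVT_line (partial i f) (x + s *: e_ i) (e_ j) h h0.
  by move=> t th; apply: ddf; exact: HU.
rewrite /partial => -> eG; by exists s, t.
Qed.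

Lemma partial_comm U f x i j : open U -> U x -> Ck_on 2 U f ->
  partial i (partial j f) x = partial j (partial i f) x.
Proof.
move=> oU Ux [_ d1]; have [df_i [_ dd_i]] := d1 i; have [df_j [_ dd_j]] := d1 j.
have [dd_ij [c_ij _]] := dd_i j; have [dd_ji [c_ji _]] := dd_j i.
apply/eqP; apply: contraT => ne.
set a := partial i _ x in ne *; set b := partial j _ x in ne *.
have e0 : 0 < `|a - b| / 2 by rewrite divr_gt0 // normr_gt0 subr_eq0.
have nbU : nbhs x U by apply: open_nbhs_nbhs.
have na : \forall y \near x, `|a - partial i (partial j f) y| < `|a - b| / 2.
  by have /cvgr_dist_lt /(_ _ e0) := c_ji x Ux.
have nb : \forall y \near x, `|b - partial j (partial i f) y| < `|a - b| / 2.
  by have /cvgr_dist_lt /(_ _ e0) := c_ij x Ux.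
have /nbhs_ballP [d /= d0 bd] : \forall y \near x,
  [/\ U y, `|a - partial i (partial j f) y| < `|a - b| / 2 &
           `|b - partial j (partial i f) y| < `|a - b| / 2].
  by move: nbU na nb; apply: filterS3 => y.
pose h := d / 4; have h0 : 0 < h by rewrite divr_gt0.
have inB k l s t : 0 <= s <= h -> 0 <= t <= h -> ball x d (x + s *: e_ k + t *: e_ l).
  move=> /andP[s0 sh] /andP[t0 th]; split=> // r q; rewrite /ball /= !mxE.
  rewrite -addrA opprD addrA subrr add0r normrN.
  apply: le_lt_trans (ler_normD _ _) _; rewrite !normrM (ger0_norm s0) (ger0_norm t0).
  have b1 (c : bool) : `|c%:R : R| <= 1 by case: c; rewrite ?normr1 ?normr0.
  have : s * `|((r == 0) && (q == k))%:R| <= h * 1 by rewrite ler_pM.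
  have : t * `|((r == 0) && (q == l))%:R| <= h * 1 by rewrite ler_pM.
  rewrite /h; lra.
have inU k l s t : 0 <= s <= h -> 0 <= t <= h -> U (x + s *: e_ k + t *: e_ l).
  by move=> sh th; have [] := bd _ (inB k l s t sh th).
have [s [t [/andP[s0 s1] /andP[t0 t1] e1]]] :=
  MVT_rectangle h0 (inU i j) df_i dd_ij.
have [s' [t' [/andP[s'0 s'1] /andP[t'0 t'1] e2]]] :=
  MVT_rectangle h0 (inU j i) df_j dd_ji.
have B1 : ball x d (x + s *: e_ i + t *: e_ j) by apply: inB; rewrite !ltW.
have B2 : ball x d (x + s' *: e_ j + t' *: e_ i) by apply: inB; rewrite !ltW.
have [_ _ lb] := bd _ B1; have [_ la _] := bd _ B2.
have hn0 := lt0r_neq0 h0.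
have e12 : f (x + h *: e_ i + h *: e_ j) - f (x + h *: e_ i) - (f (x + h *: e_ j) - f x) =
  f (x + h *: e_ j + h *: e_ i) - f (x + h *: e_ j) - (f (x + h *: e_ i) - f x).
  rewrite (addrAC x (h *: e_ j)).
  move: (f x) (f (x + h *: e_ i)) (f (x + h *: e_ j)) (f (x + _ + _)) => f0 f1 f2 f3.
  by rewrite !opprB !addrA addrAC (addrAC _ f0) (addrAC _ (- f1)).
rewrite e1 e2 in e12; have zz := mulfI hn0 (mulfI hn0 e12).
rewrite zz in lb; clearbody a b; move: la lb.
move: (partial i (partial j f) (x + s' *: e_ j + t' *: e_ i)) => z la.
rewrite (distrC b) => lb; have := le_lt_trans (ler_distD z a b) (ltrD la lb).
by rewrite -splitr ltxx.
Qed.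

Lemma constant_line f x i (h : R) :
  (forall s, `|s| <= `|h| ->
     derivable f (x + s *: e_ i) (e_ i) /\ partial i f (x + s *: e_ i) = 0) ->
  f (x + h *: e_ i) = f x.
Proof.
move=> df; have [h0|h0|h0] := ltgtP h 0.
- have := @MVT_line f (x + h *: e_ i) (e_ i) (- h); rewrite oppr_gt0 => /(_ h0).
  have sh s : 0 <= s <= - h -> `|h + s| <= `|h|.
    by move=> /andP[s0 s1]; rewrite (ltr0_norm h0) ler0_norm; lra.
  case=> [s /sh|s /andP[s0 s1]].
    by rewrite -addrA -scalerDl => /df [].
  rewrite -!addrA -!scalerDl addrN scale0r addr0.
  have /df [_ e] : `|h + s| <= `|h| by apply: sh; rewrite !ltW.
  by rewrite -[X in _ * X]/(partial i f _) e mulr0 => /eqP; rewrite subr_eq0 => /eqP.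
- have := @MVT_line f x (e_ i) h h0.
  have sh s : 0 <= s <= h -> `|s| <= `|h|.
    by move=> /andP[s0 s1]; rewrite (gtr0_norm h0) ger0_norm.
  case=> [s /sh /df []//|s /andP[s0 s1]].
  have /df [_ e] : `|s| <= `|h| by apply: sh; rewrite !ltW.
  by rewrite -[X in _ * X]/(partial i f _) e mulr0 => /eqP; rewrite subr_eq0 => /eqP.
- by rewrite h0 scale0r addr0.
Qed.

Lemma locally_constant U f x : open U -> U x ->
  (forall y i, U y -> derivable f y (e_ i) /\ partial i f y = 0) ->
  \forall y \near x, f y = f x.
Proof.
move=> oU Ux df; have : nbhs x U by apply: open_nbhs_nbhs.
move=> /nbhs_ballP [d /= d0 bd]; apply/nbhs_ballP; exists d => //= y [_ By].
pose z (k : nat) := \row_j (if (j < k)%N then y 0 j else x 0 j).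
have z0 : z 0%N = x by apply/rowP => j; rewrite mxE.
have zn : z n = y by apply/rowP => j; rewrite mxE ltn_ord.
have inB k (kn : (k < n)%N) s : `|s| <= `|y 0 (Ordinal kn) - x 0 (Ordinal kn)| ->
    U (z k + s *: e_ (Ordinal kn)).
  move=> sh; apply: bd; split=> // r q; rewrite (ord1 r) /ball /= !mxE eqxx /=.
  have byq := By 0 q; rewrite /ball /= in byq.
  have [->|qk] := eqVneq q (Ordinal kn).
    rewrite ltnn mulr1 opprD addrA subrr add0r normrN.
    by apply: le_lt_trans sh _; rewrite distrC; exact: By.
  by rewrite mulr0 addr0; case: ifP => // _; rewrite subrr normr0.
suff : forall k, (k <= n)%N -> f (z k) = f x by move/(_ n (leqnn n)); rewrite zn.
elim=> [|k IH] kn; first by rewrite z0.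
rewrite -IH; last exact: ltnW.
have -> : z k.+1 = z k + (y 0 (Ordinal kn) - x 0 (Ordinal kn)) *: e_ (Ordinal kn).
  apply/rowP => j; rewrite !mxE eqxx /=; have [->|jk] := eqVneq j (Ordinal kn).
    by rewrite /= ltnn ltnSn mulr1 addrC subrK.
  rewrite mulr0 addr0 ltnS leq_eqVlt; case: eqP => // jk'.
  by case/eqP: jk; apply: val_inj.
apply: constant_line => s sh; apply: df; exact: inB.
Qed.

End RowCalculus.

Section ChartCalculus.
Variables (R : realType) (n : nat) (M : manifold R n).
Implicit Types (c : atlas M) (U : set M) (f g : M -> R) (p : M) (X : 'rV[R]_n).

Local Notation cmap c := (chart_map (chart_at c)).
Local Notation cinv c := (chart_inv (chart_at c)).
Local Notation cdom c := (chart_dom (chart_at c)).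

Lemma chart_image_open_sub c U : open U -> U `<=` cdom c -> open (cmap c @` U).
Proof.
move=> oU Ud; rewrite openE => _ [p Up <-].
have dp := Ud _ Up.
have nU : nbhs (cinv c (cmap c p)) U.
  by rewrite chart_mapK //; apply: open_nbhs_nbhs.
have n1 : nbhs (cmap c p) (cinv c @^-1` U) := chart_inv_continuous dp nU.
have n2 : nbhs (cmap c p) (cmap c @` cdom c).
  by apply: open_nbhs_nbhs; split; [exact: chart_image_open|exists p].
have n3 : nbhs (cmap c p) ((cinv c @^-1` U) `&` (cmap c @` cdom c)) by apply: filterI.
have sub : (cinv c @^-1` U) `&` (cmap c @` cdom c) `<=` cmap c @` U.
  by move=> y [/= Uy [q dq e]]; exists (cinv c y) => //; rewrite -e chart_mapK.
have : nbhs (cmap c p) (cmap c @` U) by exact: filterS sub n3.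
by [].
Qed.

Definition smooth_in c U f : Prop := smooth_on (cmap c @` U) (f \o cinv c).

Lemma Ck_on_sub k (V W : set 'rV[R]_n) h : V `<=` W -> Ck_on k W h -> Ck_on k V h.
Proof.
move=> VW; elim: k h => [|k IH] h [ch dh]; first by split=> // x /VW; exact: ch.
split=> [x /VW|i]; first exact: ch.
by have [dhi Ci] := dh i; split=> [x /VW|]; [exact: dhi|exact: IH].
Qed.

Lemma smooth_fun_in c U W f : U `<=` W -> U `<=` cdom c -> smooth_fun W f -> smooth_in c U f.
Proof.
move=> UW Ud sf k; apply: Ck_on_sub (sf c k) => _ [p Up <-]; exists p => //.
by split; [exact: Ud|exact: UW].
Qed.

Section OpenSet.
Variables (c : atlas M) (U : set M).
Hypotheses (oU : open U) (Ud : U `<=` cdom c).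
Let V := cmap c @` U.
Let oV : open V. Proof. exact: chart_image_open_sub. Qed.

Lemma smooth_in_cst (a : R) : smooth_in c U (fun=> a).
Proof. exact: smooth_on_cst. Qed.

Lemma smooth_inD f g : smooth_in c U f -> smooth_in c U g ->
  smooth_in c U (fun q => f q + g q).
Proof. exact: smooth_onD. Qed.

Lemma smooth_inM f g : smooth_in c U f -> smooth_in c U g ->
  smooth_in c U (fun q => f q * g q).
Proof. exact: smooth_onM. Qed.

Lemma smooth_inN f : smooth_in c U f -> smooth_in c U (fun q => - f q).
Proof.
move=> sf; have := smooth_inM (smooth_in_cst (-1)) sf.
by congr smooth_on; apply/funext => y /=; rewrite mulN1r.
Qed.

Lemma smooth_in_sum (I : Type) (r : seq I) (P : pred I) (F : I -> M -> R) :
  (forall i, smooth_in c U (F i)) -> smooth_in c U (fun q => \sum_(i <- r | P i) F i q).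
Proof.
move=> sF; elim: r => [|i r IH].
  have := smooth_in_cst 0; congr smooth_on.
  by apply/funext => y; rewrite /= big_nil.
have [Pi|Pi] := boolP (P i).
  have := smooth_inD (sF i) IH; congr smooth_on.
  by apply/funext => y; rewrite /= big_cons Pi.
move: IH; congr smooth_on.
by apply/funext => y; rewrite /= big_cons (negbTE Pi).
Qed.

Variable p : M.
Hypothesis Up : U p.
Let Vp : V (cmap c p). Proof. by exists p. Qed.

Lemma pd_eq f g i : (forall q, U q -> f q = g q) -> pd c i f p = pd c i g p.
Proof.
move=> fg; apply: (partial_eq (U := V)) => // _ [q Uq <-] /=.
by rewrite chart_mapK ?fg //; exact: Ud.
Qed.

Lemma pdD f g i : smooth_in c U f -> smooth_in c U g ->
  pd c i (fun q => f q + g q) p = pd c i f p + pd c i g p.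
Proof using oU Ud Up.
move=> sf sg; rewrite /pd /partial -deriveD //;
  [exact: smooth_on_derivable sf Vp|exact: smooth_on_derivable sg Vp].
Qed.

Lemma pdM f g i : smooth_in c U f -> smooth_in c U g ->
  pd c i (fun q => f q * g q) p = pd c i f p * g p + f p * pd c i g p.
Proof using oU Ud Up.
move=> sf sg; have dp := Ud Up.
have := @deriveM _ _ (f \o cinv c) (g \o cinv c) (cmap c p) (delta_mx 0 i)
  (smooth_on_derivable sf Vp) (smooth_on_derivable sg Vp).
rewrite /= chart_mapK // => e; rewrite [LHS]e addrC; congr (_ + _).
exact: mulrC.
Qed.

Lemma pd_cst (a : R) i : pd c i (fun=> a) p = 0.
Proof. exact: derive_cst. Qed.

Lemma pd_comm f i j : smooth_in c U f ->
  pd c i (fun q => pd c j f q) p = pd c j (fun q => pd c i f q) p.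
Proof.
move=> sf; have e k l : pd c k (fun q => pd c l f q) p =
    partial k (partial l (f \o cinv c)) (cmap c p).
  apply: (partial_eq (U := V)) => // _ [q Uq <-] /=.
  by rewrite chart_mapK //; exact: Ud.
by rewrite !e; apply: partial_comm oV Vp (sf 2%N).
Qed.

Lemma deriv_along_eq X f g : (forall q, U q -> f q = g q) ->
  deriv_along c X f p = deriv_along c X g p.
Proof. by move=> fg; apply: eq_bigr => i _; rewrite (pd_eq i fg). Qed.

Lemma deriv_alongD X f g : smooth_in c U f -> smooth_in c U g ->
  deriv_along c X (fun q => f q + g q) p = deriv_along c X f p + deriv_along c X g p.
Proof using oU Ud Up.
by move=> sf sg; rewrite -big_split; apply: eq_bigr => i _; rewrite pdD // mulrDr.
Qed.

Lemma deriv_alongM X f g : smooth_in c U f -> smooth_in c U g ->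
  deriv_along c X (fun q => f q * g q) p =
  deriv_along c X f p * g p + f p * deriv_along c X g p.
Proof using oU Ud Up.
move=> sf sg; rewrite mulr_suml mulr_sumr -big_split; apply: eq_bigr => i _.
by rewrite pdM // mulrDr mulrA mulrCA.
Qed.

Lemma deriv_along_cst X (a : R) : deriv_along c X (fun=> a) p = 0.
Proof. by rewrite /deriv_along big1 // => i _; rewrite pd_cst mulr0. Qed.

Lemma deriv_alongN X f : smooth_in c U f ->
  deriv_along c X (fun q => - f q) p = - deriv_along c X f p.
Proof.
move=> sf; rewrite (@deriv_along_eq _ _ (fun q => -1 * f q)) => [|q _].
  by rewrite deriv_alongM ?deriv_along_cst ?mul0r ?add0r ?mulN1r //; exact: smooth_in_cst.
by rewrite mulN1r.
Qed.

Lemma deriv_along_sum X (I : Type) (r : seq I) (P : pred I) (F : I -> M -> R) :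
  (forall i, smooth_in c U (F i)) ->
  deriv_along c X (fun q => \sum_(i <- r | P i) F i q) p =
  \sum_(i <- r | P i) deriv_along c X (F i) p.
Proof.
move=> sF; elim: r => [|i r IH].
  rewrite big_nil (@deriv_along_eq _ _ (fun=> 0)) ?deriv_along_cst //.
  by move=> q _; rewrite big_nil.
rewrite big_cons -IH; case: ifP => Pi.
  by rewrite -deriv_alongD //; [apply: deriv_along_eq => q _; rewrite big_cons Pi|exact: smooth_in_sum].
by apply: deriv_along_eq => q _; rewrite big_cons Pi.
Qed.

Lemma deriv_along_delta i f : deriv_along c (delta_mx 0 i) f p = pd c i f p.
Proof.
rewrite /deriv_along (bigD1 i) //= big1 ?addr0 => [|j ji]; rewrite mxE eqxx /=.
  by rewrite eqxx mul1r.
by rewrite (negbTE ji) mul0r.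
Qed.

End OpenSet.

Lemma locally_constant_in c U f p : open U -> U `<=` cdom c -> U p ->
  smooth_in c U f -> (forall q i, U q -> pd c i f q = 0) ->
  \forall q \near p, f q = f p.
Proof.
move=> oU Ud Up sf df.
have oV := chart_image_open_sub oU Ud.
have Vp : (cmap c @` U) (cmap c p) by exists p.
have lc : \forall y \near cmap c p, (f \o cinv c) y = (f \o cinv c) (cmap c p).
  apply: (locally_constant oV Vp) => _ i [q Uq <-]; split; last exact: df.
  by apply: smooth_on_derivable sf _; exists q.
have := chart_map_continuous (Ud _ Up) lc.
have : nbhs p U by apply: open_nbhs_nbhs.
by apply: filterS2 => q Uq /=; rewrite !chart_mapK //; exact: Ud.
Qed.

End ChartCalculus.

Section ComplexCalculus.
Variables (R : realType) (n : nat) (M : manifold R n) (c : atlas M) (U : set M).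
Hypotheses (oU : open U) (Ud : U `<=` chart_dom (chart_at c)).
Implicit Types (f g : M -> R[i]) (X : 'rV[R]_n).

Definition smooth_inC f : Prop :=
  smooth_in c U (fun q => complex.Re (f q)) /\ smooth_in c U (fun q => complex.Im (f q)).

Definition dC X f p : R[i] :=
  (deriv_along c X (fun q => complex.Re (f q)) p +i*
   deriv_along c X (fun q => complex.Im (f q)) p)%C.

Lemma ReD (x y : R[i]) : complex.Re (x + y) = complex.Re x + complex.Re y.
Proof. by case: x y => [a b] [a' b']. Qed.
Lemma ImD (x y : R[i]) : complex.Im (x + y) = complex.Im x + complex.Im y.
Proof. by case: x y => [a b] [a' b']. Qed.
Lemma ReM (x y : R[i]) : complex.Re (x * y) =
  complex.Re x * complex.Re y + - (complex.Im x * complex.Im y).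
Proof. by case: x y => [a b] [a' b']. Qed.
Lemma ImM (x y : R[i]) : complex.Im (x * y) =
  complex.Re x * complex.Im y + complex.Im x * complex.Re y.
Proof. by case: x y => [a b] [a' b']. Qed.

Lemma smooth_inC_cst (a : R[i]) : smooth_inC (fun=> a).
Proof. by split; exact: smooth_in_cst. Qed.

Lemma smooth_inC_real (f : M -> R) : smooth_in c U f -> smooth_inC (fun q => (f q)%:C%C).
Proof. by move=> sf; split=> //; exact: smooth_in_cst. Qed.

Lemma smooth_inCD f g : smooth_inC f -> smooth_inC g -> smooth_inC (fun q => f q + g q).
Proof using oU Ud.
move=> [fr fi] [gr gi]; split.
  by under eq_fun do rewrite ReD; exact: smooth_inD.
by under eq_fun do rewrite ImD; exact: smooth_inD.
Qed.

Lemma smooth_inCM f g : smooth_inC f -> smooth_inC g -> smooth_inC (fun q => f q * g q).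
Proof using oU Ud.
move=> [fr fi] [gr gi]; split.
  under eq_fun do rewrite ReM; apply: smooth_inD => //; first exact: smooth_inM.
  by apply: smooth_inN => //; exact: smooth_inM.
by under eq_fun do rewrite ImM; apply: smooth_inD => //; exact: smooth_inM.
Qed.

Lemma smooth_inC_conj f : smooth_inC f -> smooth_inC (fun q => (f q)^*).
Proof using oU Ud.
move=> [fr fi]; split.
  by rewrite [X in smooth_in _ _ X](_ : _ = fun q => complex.Re (f q)) //; apply/funext => q; case: (f q).
rewrite [X in smooth_in _ _ X](_ : _ = fun q => - complex.Im (f q)); first exact: smooth_inN.
by apply/funext => q; case: (f q).
Qed.

Lemma smooth_inC_sum (I : Type) (r : seq I) (P : pred I) (F : I -> M -> R[i]) :
  (forall i, smooth_inC (F i)) -> smooth_inC (fun q => \sum_(i <- r | P i) F i q).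
Proof using oU Ud.
move=> sF; elim: r => [|i r IH].
  by under eq_fun do rewrite big_nil; exact: smooth_inC_cst.
under eq_fun do rewrite big_cons; case: (P i) => //.
exact: smooth_inCD.
Qed.

Variable p : M.
Hypothesis Up : U p.

Lemma dC_eq X f g : (forall q, U q -> f q = g q) -> dC X f p = dC X g p.
Proof using oU Ud Up.
by move=> fg; congr (_ +i* _)%C; apply: (deriv_along_eq oU Ud Up) => q /fg ->.
Qed.

Lemma dC_cst X (a : R[i]) : dC X (fun=> a) p = 0.
Proof. by rewrite /dC !deriv_along_cst. Qed.

Lemma dCD X f g : smooth_inC f -> smooth_inC g ->
  dC X (fun q => f q + g q) p = dC X f p + dC X g p.
Proof using oU Ud Up.
move=> [fr fi] [gr gi]; rewrite /dC.
under eq_fun do rewrite ReD; under [X in (_ +i* deriv_along _ _ X _)%C]eq_fun do rewrite ImD.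
by rewrite !(deriv_alongD oU Ud Up).
Qed.

Lemma dCM X f g : smooth_inC f -> smooth_inC g ->
  dC X (fun q => f q * g q) p = dC X f p * g p + f p * dC X g p.
Proof using oU Ud Up.
move=> [fr fi] [gr gi]; rewrite /dC.
under eq_fun do rewrite ReM; under [X in (_ +i* deriv_along _ _ X _)%C]eq_fun do rewrite ImM.
have sM := smooth_inM oU Ud.
rewrite !(deriv_alongD oU Ud Up) ?(deriv_alongN oU Ud Up) ?(deriv_alongM oU Ud Up) //;
  do ?[exact: sM | apply: smooth_inN => //; exact: sM].
case: (f p) (g p) => [a b] [a' b'] /=.
by apply/eqP; rewrite eq_complex /=; apply/andP; split; apply/eqP; ring.
Qed.

Lemma dC_real X (f : M -> R) : dC X (fun q => (f q)%:C%C) p = (deriv_along c X f p)%:C%C.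
Proof. by rewrite /dC /= deriv_along_cst. Qed.

Lemma dC_conj X f : smooth_inC f -> dC X (fun q => (f q)^*) p = (dC X f p)^*.
Proof using oU Ud Up.
move=> [fr fi]; rewrite /dC -[RHS]/(_ +i* _)%C; congr (_ +i* _)%C.
  by congr deriv_along; apply/funext => q; case: (f q).
rewrite -(deriv_alongN oU Ud Up) //; congr deriv_along; apply/funext => q.
by case: (f q).
Qed.

Lemma dC_sum X (I : Type) (r : seq I) (P : pred I) (F : I -> M -> R[i]) :
  (forall i, smooth_inC (F i)) ->
  dC X (fun q => \sum_(i <- r | P i) F i q) p = \sum_(i <- r | P i) dC X (F i) p.
Proof using oU Ud Up.
move=> sF; elim: r => [|i r IH].
  by rewrite big_nil -[RHS](dC_cst X 0); apply: dC_eq => q _; rewrite big_nil.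
rewrite big_cons -IH; case: ifP => Pi.
  rewrite -dCD //; last exact: smooth_inC_sum.
  by apply: dC_eq => q _; rewrite big_cons Pi.
by apply: dC_eq => q _; rewrite big_cons Pi.
Qed.

Lemma dC_mulr X (a : R[i]) f : smooth_inC f -> dC X (fun q => a * f q) p = a * dC X f p.
Proof using oU Ud Up.
by move=> sf; rewrite dCM ?dC_cst ?mul0r ?add0r //; exact: smooth_inC_cst.
Qed.

End ComplexCalculus.

Section SpinorCalculus.
Variables (R : realType) (n N : nat) (M : manifold R n) (c : atlas M) (U : set M).
Hypotheses (oU : open U) (Ud : U `<=` chart_dom (chart_at c)).
Implicit Types (f g : M -> R[i]) (X : 'rV[R]_n) (phi psi : M -> 'cV[R[i]]_N).

Definition smooth_in_cv phi : Prop := forall i, smooth_inC c U (fun q => phi q i 0).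

Lemma smooth_cmx_in_cv phi : smooth_cmx U phi -> smooth_in_cv phi.
Proof.
move=> [sr si] i; split.
  have := smooth_fun_in (fun _ h => h) Ud (sr i 0); congr smooth_in.
  by apply/funext => q; rewrite mxE.
have := smooth_fun_in (fun _ h => h) Ud (si i 0); congr smooth_in.
by apply/funext => q; rewrite mxE.
Qed.

Lemma smooth_in_cv_mulmx (A : 'M[R[i]]_N) phi : smooth_in_cv phi ->
  smooth_in_cv (fun q => A *m phi q).
Proof using oU Ud.
move=> sp i; under eq_fun do rewrite mxE.
by apply: smooth_inC_sum => // j; apply: smooth_inCM => //; exact: smooth_inC_cst.
Qed.

Lemma smooth_in_cv_scale f phi : smooth_inC c U f -> smooth_in_cv phi ->
  smooth_in_cv (fun q => f q *: phi q).
Proof using oU Ud. by move=> sf sp i; under eq_fun do rewrite mxE; exact: smooth_inCM. Qed.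

Lemma smooth_inC_herm (Q : 'M[R[i]]_N) phi psi : smooth_in_cv phi -> smooth_in_cv psi ->
  smooth_inC c U (fun q => herm Q (phi q) (psi q)).
Proof using oU Ud.
move=> sp ss; under eq_fun do rewrite hermE.
apply: smooth_inC_sum => // j; apply: smooth_inCM => //; last exact: smooth_in_cv_mulmx.
by apply: smooth_inC_conj => //; exact: smooth_in_cv_mulmx.
Qed.

Variable p : M.
Hypothesis Up : U p.
Local Notation D X phi := (deriv_along_cmx c X phi p).

Lemma deriv_cvE X phi i : D X phi i 0 = dC c X (fun q => phi q i 0) p.
Proof. by rewrite mxE. Qed.

Lemma deriv_cv_eq X phi psi : (forall q, U q -> phi q = psi q) -> D X phi = D X psi.
Proof using oU Ud Up.
by move=> e; apply/colP => i; rewrite !deriv_cvE; apply: (dC_eq oU Ud Up) => q /e ->.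
Qed.

Lemma deriv_cvD X phi psi : smooth_in_cv phi -> smooth_in_cv psi ->
  D X (fun q => phi q + psi q) = D X phi + D X psi.
Proof using oU Ud Up.
move=> sp ss; apply/colP => i; rewrite [RHS]mxE !deriv_cvE.
by under eq_fun do rewrite mxE; exact: (dCD oU Ud Up _ (sp i) (ss i)).
Qed.

Lemma deriv_cv_mulmx X (A : 'M[R[i]]_N) phi : smooth_in_cv phi ->
  D X (fun q => A *m phi q) = A *m D X phi.
Proof using oU Ud Up.
move=> sp; apply/colP => i; rewrite deriv_cvE [RHS]mxE; under eq_fun do rewrite mxE.
rewrite (dC_sum oU Ud Up) => [|j].
  by apply: eq_bigr => j _; rewrite deriv_cvE (dC_mulr oU Ud Up).
by apply: smooth_inCM => //; exact: smooth_inC_cst.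
Qed.

Lemma deriv_cv_scale X f phi : smooth_inC c U f -> smooth_in_cv phi ->
  D X (fun q => f q *: phi q) = dC c X f p *: phi p + f p *: D X phi.
Proof using oU Ud Up.
move=> sf sp; apply/colP => i; rewrite deriv_cvE !mxE; under eq_fun do rewrite mxE.
exact: (dCM oU Ud Up).
Qed.

Lemma deriv_herm X (Q : 'M[R[i]]_N) phi psi : smooth_in_cv phi -> smooth_in_cv psi ->
  dC c X (fun q => herm Q (phi q) (psi q)) p =
  herm Q (D X phi) (psi p) + herm Q (phi p) (D X psi).
Proof using oU Ud Up.
move=> sp ss; under eq_fun do rewrite hermE.
have sQp := smooth_in_cv_mulmx Q sp; have sQs := smooth_in_cv_mulmx Q ss.
rewrite (dC_sum oU Ud Up) => [|i]; last first.
  by apply: smooth_inCM => //; exact: smooth_inC_conj.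
rewrite !hermE -big_split; apply: eq_bigr => i _ /=.
rewrite (dCM oU Ud Up) ?(dC_conj oU Ud Up) //; last exact: smooth_inC_conj.
by rewrite -!deriv_cv_mulmx // !deriv_cvE.
Qed.

End SpinorCalculus.

Section RealMatrixCalculus.
Variables (R : realType) (n : nat) (M : manifold R n) (c : atlas M) (U : set M).
Hypotheses (oU : open U) (Ud : U `<=` chart_dom (chart_at c)).

Definition smooth_in_mx (m k : nat) (A : M -> 'M[R]_(m, k)) : Prop :=
  forall i j, smooth_in c U (fun q => A q i j).

Definition deriv_mx (m k : nat) (X : 'rV[R]_n) (A : M -> 'M[R]_(m, k)) p : 'M[R]_(m, k) :=
  \matrix_(i, j) deriv_along c X (fun q => A q i j) p.

Lemma smooth_in_mxM m k l (A : M -> 'M[R]_(m, k)) (B : M -> 'M[R]_(k, l)) :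
  smooth_in_mx A -> smooth_in_mx B -> smooth_in_mx (fun q => A q *m B q).
Proof using oU Ud.
move=> sA sB i j; under eq_fun do rewrite mxE.
by apply: smooth_in_sum => // a; exact: smooth_inM.
Qed.

Lemma smooth_in_mx_tr m k (A : M -> 'M[R]_(m, k)) :
  smooth_in_mx A -> smooth_in_mx (fun q => (A q)^T).
Proof. by move=> sA i j; under eq_fun do rewrite mxE; exact: sA. Qed.

Lemma smooth_in_mx_cst m k (A : 'M[R]_(m, k)) : smooth_in_mx (fun=> A).
Proof. by move=> i j; exact: smooth_in_cst. Qed.

Variable p : M.
Hypothesis Up : U p.

Lemma deriv_mxM X m k l (A : M -> 'M[R]_(m, k)) (B : M -> 'M[R]_(k, l)) :
  smooth_in_mx A -> smooth_in_mx B ->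
  deriv_mx X (fun q => A q *m B q) p = deriv_mx X A p *m B p + A p *m deriv_mx X B p.
Proof using oU Ud Up.
move=> sA sB; apply/matrixP => i j; rewrite !mxE; under eq_fun do rewrite mxE.
rewrite (deriv_along_sum oU Ud Up) => [|a]; last exact: smooth_inM.
rewrite -big_split; apply: eq_bigr => a _ /=.
by rewrite !mxE (deriv_alongM oU Ud Up).
Qed.

Lemma deriv_mx_tr X m k (A : M -> 'M[R]_(m, k)) :
  deriv_mx X (fun q => (A q)^T) p = (deriv_mx X A p)^T.
Proof. by apply/matrixP => i j; rewrite !mxE; under eq_fun do rewrite mxE. Qed.

Lemma deriv_mx_cst X m k (A : 'M[R]_(m, k)) : deriv_mx X (fun=> A) p = 0.
Proof. by apply/matrixP => i j; rewrite !mxE deriv_along_cst. Qed.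

Lemma deriv_mx_eq X m k (A B : M -> 'M[R]_(m, k)) : (forall q, U q -> A q = B q) ->
  deriv_mx X A p = deriv_mx X B p.
Proof using oU Ud Up.
by move=> e; apply/matrixP => i j; rewrite !mxE; apply: (deriv_along_eq oU Ud Up) => q /e ->.
Qed.

End RealMatrixCalculus.

(** * Riemannian and spin geometry *)

Section LeviCivita.
Variables (R : realType) (n : nat) (M : manifold R n) (g : riemannian_metric M).
Variables (c : atlas M) (U : set M).
Hypotheses (oU : open U) (Ud : U `<=` chart_dom (chart_at c)).
Implicit Types (X Y Z : 'rV[R]_n).

Lemma smooth_mx_in (m k : nat) (W : set M) (A : M -> 'M[R]_(m, k)) :
  U `<=` W -> smooth_mx W A -> smooth_in_mx c U A.
Proof. by move=> UW sA i j; exact: smooth_fun_in UW Ud (sA i j). Qed.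

Lemma gram_smooth_in : smooth_in_mx c U (g c).
Proof. exact: smooth_mx_in Ud (gram_smooth g c). Qed.

Variable p : M.
Hypothesis Up : U p.

Lemma gram_unit : g c p \in unitmx.
Proof using Ud Up.
rewrite -row_free_unit -kermx_eq0; apply: contraT => /rowV0Pn [v /sub_kermxP vG v0].
by have := gram_pos g (Ud Up) v0; rewrite vG mul0mx mxE ltxx.
Qed.

Definition connection_mx X : 'M[R]_n :=
  \matrix_(j, k) \sum_i X 0 i * christoffel g c p i j k.

Lemma nabla_gE X (Y : M -> 'rV[R]_n) :
  nabla_g g c X Y p = deriv_mx c X Y p + Y p *m connection_mx X.
Proof.
apply/rowP => k; rewrite !mxE; congr (_ + _); rewrite exchange_big.
apply: eq_bigr => j _; rewrite mxE mulr_sumr; apply: eq_bigr => i _; ring.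
Qed.

Lemma gram_symE i j : g c p i j = g c p j i.
Proof using Ud Up. by have /matrixP/(_ i j) := gram_sym g (Ud Up); rewrite mxE. Qed.

Lemma pd_gram_sym l i j : pd c l (fun q => g c q i j) p = pd c l (fun q => g c q j i) p.
Proof using oU Ud Up.
apply: (pd_eq oU Ud Up) => q Uq.
by have /matrixP/(_ i j) := gram_sym g (Ud Uq); rewrite mxE.
Qed.

Lemma christoffel_sym i j k : christoffel g c p i j k = christoffel g c p j i k.
Proof using oU Ud Up.
congr (_ * _); apply: eq_bigr => l _; congr (_ * _).
by rewrite (pd_gram_sym l i j); ring.
Qed.

Lemma christoffel_lower i j k :
  \sum_l christoffel g c p i j l * g c p l k =
  2^-1 * (pd c i (fun q => g c q j k) p + pd c j (fun q => g c q i k) p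
     - pd c k (fun q => g c q i j) p).
Proof using oU Ud Up.
pose D l := pd c i (fun q => g c q j l) p + pd c j (fun q => g c q i l) p
     - pd c l (fun q => g c q i j) p.
have -> : \sum_l christoffel g c p i j l * g c p l k =
    2^-1 * \sum_m D m * (invmx (g c p) *m g c p) m k.
  rewrite mulr_sumr.
  under eq_bigr => l _ do rewrite /christoffel -mulrA mulr_suml mulr_sumr.
  rewrite exchange_big; apply: eq_bigr => m _ /=.
  rewrite mxE !mulr_sumr; apply: eq_bigr => l _; rewrite /D; ring.
rewrite mulVmx ?gram_unit // (bigD1 k) //= big1 ?addr0 => [|m mk].
  by rewrite mxE eqxx mulr1.
by rewrite mxE (negbTE mk) mulr0.
Qed.

Lemma deriv_gram X :
  deriv_mx c X (g c) p = connection_mx X *m g c p + g c p *m (connection_mx X)^T.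
Proof using oU Ud Up.
apply/matrixP => j k; rewrite !mxE.
have -> : \sum_l connection_mx X j l * g c p l k =
    \sum_i X 0 i * \sum_l christoffel g c p i j l * g c p l k.
  under eq_bigr => l _ do rewrite mxE mulr_suml.
  rewrite exchange_big; apply: eq_bigr => i _ /=; rewrite mulr_sumr.
  by apply: eq_bigr => l _; rewrite mulrA.
have -> : \sum_l g c p j l * (connection_mx X)^T l k =
    \sum_i X 0 i * \sum_l christoffel g c p i k l * g c p l j.
  under eq_bigr => l _ do rewrite !mxE mulr_sumr.
  rewrite exchange_big; apply: eq_bigr => i _ /=; rewrite mulr_sumr.
  by apply: eq_bigr => l _; rewrite (gram_symE j l); ring.
rewrite -big_split; apply: eq_bigr => i _ /=.
rewrite !christoffel_lower -mulrDr (pd_gram_sym i k j); congr (_ * _).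
by field.
Qed.

End LeviCivita.

Section NearlyKahlerTorsion.
Variables (R : realType) (n : nat) (M : manifold R n) (g : riemannian_metric M).
Variables (J : almost_complex M) (c : atlas M) (p : M).
Hypothesis dp : chart_dom (chart_at c) p.
Implicit Types (X Y Z : 'rV[R]_n).

Let oU : open (chart_dom (chart_at c)). Proof. exact: chart_dom_open. Qed.
Let Ud : chart_dom (chart_at c) `<=` chart_dom (chart_at c). Proof. by []. Qed.
Let sG : smooth_in_mx c (chart_dom (chart_at c)) (g c). Proof. exact: gram_smooth_in. Qed.
Let sJ : smooth_in_mx c (chart_dom (chart_at c)) (J c).
Proof. exact: smooth_mx_in (acs_smooth J c). Qed.

Local Notation Gam := (connection_mx g c p).

Definition nablaJ_mx X : 'M[R]_n :=
  deriv_mx c X (J c) p + J c p *m Gam X - Gam X *m J c p.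

Lemma nablaJE X Y : nablaJ g J c p X Y = Y *m nablaJ_mx X.
Proof.
rewrite /nablaJ !nabla_gE (deriv_mxM oU Ud dp) //; last exact: smooth_in_mx_cst.
rewrite !deriv_mx_cst mul0mx !add0r mulmxBr mulmxDr !mulmxA.
by [].
Qed.

Lemma nablaJ_mxD X Y : nablaJ_mx (X + Y) = nablaJ_mx X + nablaJ_mx Y.
Proof.
have GD : Gam (X + Y) = Gam X + Gam Y.
  apply/matrixP => j k; rewrite !mxE -big_split; apply: eq_bigr => i _.
  by rewrite mxE mulrDl.
have dD : deriv_mx c (X + Y) (J c) p = deriv_mx c X (J c) p + deriv_mx c Y (J c) p.
  apply/matrixP => j k; rewrite !mxE -big_split; apply: eq_bigr => i _.
  by rewrite mxE mulrDl.
rewrite /nablaJ_mx GD dD mulmxDr mulmxDl.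
move: (J c p *m _) (J c p *m _) (_ *m J c p) (_ *m J c p) => a b d e.
by apply/matrixP => r s; rewrite !mxE; ring.
Qed.

Lemma nablaJ_mx_anticomm X : nablaJ_mx X *m J c p = - (J c p *m nablaJ_mx X).
Proof.
have JJ := acs_sqr J dp.
have dJ : deriv_mx c X (J c) p *m J c p + J c p *m deriv_mx c X (J c) p = 0.
  rewrite -(deriv_mxM oU Ud dp) // -[RHS](deriv_mx_cst c p X (- 1%:M : 'M[R]_n)).
  by apply: (deriv_mx_eq oU Ud dp) => q dq; exact: acs_sqr.
apply/eqP; rewrite -addr_eq0 /nablaJ_mx !mulmxBr !mulmxBl !mulmxDr !mulmxDl.
rewrite !mulmxA JJ -(mulmxA (Gam X)) JJ mulmxN mulNmx mulmx1 mul1mx opprK.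
have -> : J c p *m deriv_mx c X (J c) p = - (deriv_mx c X (J c) p *m J c p).
  by apply/eqP; rewrite -addr_eq0 addrC dJ.
move: (deriv_mx c X (J c) p *m J c p) (J c p *m Gam X *m J c p) => a b.
by apply/eqP/matrixP => r s; rewrite !mxE; ring.
Qed.

Hypothesis AH : almost_hermitian g J.

Lemma acs_isometry q : chart_dom (chart_at c) q -> J c q *m g c q *m (J c q)^T = g c q.
Proof.
move=> dq; apply/matrixP => i j; have := AH (delta_mx 0 i) (delta_mx 0 j) dq.
rewrite /inner trmx_mul !mulmxA.
have e (A : 'M[R]_n) : ((delta_mx 0 i : 'rV[R]_n) *m A *m (delta_mx 0 j : 'rV[R]_n)^T) 0 0 = A i j.
  by rewrite trmx_delta -rowE -colE !mxE.
by rewrite -(mulmxA (delta_mx 0 i)) -(mulmxA (delta_mx 0 i)) !e.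
Qed.

Lemma acs_gram_skew q : chart_dom (chart_at c) q -> J c q *m g c q = - (g c q *m (J c q)^T).
Proof.
move=> dq; have := congr1 (mulmx (J c q)) (acs_isometry dq).
by rewrite !mulmxA acs_sqr // mulNmx mul1mx => /esym; rewrite -mulNmx.
Qed.

Lemma nablaJ_mx_gram_skew X : nablaJ_mx X *m g c p + g c p *m (nablaJ_mx X)^T = 0.
Proof.
have dJG : deriv_mx c X (J c) p *m g c p + J c p *m deriv_mx c X (g c) p +
    (deriv_mx c X (g c) p *m (J c p)^T + g c p *m (deriv_mx c X (J c) p)^T) = 0.
  have sJT := smooth_in_mx_tr sJ.
  rewrite -(deriv_mx_tr c p X (J c)) -!(deriv_mxM oU Ud dp) //.
  apply/matrixP => r s; rewrite !mxE -(deriv_alongD oU Ud dp).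
  - rewrite -[RHS](deriv_along_cst c p X 0); apply: (deriv_along_eq oU Ud dp) => q dq.
    by rewrite (acs_gram_skew dq) mxE addNr.
  - exact: (smooth_in_mxM oU Ud sJ sG).
  - exact: (smooth_in_mxM oU Ud sG sJT).
have GT : (g c p)^T = g c p by exact: gram_sym.
have JG := acs_gram_skew dp.
have dG := deriv_gram g oU Ud dp X.
rewrite dG !mulmxDr !mulmxDl !mulmxA in dJG.
have e1 : Gam X *m J c p *m g c p = - (Gam X *m g c p *m (J c p)^T).
  by rewrite -mulmxA JG mulmxN mulmxA.
have e2 : g c p *m (J c p)^T *m (Gam X)^T = - (J c p *m g c p *m (Gam X)^T).
  by rewrite JG mulNmx opprK.
have -> : (nablaJ_mx X)^T = (deriv_mx c X (J c) p)^T + (Gam X)^T *m (J c p)^T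
     - (J c p)^T *m (Gam X)^T by rewrite -!trmx_mul -linearD -linearB.
rewrite /nablaJ_mx mulmxBl mulmxDl mulmxBr mulmxDr !mulmxA e1 e2 -dJG.
move: (deriv_mx c X (J c) p *m g c p) (g c p *m (deriv_mx c X (J c) p)^T)
  (J c p *m Gam X *m g c p) (J c p *m g c p *m (Gam X)^T)
  (Gam X *m g c p *m (J c p)^T) (g c p *m (Gam X)^T *m (J c p)^T) => a b d e f h.
by apply/matrixP => r s; rewrite !mxE; ring.
Qed.

Hypothesis NK : forall X, nablaJ g J c p X X = 0.

Lemma torsion3_swap12 X Y Z : torsion3 g J c p X Y Z = - torsion3 g J c p Y X Z.
Proof.
have anti : X *m nablaJ_mx Y = - (Y *m nablaJ_mx X).
  have := NK (X + Y); rewrite nablaJE nablaJ_mxD mulmxDl (mulmxDr X) (mulmxDr Y) -!nablaJE !NK.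
  by rewrite add0r addr0 addrC !nablaJE => /eqP; rewrite addr_eq0 => /eqP ->; rewrite opprK.
rewrite /torsion3 /inner /torsion !nablaJE -!(mulmxA _ (J c p)).
have e W : J c p *m nablaJ_mx W = - (nablaJ_mx W *m J c p).
  by rewrite nablaJ_mx_anticomm opprK.
by rewrite !e !mulmxN !mulNmx !(mulmxA _ (nablaJ_mx _)) anti !mulNmx opprK [in LHS]mxE.
Qed.

Lemma torsion3_swap23 X Y Z : torsion3 g J c p X Y Z = - torsion3 g J c p X Z Y.
Proof.
have skew : (J c p *m nablaJ_mx X *m g c p)^T = - (J c p *m nablaJ_mx X *m g c p).
  rewrite !trmx_mul (gram_sym g dp).
  have -> : g c p *m ((nablaJ_mx X)^T *m (J c p)^T) = - (nablaJ_mx X *m g c p) *m (J c p)^T.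
    rewrite mulmxA; congr (_ *m _); apply/eqP.
    by rewrite -addr_eq0 addrC nablaJ_mx_gram_skew.
  have GJ : g c p *m (J c p)^T = - (J c p *m g c p) by rewrite (acs_gram_skew dp) opprK.
  rewrite mulNmx -(mulmxA (nablaJ_mx X)) GJ mulmxN opprK mulmxA.
  by rewrite nablaJ_mx_anticomm mulNmx.
rewrite /torsion3 /inner /torsion !nablaJE.
have e (u v : 'rV[R]_n) : u *m J c p *m nablaJ_mx X *m g c p *m v^T =
    u *m (J c p *m nablaJ_mx X *m g c p) *m v^T by rewrite !mulmxA.
rewrite !e -[in LHS](trmxK (J c p *m _ *m _)) skew linearN /= mulmxN mulNmx mxE.
congr (- _); have t (A : 'M[R]_1) : A 0 0 = A^T 0 0 by rewrite mxE.
by rewrite [RHS]t !trmx_mul trmxK !mulmxA.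
Qed.

End NearlyKahlerTorsion.

#[local] Opaque herm cl2 cl3 deriv_along_cmx.

Section SpinPatch.
Variables (R : realType) (n m : nat) (M : manifold R n) (g : riemannian_metric M).
Variables (J : almost_complex M) (gamma : 'I_n -> 'M[R[i]]_m.+1).
Hypothesis Hgamma : clifford_rep gamma.
Variables (S : spin_structure g gamma) (a : spin_patch S).
Implicit Types (p q : M) (X Y : 'rV[R]_n).

Local Notation U := (patch_dom a).
Local Notation c := (patch_chart a).
Local Notation E := (patch_frame a).
Let oU : open U. Proof. exact: patch_dom_open. Qed.
Let Ud : U `<=` chart_dom (chart_at c). Proof. exact: patch_dom_sub. Qed.

Let sE : smooth_in_mx c U E.
Proof. exact: (smooth_mx_in Ud (fun _ h => h) (patch_frame_smooth (s := S) a)). Qed.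
Let sG : smooth_in_mx c U (g c). Proof. exact: gram_smooth_in. Qed.

Definition coframe_mx p : 'M[R]_n := g c p *m (E p)^T.

Lemma coframe_smooth_in : smooth_in_mx c U coframe_mx.
Proof. by apply: (smooth_in_mxM oU Ud) => //; exact: smooth_in_mx_tr. Qed.

Lemma frame_coframe p : U p -> E p *m coframe_mx p = 1%:M.
Proof. by move=> Up; rewrite mulmxA; exact: patch_frame_orthonormal. Qed.

Lemma coframe_frame p : U p -> coframe_mx p *m E p = 1%:M.
Proof. by move=> Up; apply: mulmx1C; exact: frame_coframe. Qed.

Lemma inner_frame p X k : inner g c p X (frame_vec a k p) = (X *m coframe_mx p) 0 k.
Proof.
by rewrite /inner /frame_vec /coframe_mx mulmxA tr_row colE mulmxA -colE mxE.
Qed.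

Lemma coframe_tr p : U p -> (coframe_mx p)^T = E p *m g c p.
Proof. by move=> Up; rewrite trmx_mul trmxK gram_sym //; exact: Ud. Qed.

Lemma inner_sum_frame p X Y : U p ->
  inner g c p X Y = \sum_k inner g c p X (frame_vec a k p) * inner g c p Y (frame_vec a k p).
Proof.
move=> Up; have -> : \sum_k inner g c p X (frame_vec a k p) * inner g c p Y (frame_vec a k p)
    = (X *m coframe_mx p *m (Y *m coframe_mx p)^T) 0 0.
  by rewrite [RHS]mxE; apply: eq_bigr => k _; rewrite !inner_frame [X in _ = _ * X]mxE.
rewrite /inner trmx_mul coframe_tr // -(mulmxA X (coframe_mx p)).
by rewrite 2!(mulmxA (coframe_mx p)) coframe_frame // mul1mx mulmxA.
Qed.

Lemma cl_vecE p X : cl_vec a p X = \sum_k ((X *m coframe_mx p) 0 k)%:C%C *: gamma k.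
Proof. by apply: eq_bigr => k _; rewrite inner_frame. Qed.

Lemma cl_vec_frame p k : U p -> cl_vec a p (frame_vec a k p) = gamma k.
Proof.
move=> Up; rewrite cl_vecE /frame_vec -row_mul frame_coframe // (bigD1 k) //= big1.
  by rewrite !mxE eqxx scale1r addr0.
by move=> l lk; rewrite !mxE eq_sym (negbTE lk) scale0r.
Qed.

Lemma cl_vec_sum p (w : 'I_n -> R) (X : 'I_n -> 'rV[R]_n) :
  cl_vec a p (\sum_k w k *: X k) = \sum_k (w k)%:C%C *: cl_vec a p (X k).
Proof.
rewrite cl_vecE; under [RHS]eq_bigr => k _ do rewrite cl_vecE scaler_sumr.
rewrite exchange_big; apply: eq_bigr => l _ /=.
rewrite mulmx_suml summxE rmorph_sum /= scaler_suml; apply: eq_bigr => k _.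
by rewrite -scalemxAl mxE rmorphM scalerA.
Qed.

(* The matrix of g(nabla_X e_i, e_j). *)
Definition spin_connection_mx p X : 'M[R]_n :=
  (deriv_mx c X E p + E p *m connection_mx g c p X) *m coframe_mx p.

Lemma nabla_spinE (phi : spinor S) p X : nabla_spin phi a p X =
  deriv_along_cmx c X (phi a) p +
  (2^-1)%:C%C *: (cl2 gamma (spin_connection_mx p X) *m phi a p).
Proof.
congr (_ + _ *: (cl2 gamma _ *m _)); apply/funext => i; apply/funext => j.
rewrite inner_frame nabla_gE.
have -> : deriv_mx c X (frame_vec a i) p = row i (deriv_mx c X E p).
  apply/rowP => k; rewrite [LHS]mxE [RHS]mxE [RHS]mxE.
  have -> // : (fun q => frame_vec a i q 0 k) = (fun q => E q i k).
  by apply/funext => q; rewrite mxE.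
by rewrite /frame_vec -row_mul -linearD /= -row_mul mxE.
Qed.

Section AtPoint.
Variable p : M.
Hypothesis Up : U p.

Lemma deriv_coframe X : deriv_mx c X coframe_mx p =
  connection_mx g c p X *m coframe_mx p + coframe_mx p *m (spin_connection_mx p X)^T.
Proof.
rewrite /coframe_mx (deriv_mxM oU Ud Up) //; last exact: smooth_in_mx_tr.
rewrite deriv_mx_tr (deriv_gram g oU Ud Up) mulmxDl -!mulmxA -addrA; congr (_ + _).
rewrite -mulmxDr; congr (_ *m _).
rewrite /spin_connection_mx !trmx_mul trmxK gram_sym; last exact: Ud.
have -> : (E p)^T *m (E p *m g c p *m (deriv_mx c X E p + E p *m connection_mx g c p X)^T) =
   (coframe_mx p *m E p)^T *m (deriv_mx c X E p + E p *m connection_mx g c p X)^T.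
  by rewrite trmx_mul coframe_tr // mulmxA.
by rewrite coframe_frame // trmx1 mul1mx linearD /= trmx_mul addrC.
Qed.

Lemma spin_connection_anti X i j :
  spin_connection_mx p X i j = - spin_connection_mx p X j i.
Proof.
have d1 : deriv_mx c X (fun q => E q *m coframe_mx q) p = 0.
  rewrite -(deriv_mx_cst c p X 1%:M); apply: (deriv_mx_eq oU Ud Up) => q Uq.
  exact: frame_coframe.
move: d1; rewrite (deriv_mxM oU Ud Up) //; last exact: coframe_smooth_in.
rewrite deriv_coframe mulmxDr (mulmxA (E p) (connection_mx _ _ _ _)).
rewrite (mulmxA (E p) (coframe_mx p)) frame_coframe // mul1mx addrA -mulmxDl.
move/matrixP/(_ i j); rewrite !mxE => /eqP.
by rewrite addr_eq0 => /eqP.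
Qed.

Variable Q : 'M[R[i]]_m.+1.
Hypothesis Qskew : forall i u v, herm Q (gamma i *m u) v = - herm Q u (gamma i *m v).
Variables (psi phi : spinor S).
Hypotheses (spsi : spinor_field psi) (sphi : spinor_field phi).

Let spsi' : smooth_in_cv c U (psi a).
Proof. exact: smooth_cmx_in_cv (spsi.1 a). Qed.
Let sphi' : smooth_in_cv c U (phi a).
Proof. exact: smooth_cmx_in_cv (sphi.1 a). Qed.

Lemma smooth_herm_spinor : smooth_inC c U (fun q => herm Q (psi a q) (phi a q)).
Proof. exact: smooth_inC_herm. Qed.

Lemma deriv_herm_spin X :
  dC c X (fun q => herm Q (psi a q) (phi a q)) p =
  herm Q (nabla_spin psi a p X) (phi a p) + herm Q (psi a p) (nabla_spin phi a p X).
Proof.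
rewrite [LHS](deriv_herm oU Ud Up X Q spsi' sphi') !nabla_spinE.
rewrite hermDl hermDr hermZl hermZr conjC_real.
by rewrite (herm_cl2 Hgamma Qskew) mulrN addrACA addNr addr0.
Qed.

Lemma herm_cl_vecE q i u w : herm Q (cl_vec a q (delta_mx 0 i) *m u) w =
  \sum_k (coframe_mx q i k)%:C%C * herm Q (gamma k *m u) w.
Proof.
rewrite cl_vecE mulmx_suml herm_suml; apply: eq_bigr => k _.
by rewrite -scalemxAl hermZl conjC_real -rowE mxE.
Qed.

Lemma smooth_herm_cl_vec i : smooth_inC c U
  (fun q => herm Q (cl_vec a q (delta_mx 0 i) *m psi a q) (phi a q)).
Proof.
under eq_fun do rewrite herm_cl_vecE.
apply: smooth_inC_sum => // k; apply: smooth_inCM => //.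
  by apply: smooth_inC_real; exact: coframe_smooth_in.
by apply: smooth_inC_herm => //; exact: smooth_in_cv_mulmx.
Qed.

Lemma deriv_herm_cl_vec X i :
  dC c X (fun q => herm Q (cl_vec a q (delta_mx 0 i) *m psi a q) (phi a q)) p =
  \sum_k ((connection_mx g c p X *m coframe_mx p) i k)%:C%C *
            herm Q (gamma k *m psi a p) (phi a p) +
  herm Q (cl_vec a p (delta_mx 0 i) *m nabla_spin psi a p X) (phi a p) +
  herm Q (cl_vec a p (delta_mx 0 i) *m psi a p) (nabla_spin phi a p X).
Proof.
pose h k q := herm Q (gamma k *m psi a q) (phi a q).
under eq_fun do rewrite herm_cl_vecE.
have sh k : smooth_inC c U (h k).
  by apply: smooth_inC_herm => //; exact: smooth_in_cv_mulmx.
have sm k : smooth_inC c U (fun q => (coframe_mx q i k)%:C%C).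
  by apply: smooth_inC_real; exact: coframe_smooth_in.
rewrite (dC_sum oU Ud Up) => [|k]; last exact: (smooth_inCM oU Ud (sm k) (sh k)).
pose W := spin_connection_mx p X.
have dh k : dC c X (h k) p = \sum_l (W k l)%:C%C * h l p +
   (herm Q (gamma k *m nabla_spin psi a p X) (phi a p) +
    herm Q (gamma k *m psi a p) (nabla_spin phi a p X)).
  rewrite [LHS](deriv_herm oU Ud Up X Q (smooth_in_cv_mulmx oU Ud (gamma k) spsi') sphi').
  rewrite (deriv_cv_mulmx oU Ud Up X (gamma k) spsi') !nabla_spinE mulmxDr hermDl hermDr.
  rewrite -scalemxAr hermZl hermZr conjC_real -(opprK (herm Q _ (cl2 _ _ *m _))).
  rewrite -(herm_cl2 Hgamma Qskew).
  have -> : \sum_l (W k l)%:C%C * h l p = (2^-1)%:C%C *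
     (herm Q (cl2 gamma W *m (gamma k *m psi a p)) (phi a p) -
      herm Q (gamma k *m (cl2 gamma W *m psi a p)) (phi a p)).
    rewrite -hermBl !mulmxA -mulmxBl.
    have := cl2_comm Hgamma k (spin_connection_anti X).
    rewrite -[LHS]/(cl2 gamma W *m gamma k - gamma k *m cl2 gamma W) => ->.
    rewrite -scalemxAl hermZl mulrA -[_ * _^*]/(_ * _) rmorph_nat.
    have -> : (2^-1)%:C%C * 2%:R = 1 :> R[i].
      by rewrite -(rmorph_nat (real_complex R)) -rmorphM mulVf ?pnatr_eq0.
    rewrite mul1r /cl1 mulmx_suml herm_suml; apply: eq_bigr => l _.
    by rewrite -scalemxAl hermZl conjC_real.
  rewrite mulrBr mulrN -/W.
  rewrite [X in _ = _ + (X + _)]addrC -!addrA addKr [RHS]addrC -!addrA.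
  by rewrite addNr addr0.
transitivity (\sum_k (((connection_mx g c p X *m coframe_mx p) i k)%:C%C * h k p +
  ((coframe_mx p *m W^T) i k)%:C%C * h k p +
  ((coframe_mx p i k)%:C%C * (\sum_l (W k l)%:C%C * h l p) +
   ((coframe_mx p i k)%:C%C * herm Q (gamma k *m nabla_spin psi a p X) (phi a p) +
    (coframe_mx p i k)%:C%C * herm Q (gamma k *m psi a p) (nabla_spin phi a p X))))).
  apply: eq_bigr => k _; rewrite [LHS](dCM oU Ud Up X (sm k) (sh k)) dh.
  rewrite !(mulrDr (coframe_mx p i k)%:C%C); congr (_ + _).
  rewrite -(mulrDl _ ((coframe_mx p *m W^T) i k)%:C%C (h k p)); congr (_ * _).
  rewrite [LHS](dC_real c p X (fun q => coframe_mx q i k)) -rmorphD; congr (_%:C%C).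
  by have /matrixP/(_ i k) := deriv_coframe X; rewrite !mxE.
rewrite (herm_cl_vecE p i (nabla_spin psi a p X)) (herm_cl_vecE p i (psi a p)).
have split5 (f1 f2 f3 f4 f5 : 'I_n -> R[i]) :
    \sum_k (f1 k + f2 k + (f3 k + (f4 k + f5 k))) =
    \sum_k f1 k + \sum_k f4 k + \sum_k f5 k + (\sum_k f2 k + \sum_k f3 k).
  rewrite !big_split /= -!addrA; congr (_ + _).
  by rewrite addrA [RHS]addrA [RHS]addrC.
rewrite split5 [X in _ + X = _](_ : _ = 0) ?addr0 //.
have -> : \sum_k ((coframe_mx p *m W^T) i k)%:C%C * h k p =
    \sum_k \sum_l (coframe_mx p i l * W k l)%:C%C * h k p.
  apply: eq_bigr => k _; rewrite mxE rmorph_sum mulr_suml.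
  by apply: eq_bigr => l _; rewrite [W^T _ _]mxE.
have -> : \sum_k (coframe_mx p i k)%:C%C * (\sum_l (W k l)%:C%C * h l p) =
    \sum_k \sum_l (coframe_mx p i l * W l k)%:C%C * h k p.
  rewrite exchange_big; apply: eq_bigr => k _ /=; rewrite mulr_sumr.
  by apply: eq_bigr => l _; rewrite mulrA -rmorphM.
rewrite -big_split big1 // => k _; rewrite -big_split big1 // => l _ /=.
by rewrite /W (spin_connection_anti X k l) mulrN rmorphN mulNr addNr.
Qed.

End AtPoint.

End SpinPatch.

Section ComplexLocal.
Variables (R : realType) (n : nat) (M : manifold R n) (c : atlas M) (U : set M).
Hypotheses (oU : open U) (Ud : U `<=` chart_dom (chart_at c)).
Variables (f : M -> R[i]) (p : M).
Hypotheses (Up : U p) (sf : smooth_inC c U f).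

Lemma dC_comm i j :
  dC c (delta_mx 0 i) (fun q => dC c (delta_mx 0 j) f q) p =
  dC c (delta_mx 0 j) (fun q => dC c (delta_mx 0 i) f q) p.
Proof.
have [sr si] := sf; rewrite /dC /= !deriv_along_delta.
have e (h : M -> R) k : (fun q => deriv_along c (delta_mx 0 k) h q) = (fun q => pd c k h q).
  by apply/funext => q; exact: deriv_along_delta.
by rewrite !e (pd_comm oU Ud Up i j sr) (pd_comm oU Ud Up i j si).
Qed.

Lemma locally_constantC : (forall q X, U q -> dC c X f q = 0) ->
  \forall q \near p, f q = f p.
Proof.
have [sr si] := sf => df.
have dr q i : U q -> pd c i (fun q => complex.Re (f q)) q = 0.
  by move=> Uq; have [+ _] := df q (delta_mx 0 i) Uq; rewrite deriv_along_delta.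
have di q i : U q -> pd c i (fun q => complex.Im (f q)) q = 0.
  by move=> Uq; have [_ +] := df q (delta_mx 0 i) Uq; rewrite deriv_along_delta.
have nr := locally_constant_in oU Ud Up sr dr.
have ni := locally_constant_in oU Ud Up si di.
apply: filterS2 nr ni => q; case: (f q) (f p) => [x y] [x' y'] /= -> -> //.
Qed.

End ComplexLocal.

Section SpinorDerivatives.
Variables (R : realType) (n m : nat) (M : manifold R n) (g : riemannian_metric M).
Variables (J : almost_complex M) (gamma : 'I_n -> 'M[R[i]]_m.+1).
Variables (S : spin_structure g gamma) (a : spin_patch S).
Implicit Types (X : 'rV[R]_n) (phi psi : spinor S) (s : R).

Local Notation U := (patch_dom a).
Local Notation c := (patch_chart a).
Let oU : open U. Proof. exact: patch_dom_open. Qed.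
Let Ud : U `<=` chart_dom (chart_at c). Proof. exact: patch_dom_sub. Qed.

Variable p : M.
Hypothesis Up : U p.

Lemma nabla_spin_eq phi psi X : (forall q, U q -> phi a q = psi a q) ->
  nabla_spin phi a p X = nabla_spin psi a p X.
Proof.
move=> e; rewrite !nabla_spinE (e p Up).
by rewrite (deriv_cv_eq oU Ud Up X e).
Qed.

Lemma nabla_s_eq s phi psi X : (forall q, U q -> phi a q = psi a q) ->
  nabla_s J s phi a p X = nabla_s J s psi a p X.
Proof. by move=> e; rewrite /nabla_s (nabla_spin_eq X e) (e p Up). Qed.

Lemma nabla_spin_scale (f : M -> R[i]) phi X : smooth_inC c U f ->
  smooth_in_cv c U (phi a) ->
  nabla_spin (fun b q => f q *: phi b q) a p X =
  dC c X f p *: phi a p + f p *: nabla_spin phi a p X.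
Proof.
move=> sf sp; rewrite !nabla_spinE (deriv_cv_scale oU Ud Up X sf sp).
by rewrite -scalemxAr scalerDr -addrA !scalerA (mulrC (f p)).
Qed.

Lemma nabla_s_scale s (f : M -> R[i]) phi X : smooth_inC c U f ->
  smooth_in_cv c U (phi a) ->
  nabla_s J s (fun b q => f q *: phi b q) a p X =
  dC c X f p *: phi a p + f p *: nabla_s J s phi a p X.
Proof.
move=> sf sp; rewrite /nabla_s (nabla_spin_scale X sf sp).
move: (dC _ _ _ _ *: _) (nabla_spin _ _ _ _) (cl_contract_torsion _ _ _ _) => u A K.
by rewrite -scalemxAr scalerDr -addrA !scalerA (mulrC (f p)).
Qed.

Lemma nabla_sD s phi psi X : smooth_in_cv c U (phi a) -> smooth_in_cv c U (psi a) ->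
  nabla_s J s (fun b q => phi b q + psi b q) a p X =
  nabla_s J s phi a p X + nabla_s J s psi a p X.
Proof.
move=> sp ss; rewrite /nabla_s !nabla_spinE (deriv_cvD oU Ud Up X sp ss).
move: (deriv_along_cmx _ _ _ _) (deriv_along_cmx _ _ _ _) => u v.
rewrite !mulmxDr !scalerDr (addrACA v u).
exact: addrACA.
Qed.

Variable Q : 'M[R[i]]_m.+1.
Hypothesis Hgamma : clifford_rep gamma.
Hypothesis Qskew : forall i u v, herm Q (gamma i *m u) v = - herm Q u (gamma i *m v).

Lemma deriv_herm_s s phi psi X : spinor_field phi -> spinor_field psi ->
  dC c X (fun q => herm Q (psi a q) (phi a q)) p =
  herm Q (nabla_s J s psi a p X) (phi a p) + herm Q (psi a p) (nabla_s J s phi a p X).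
Proof.
move=> sp ss; rewrite (deriv_herm_spin Hgamma Up Qskew ss sp X) /nabla_s.
move: (nabla_spin _ _ _ _) (nabla_spin _ _ _ _) => A B.
rewrite hermDl hermDr hermZl hermZr conjC_real (herm_cl2 Hgamma Qskew).
by rewrite mulrN addrACA addNr addr0.
Qed.

End SpinorDerivatives.

Section NowhereZero.
Variables (R : realType) (n m : nat) (M : manifold R n) (g : riemannian_metric M).
Variables (gamma : 'I_n -> 'M[R[i]]_m.+1) (S : spin_structure g gamma).
Hypothesis Hgamma : clifford_rep gamma.
Variable Q : 'M[R[i]]_m.+1.
Hypothesis Qu : Q \in unitmx.
Hypothesis Qskew : forall i u v, herm Q (gamma i *m u) v = - herm Q u (gamma i *m v).
Variables (phi : spinor S) (kappa : R).
Hypotheses (sphi : spinor_field phi) (Kphi : riemannian_killing kappa phi).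

Lemma killing_norm_deriv a p X : patch_dom a p ->
  dC (patch_chart a) X (fun q => herm Q (phi a q) (phi a q)) p = 0.
Proof.
move=> Up; rewrite (deriv_herm_spin Hgamma Up Qskew sphi sphi X) !(Kphi.2 _ _ _ Up).
by rewrite hermZl hermZr conjC_real herm_cl1 // mulrN addNr.
Qed.

Lemma killing_nowhere_zero : nonzero_spinor phi ->
  forall a p, patch_dom a p -> phi a p != 0.
Proof.
move=> [a0 [p0 [Up0 nz0]]].
pose Z : set M := [set p | forall a, patch_dom a p -> phi a p = 0].
have ZP a p : patch_dom a p -> phi a p = 0 -> Z p.
  by move=> ap e b bp; rewrite (sphi.2 _ _ _ bp ap) e mulmx0.
have lc a p : patch_dom a p -> \forall q \near p, patch_dom a q /\
    herm Q (phi a q) (phi a q) = herm Q (phi a p) (phi a p).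
  move=> ap; have n1 : nbhs p (patch_dom a).
    by apply: open_nbhs_nbhs; split=> //; exact: patch_dom_open.
  have n2 := locally_constantC (@patch_dom_open _ _ _ _ _ _ _ a)
    (@patch_dom_sub _ _ _ _ _ _ _ a) ap (smooth_herm_spinor a Q sphi sphi)
    (fun q X aq => killing_norm_deriv X aq).
  by apply: filterS2 n1 n2.
have oZ : open Z.
  rewrite openE => p Zp; have [a ap] := patch_dom_cover S p.
  apply: filterS (lc a p ap) => q [aq e]; apply: (ZP a q aq).
  by apply: (herm_eq0 Qu); rewrite e (Zp a ap) herm0r.
have cZ : closed Z.
  rewrite -openC openE => p nZp; have [a ap] := patch_dom_cover S p.
  apply: filterS (lc a p ap) => q [aq e] Zq; apply: nZp; apply: (ZP a p ap).
  by apply: (herm_eq0 Qu); rewrite -e (Zq a aq) herm0r.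
move=> a p ap; apply/eqP => e.
have ZT : Z = setT.
  apply: (points_connected (m := M)).
  - by exists p; exact: ZP ap e.
  - by exists Z => //; rewrite setTI.
  - by exists Z => //; rewrite setTI.
have Zp0 : Z p0 by rewrite ZT.
exact: nz0 (Zp0 a0 Up0).
Qed.

End NowhereZero.

Section TorsionFrame.
Variables (R : realType) (n m : nat) (M : manifold R n) (g : riemannian_metric M).
Variables (J : almost_complex M) (gamma : 'I_n -> 'M[R[i]]_m.+1).
Hypothesis NK : nearly_kahler g J.
Variables (S : spin_structure g gamma) (a : spin_patch S) (p : M).
Hypothesis ap : patch_dom a p.

Let dp : chart_dom (chart_at (patch_chart a)) p. Proof. exact: patch_dom_sub ap. Qed.
Local Notation t := (torsion_frame J a p).

Lemma torsion3_anti12 X Y Z : torsion3 g J (patch_chart a) p X Y Z =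
  - torsion3 g J (patch_chart a) p Y X Z.
Proof. by apply: (torsion3_swap12 dp) => W; exact: NK.2. Qed.

Lemma torsion3_anti23 X Y Z : torsion3 g J (patch_chart a) p X Y Z =
  - torsion3 g J (patch_chart a) p X Z Y.
Proof. exact: (torsion3_swap23 dp NK.1). Qed.

Lemma torsion_frame_anti12 i j k : t i j k = - t j i k.
Proof. exact: torsion3_anti12. Qed.

Lemma torsion_frame_anti23 i j k : t i j k = - t i k j.
Proof. exact: torsion3_anti23. Qed.

Lemma cl_contract_torsionE X : cl_contract_torsion J a p X =
  \sum_k (inner g (patch_chart a) p X (frame_vec a k p))%:C%C *: cl2 gamma (t k).
Proof.
have cyc k i j : t k i j = t i j k.
  by rewrite torsion_frame_anti12 torsion_frame_anti23 opprK.
under [RHS]eq_bigr => k _ do rewrite scaler_sumr.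
rewrite exchange_big; apply: eq_bigr => i _ /=.
under [RHS]eq_bigr => k _ do rewrite scaler_sumr.
rewrite exchange_big; apply: eq_bigr => j _ /=.
under [RHS]eq_bigr => k _ do rewrite scalerA -rmorphM.
rewrite -scaler_suml -rmorph_sum; congr (_%:C%C *: _).
rewrite torsion3_anti12 torsion3_anti23 opprK /torsion3 (inner_sum_frame _ _ ap).
by apply: eq_bigr => k _; rewrite mulrC cyc.
Qed.

Lemma torsion_norm_sqr : torsion_norm J a p ^+ 2 =
  \sum_(i < n) \sum_(j < n | (i < j)%N) \sum_(k < n | (j < k)%N) t i j k ^+ 2.
Proof.
have e (i j : 'I_n) : inner g (patch_chart a) p
    (torsion g J (patch_chart a) p (frame_vec a i p) (frame_vec a j p))
    (torsion g J (patch_chart a) p (frame_vec a i p) (frame_vec a j p)) =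
    \sum_k t i j k ^+ 2.
  by rewrite (inner_sum_frame _ _ ap); apply: eq_bigr => k _; rewrite -expr2.
rewrite /torsion_norm /=.
under eq_bigr => i _ do under eq_bigr => j _ do rewrite e.
have ge0 : 0 <= \sum_(i < n) \sum_(j < n | (i < j)%N) \sum_k t i j k ^+ 2.
  by apply: sumr_ge0 => i _; apply: sumr_ge0 => j _; apply: sumr_ge0 => k _; exact: sqr_ge0.
rewrite sqr_sqrtr; last by rewrite mulr_ge0 // invr_ge0 ler0n.
have t12 i j k : t i j k ^+ 2 = t j i k ^+ 2 by rewrite torsion_frame_anti12 sqrrN.
have t23 i j k : t i j k ^+ 2 = t i k j ^+ 2 by rewrite torsion_frame_anti23 sqrrN.
have t0 i k : t i i k ^+ 2 = 0.
  have h := torsion_frame_anti12 i i k.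
  by rewrite (_ : t i i k = 0) ?expr0n //; lra.
have h3 := sum_offdiag3 (f := fun i j k => t i j k ^+ 2) t12 t23 t0.
have h2 := @sum_offdiag2 _ _ (fun i j => \sum_k t i j k ^+ 2).
rewrite h2 in h3 => [|i j|i]; last by rewrite big1.
  have arith (A B : R) : A *+ 2 = B *+ 6 -> 3^-1 * A = B.
    by rewrite -[A *+ 2]mulr_natl -[B *+ 6]mulr_natl => h; lra.
  exact: arith h3.
by apply: eq_bigr => k _; exact: t12.
Qed.

End TorsionFrame.

Lemma gradient_terms_vanish (R : realType) (n m : nat) (gamma : 'I_n -> 'M[R[i]]_m.+1)
    (f : 'I_n -> R[i]) (u v : 'cV[R[i]]_m.+1) :
  clifford_rep gamma -> (2 < n)%N -> v != 0 ->
  (forall j, f j *: (gamma j *m v) = u) -> forall j, f j = 0.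
Proof.
move=> Hg n2 v0 fu.
have sq i j : i != j -> f i ^+ 2 + f j ^+ 2 = 0.
  move=> ij; have gs k : gamma k *m gamma k = - 1%:M := gen_sqr Hg (complex_two_neq0 R) k.
  pose w := gamma i *m (gamma j *m v).
  have e1 : f j *: w = - (f i *: v).
    rewrite /w scalemxAr (fu j) -(fu i) -scalemxAr mulmxA gs mulNmx mul1mx.
    by rewrite scalerN.
  have e2 : gamma i *m (gamma j *m w) = - v.
    have -> : gamma j *m w = gamma i *m v.
      have gji : gamma j *m gamma i = - (gamma i *m gamma j).
        by apply: (gamma_anticomm Hg); rewrite eq_sym.
      rewrite /w mulmxA gji mulNmx -mulmxA (mulmxA (gamma j) (gamma j)) gs.
      by rewrite mulNmx mul1mx mulmxN opprK.
    by rewrite mulmxA gs mulNmx mul1mx.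
  have : f j ^+ 2 *: v = - (f i ^+ 2 *: v).
    have -> : f j ^+ 2 *: v = - (f j *: (gamma i *m (gamma j *m (f j *: w)))).
      by rewrite -!scalemxAr e2 scalerA -expr2 scalerN opprK.
    rewrite e1 !mulmxN -!scalemxAr scalerN opprK scalerA mulrC -scalerA -/w e1.
    by rewrite scalerN scalerA -expr2.
  move=> h; apply/eqP; have : (f i ^+ 2 + f j ^+ 2) *: v == 0.
    by rewrite scalerDl h addrN.
  by rewrite scaler_eq0 (negbTE v0) orbF.
move=> j.
have [k kj [l lj lk]] : exists2 k, k != j & exists2 l, l != j & l != k.
  have h0 : (0 < n)%N by apply: leq_trans n2.
  have h1 : (1 < n)%N by apply: leq_trans n2.
  pose a0 := Ordinal h0; pose a1 := Ordinal h1; pose a2 := Ordinal n2.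
  have [->|j0] := eqVneq j a0; first by exists a1 => //; exists a2.
  have [->|j1] := eqVneq j a1; first by exists a0 => //; exists a2.
  by exists a0; [rewrite eq_sym|exists a1 => //; rewrite eq_sym].
have := sq _ _ kj; have := sq _ _ lj; have := sq _ _ lk.
move=> /eqP; rewrite addr_eq0 => /eqP -> /eqP; rewrite addr_eq0 eqr_opp => /eqP ->.
rewrite -mulr2n => /eqP; rewrite mulrn_eq0 sqrf_eq0 => /eqP; exact.
Qed.

(** * Spinors on nearly Kaehler manifolds *)

Lemma antisymmetric_part_eq0 (F : fieldType) (A k z S c x y X Y : F) : S != 0 ->
  k + z = - (S * c) ->
  A + k * x + (- (z * y) - S * Y) = A + k * y + (- (z * x) - S * X) ->
  c * (x - y) - (X - Y) = 0.
Proof.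
move=> S0 kz /eqP; rewrite -subr_eq0 => /eqP h; apply: (mulfI S0).
by rewrite mulr0 mulrBr mulrA -[S * c]opprK -kz -[RHS]oppr0 -h; ring.
Qed.

Lemma opposite_part_eq0 (K : fieldType) (V : lmodType K) (z b a : K) (x y u : V) :
  (2%:R : K) != 0 -> z != 0 -> y != 0 -> u = a *: x + b *: y ->
  z *: u = a *: (z *: x) + b *: (- z *: y) -> b = 0.
Proof.
move=> two0 z0 y0 ->; rewrite scalerDr !scalerA (mulrC z a) mulrN => /addrI /eqP.
rewrite -subr_eq0 -scalerBl opprK (mulrC z b) -mulr2n -mulr_natl.
by rewrite scaler_eq0 (negbTE y0) orbF !mulf_eq0 (negbTE two0) (negbTE z0) orbF => /eqP.
Qed.

Section NearlyKahlerSpinors.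
Variables (R : realType) (M : manifold R 6) (g : riemannian_metric M).
Variables (J : almost_complex M) (gamma : 'I_6 -> 'M[R[i]]_8).
Variables (S : spin_structure g gamma) (tau : R) (phi_ : bool -> spinor S).
Hypothesis Hgamma : clifford_rep gamma.
Hypothesis HnK : strict_nearly_kahler g J.
Hypothesis Htau : forall (a : spin_patch S) (p : M), patch_dom a p -> torsion_norm J a p = tau.
Hypothesis Hphi : forall e, spinor_field (phi_ e) /\ nonzero_spinor (phi_ e).
Hypothesis Hkilling : forall e phi, spinor_field phi ->
  (riemannian_killing (sign_of R e * tau / 4) phi <-> in_line phi (phi_ e)).
Hypothesis HTphi : forall e, in_eigenbundle J (sign_of R e * (2 * tau)) (phi_ e).
Hypothesis Hparallel : forall phi, spinor_field phi ->
  (parallel_c J phi <-> in_span2 phi (phi_ true) (phi_ false)).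
Variable Q : 'M[R[i]]_8.
Hypothesis Qu : Q \in unitmx.
Hypothesis Qskew : forall i u v, herm Q (gamma i *m u) v = - herm Q u (gamma i *m v).
Implicit Types (a : spin_patch S) (p q : M) (X : 'rV[R]_6) (phi : spinor S) (s : R).

Local Notation sg := (sign_of R).
Local Notation zeta e s := (- sg e * ((4 * s - 1) / 4) * tau).

Lemma sign_of_neg e : sg (~~ e) = - sg e.
Proof. by case: e; rewrite /= ?opprK. Qed.

Lemma sign_of_neq0 e : sg e != 0.
Proof. by case: e; rewrite /= ?oppr_eq0 oner_eq0. Qed.

Lemma phi_killing e : riemannian_killing (sg e * tau / 4) (phi_ e).
Proof.
by apply/(Hkilling e (Hphi e).1); exists 1 => a p _; rewrite scale1r.
Qed.

Lemma tau_neq0 : tau != 0.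
Proof.
by apply/eqP => t0; have [+ _] := phi_killing true; rewrite t0 mulr0 mul0r.
Qed.

Lemma zeta_neq0 e s : s <> 1 / 4 -> zeta e s != 0.
Proof.
move=> s4; rewrite !mulf_neq0 ?oppr_eq0 ?sign_of_neq0 ?tau_neq0 ?invr_eq0 ?pnatr_eq0 //.
by apply/eqP => h; apply: s4; lra.
Qed.

Lemma phi_neq0 e a p : patch_dom a p -> phi_ e a p != 0.
Proof.
exact: (killing_nowhere_zero (m := 7) Hgamma Qu Qskew (Hphi e).1 (phi_killing e) (Hphi e).2).
Qed.

Lemma phi_contract e a p X : patch_dom a p ->
  cl_contract_torsion J a p X *m phi_ e a p =
  (- (sg e * tau))%:C%C *: (cl_vec a p X *m phi_ e a p).
Proof.
move=> ap; have : parallel_c J (phi_ e).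
  apply/(Hparallel (Hphi e).1); case: e => /=.
    by exists 1, 0 => b q _; rewrite scale1r scale0r addr0.
  by exists 0, 1 => b q _; rewrite scale1r scale0r add0r.
move=> /(_ a p X ap); rewrite /nabla_s ((phi_killing e).2 a p X ap).
move: (cl_contract_torsion _ _ _ _ *m _) (cl_vec _ _ _ *m _) => u w /eqP.
rewrite addrC addr_eq0 => /eqP h.
have -> : u = 4%:C%C *: (4^-1%:C%C *: u).
  by rewrite scalerA -rmorphM divff ?pnatr_eq0 // rmorph1 scale1r.
rewrite h scalerN -scaleNr scalerA -rmorphN -rmorphM; congr (_%:C%C *: _).
by field.
Qed.

Lemma line_contract e a p X z (u : 'cV[R[i]]_8) : patch_dom a p -> u = z *: phi_ e a p ->
  cl_contract_torsion J a p X *m u = (- (sg e * tau))%:C%C *: (cl_vec a p X *m u).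
Proof.
by move=> ap ->; rewrite -!scalemxAr phi_contract // !scalerA mulrC.
Qed.

Lemma killing_line e phi a p : spinor_field phi ->
  riemannian_killing (sg e * tau / 4) phi -> patch_dom a p ->
  exists z, phi a p = z *: phi_ e a p.
Proof.
by move=> sphi /(Hkilling e sphi) [z hz] ap; exists z; exact: hz.
Qed.

Lemma killing_nabla_s e s phi : spinor_field phi ->
  riemannian_killing (sg e * tau / 4) phi -> killing_torsion J s (zeta e s) phi.
Proof.
move=> sphi K a p X ap; have [z hz] := killing_line sphi K ap.
rewrite /nabla_s (K.2 a p X ap) (line_contract X ap hz).
rewrite scalerA -rmorphM -scalerDl -rmorphD; congr (_%:C%C *: _).
by field.
Qed.

Lemma killing_of_nabla_s e s phi : killing_torsion J s (zeta e s) phi ->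
  (forall a p, patch_dom a p -> exists z, phi a p = z *: phi_ e a p) ->
  riemannian_killing (sg e * tau / 4) phi.
Proof.
move=> K line; split=> [|a p X ap]; first exact: (phi_killing e).1.
have := K a p X ap; have [z hz] := line a p ap.
rewrite /nabla_s (line_contract X ap hz).
move: (nabla_spin _ _ _ _) (cl_vec _ _ _ *m _) => u w /eqP.
rewrite scalerA -rmorphM -subr_eq0 -addrA addr_eq0 => /eqP ->.
rewrite -scalerBl -scaleNr -rmorphB -rmorphN; congr (_%:C%C *: _).
by field.
Qed.

Lemma torsion_sum e a p : patch_dom a p ->
  4 * (\sum_(i < 6) \sum_(j < 6 | (i < j)%N) \sum_(k < 6 | (j < k)%N)
    torsion_frame J a p i j k ^+ 2) = (sg e * (2 * tau)) ^+ 2.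
Proof.
move=> ap; rewrite -(torsion_norm_sqr HnK.1 ap) (Htau ap).
by case: e => /=; ring.
Qed.

Lemma eigenvalue_neq0 e : sg e * (2 * tau) != 0.
Proof. by rewrite !mulf_neq0 ?sign_of_neq0 ?tau_neq0 ?pnatr_eq0. Qed.

Lemma HTphi_neg e a p : patch_dom a p ->
  cl_torsion J a p *m phi_ (~~ e) a p = - (sg e * (2 * tau))%:C%C *: phi_ (~~ e) a p.
Proof. by move=> ap; rewrite (HTphi (~~ e)) // sign_of_neg mulNr rmorphN. Qed.

Lemma eigen_line e a p u : patch_dom a p ->
  cl_torsion J a p *m u = (sg e * (2 * tau))%:C%C *: u ->
  exists z, u = z *: phi_ e a p.
Proof.
move=> ap; apply: (three_form_line Hgamma Qu Qskew (eigenvalue_neq0 e) (torsion_sum e ap)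
  (phi_neq0 e ap) (HTphi e ap) (phi_neq0 (~~ e) ap)).
exact: HTphi_neg.
Qed.

Lemma killing_twistor e s phi : killing_torsion J s (zeta e s) phi -> twistor_torsion J s phi.
Proof.
move=> K a p X ap; rewrite /dirac_s (K a p X ap).
have -> : \sum_i gamma i *m nabla_s J s phi a p (frame_vec a i p) =
    (- 6 * zeta e s)%:C%C *: phi a p.
  transitivity (\sum_(i < 6) - ((zeta e s)%:C%C *: phi a p)).
    apply: eq_bigr => i _; rewrite (K a p _ ap) (cl_vec_frame i ap).
    rewrite -scalemxAr mulmxA.
    have -> : gamma i *m gamma i = - 1%:M by exact: (gen_sqr (m := 7) Hgamma (complex_two_neq0 R)).
    by rewrite mulNmx mul1mx scalerN.
  rewrite sumr_const card_ord -scaler_nat scalerN -scaleNr scalerA mulNr -mulrN -rmorphN.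
  by rewrite -(rmorph_nat (real_complex R)) -rmorphM; congr (_%:C%C *: _); ring.
rewrite -scalemxAr scalerA -rmorphM -scalerDl -rmorphD.
by rewrite (_ : _ + _ = 0) ?rmorph0 ?scale0r //; field.
Qed.

Lemma smooth_spinor a phi : spinor_field phi -> smooth_in_cv (patch_chart a) (patch_dom a) (phi a).
Proof. by move=> sp; apply: smooth_cmx_in_cv (sp.1 a); exact: patch_dom_sub. Qed.

Lemma phi_norm_neq0 e a p : patch_dom a p -> herm Q (phi_ e a p) (phi_ e a p) != 0.
Proof.
by move=> ap; apply: contra_neq (phi_neq0 e ap) => /(herm_eq0 Qu).
Qed.

Lemma phi_norm_deriv e a p X : patch_dom a p ->
  dC (patch_chart a) X (fun q => herm Q (phi_ e a q) (phi_ e a q)) p = 0.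
Proof.
exact: (killing_norm_deriv (m := 7) Hgamma Qskew (Hphi e).1 (phi_killing e)).
Qed.

Lemma gamma_sqr i : gamma i *m gamma i = - 1%:M.
Proof. exact: (gen_sqr (m := 7) Hgamma (complex_two_neq0 R)). Qed.

Lemma killing_of_twistor e s phi : s <> 1 / 4 -> spinor_field phi ->
  twistor_torsion J s phi -> in_eigenbundle J (sg e * (2 * tau)) phi ->
  riemannian_killing (sg e * tau / 4) phi.
Proof.
move=> s4 sphi tw eig; pose v := phi_ e; have sv : spinor_field v := (Hphi e).1.
have line a p : patch_dom a p -> exists z, phi a p = z *: v a p.
  by move=> ap; apply: (eigen_line ap); exact: eig.
apply: (@killing_of_nabla_s e s) => // a p X ap.
pose N q := herm Q (v a q) (v a q); pose F q := herm Q (v a q) (phi a q).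
have NF q : patch_dom a q -> N q *: phi a q = F q *: v a q.
  by move=> aq; have [z hz] := line a q aq; rewrite /F hz hermZr scalerA mulrC.
have N0 : N p != 0 := phi_norm_neq0 e ap.
have sN : smooth_inC (patch_chart a) (patch_dom a) N := smooth_herm_spinor a Q sv sv.
have sF : smooth_inC (patch_chart a) (patch_dom a) F := smooth_herm_spinor a Q sv sphi.
pose dF Y := dC (patch_chart a) Y F p.
have nv Y : nabla_s J s v a p Y = (zeta e s)%:C%C *: (cl_vec a p Y *m v a p).
  exact: (killing_nabla_s s sv (phi_killing e)).
have key Y : N p *: nabla_s J s phi a p Y =
    dF Y *: v a p + (F p * (zeta e s)%:C%C) *: (cl_vec a p Y *m v a p).
  have := nabla_s_eq J (phi := fun b q => N q *: phi b q) (psi := fun b q => F q *: v b q)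
    ap s Y NF.
  rewrite (nabla_s_scale J ap s Y sN (smooth_spinor a sphi)).
  rewrite (nabla_s_scale J ap s Y sF (smooth_spinor a sv)).
  by rewrite (phi_norm_deriv e Y ap) scale0r add0r nv scalerA.
pose w := \sum_i dF (frame_vec a i p) *: (gamma i *m v a p).
have A Y : dF Y *: v a p + (6%:R^-1)%:C%C *: (cl_vec a p Y *m w) = 0.
  have := congr1 (fun u => N p *: u) (tw a p Y ap).
  rewrite scaler0 scalerDr key /dirac_s (scalerA (N p)) (mulrC (N p)) -(scalerA _ (N p)).
  rewrite (scalemxAr (N p)) scaler_sumr.
  have -> : \sum_i N p *: (gamma i *m nabla_s J s phi a p (frame_vec a i p)) =
      w - (6%:R * F p * (zeta e s)%:C%C) *: v a p.
    transitivity (\sum_(i < 6) (dF (frame_vec a i p) *: (gamma i *m v a p) -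
       (F p * (zeta e s)%:C%C) *: v a p)).
      apply: eq_bigr => i _; rewrite scalemxAr key mulmxDr -!scalemxAr (cl_vec_frame i ap).
      by rewrite mulmxA gamma_sqr mulNmx mul1mx scalerN.
    rewrite sumrB sumr_const card_ord; congr (_ - _).
    by rewrite -scaler_nat scalerA mulrA.
  rewrite mulmxBr -scalemxAr scalerBr scalerA.
  have -> : (6%:R^-1)%:C%C * (6%:R * F p * (zeta e s)%:C%C) = F p * (zeta e s)%:C%C.
    rewrite !mulrA -(rmorph_nat (real_complex R) 6) -rmorphM mulVf ?pnatr_eq0 //.
    by rewrite rmorph1 mul1r.
  by rewrite addrA addrAC addrK.
have f0 : forall j, dF (frame_vec a j p) = 0.
  apply: (gradient_terms_vanish (m := 7) (u := (6%:R^-1)%:C%C *: w) Hgamma _ (phi_neq0 e ap)) => // j.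
  have := congr1 (mulmx (gamma j)) (A (frame_vec a j p)).
  rewrite (cl_vec_frame j ap) mulmx0 mulmxDr -!scalemxAr mulmxA gamma_sqr mulNmx mul1mx.
  by rewrite scalerN => /eqP; rewrite subr_eq0 => /eqP.
have w0 : w = 0 by rewrite /w big1 // => i _; rewrite f0 scale0r.
have dF0 : dF X = 0.
  have := A X; rewrite w0 mulmx0 scaler0 addr0 => /eqP.
  by rewrite scaler_eq0 (negbTE (phi_neq0 e ap)) orbF => /eqP.
apply: (scalerI N0); rewrite key dF0 scale0r add0r.
rewrite [RHS]scalerA (mulrC (N p)) -[RHS]scalerA (scalemxAr (N p)) (NF p ap).
by rewrite -scalemxAr scalerA (mulrC (F p)).
Qed.

Lemma christoffel_connection a p (i j : 'I_6) k : patch_dom a p ->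
  (connection_mx g (patch_chart a) p (delta_mx 0 j) *m coframe_mx a p) i k =
  (connection_mx g (patch_chart a) p (delta_mx 0 i) *m coframe_mx a p) j k.
Proof.
move=> ap; rewrite mxE [RHS]mxE; apply: eq_bigr => l _; congr (_ * _).
have e (r u : 'I_6) : connection_mx g (patch_chart a) p (delta_mx 0 r) u l =
    christoffel g (patch_chart a) p r u l.
  rewrite mxE (bigD1 r) //= big1 ?addr0 => [|b br].
    by rewrite mxE !eqxx mul1r.
  by rewrite mxE (negbTE br) andbF mul0r.
rewrite !e; apply: christoffel_sym ap _ _ _; [exact: patch_dom_open|exact: patch_dom_sub].
Qed.

Lemma cl_torsion_anticomm a p X : patch_dom a p ->
  cl_torsion J a p *m cl_vec a p X + cl_vec a p X *m cl_torsion J a p =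
  - 2%:R *: cl_contract_torsion J a p X.
Proof.
move=> ap; rewrite (cl_contract_torsionE HnK.1 ap).
rewrite /cl_vec /cl1 mulmx_sumr mulmx_suml -big_split scaler_sumr.
apply: eq_bigr => k _ /=; rewrite -scalemxAr -scalemxAl -scalerDr.
have := cl3_anticomm (m := 7) Hgamma k (torsion_frame_anti12 HnK.1 ap)
  (torsion_frame_anti23 HnK.1 ap).
rewrite -[LHS]/(cl_torsion J a p *m gamma k + gamma k *m cl_torsion J a p) => ->.
by rewrite scalerA mulrC -scalerA.
Qed.

Lemma cl_torsion_vec e a p X : patch_dom a p ->
  cl_torsion J a p *m (cl_vec a p X *m phi_ e a p) = 0.
Proof.
move=> ap; have := congr1 (mulmx^~ (phi_ e a p)) (cl_torsion_anticomm X ap).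
rewrite mulmxDl -scalemxAl -!mulmxA (phi_contract e X ap) (HTphi e ap) -scalemxAr.
move=> h; apply: (addIr ((sg e * (2 * tau))%:C%C *: (cl_vec a p X *m phi_ e a p))).
rewrite [LHS]h add0r scalerA; congr (_ *: _).
rewrite -(rmorph_nat (real_complex R) 2) -rmorphN -rmorphM; congr (_%:C%C); ring.
Qed.

Lemma herm_cl_vec a p X u w :
  herm Q (cl_vec a p X *m u) w = - herm Q u (cl_vec a p X *m w).
Proof. exact: (herm_cl1 (m := 7) Qskew). Qed.

(* The second derivatives of <phi_-, phi> along coordinate fields commute, and
   its gradient is X |-> <X phi_-, phi> up to a factor. *)
Lemma killing_torsion_commutator e s phi : s <> 0 -> s <> 1 / 4 -> spinor_field phi ->
  killing_torsion J s (zeta e s) phi -> forall a p (i j : 'I_6), patch_dom a p ->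
  let ci := cl_vec a p (delta_mx 0 i) in let cj := cl_vec a p (delta_mx 0 j) in
  herm Q (((sg e * (2 * tau))%:C%C%:M - cl_torsion J a p) *m (ci *m cj - cj *m ci) *m
          phi_ (~~ e) a p) (phi a p) = 0.
Proof.
move=> s0 s4 sphi K a p i j ap /=.
pose v := phi_ (~~ e); have sv : spinor_field v := (Hphi (~~ e)).1.
pose cc k := cl_vec a p (delta_mx 0 k).
pose T := cl_torsion J a p.
pose h u := herm Q u (phi a p).
pose theta k q := herm Q (cl_vec a q (delta_mx 0 k) *m v a q) (phi a q).
pose F q := herm Q (v a q) (phi a q).
have sF : smooth_inC (patch_chart a) (patch_dom a) F := smooth_herm_spinor a Q sv sphi.
have nv X q : patch_dom a q ->
    nabla_s J s v a q X = (- zeta e s)%:C%C *: (cl_vec a q X *m v a q).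
  move=> aq; have := killing_nabla_s s sv (phi_killing (~~ e)) X aq.
  by rewrite sign_of_neg => ->; congr (_%:C%C *: _); ring.
have dF q k : patch_dom a q -> dC (patch_chart a) (delta_mx 0 k) F q =
    (- 2 * zeta e s)%:C%C * theta k q.
  move=> aq; rewrite (deriv_herm_s J aq (m := 7) Hgamma Qskew s _ sphi sv) (nv _ _ aq) (K _ _ _ aq).
  rewrite hermZl hermZr conjC_real -[herm Q (v a q) _]opprK -herm_cl_vec.
  rewrite mulrN -mulNr -rmorphN -mulrDl -rmorphD; congr (_%:C%C * _); ring.
have oU : open (patch_dom a) by exact: patch_dom_open.
have Ud : patch_dom a `<=` chart_dom (chart_at (patch_chart a)) by exact: patch_dom_sub.
have stheta k : smooth_inC (patch_chart a) (patch_dom a) (theta k).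
  exact: (smooth_herm_cl_vec a Q sv sphi k).
have comm : dC (patch_chart a) (delta_mx 0 j) (theta i) p =
            dC (patch_chart a) (delta_mx 0 i) (theta j) p.
  have := dC_comm oU Ud ap sF j i.
  rewrite (dC_eq oU Ud ap (delta_mx 0 j) (fun q aq => dF q i aq)).
  rewrite (dC_eq oU Ud ap (delta_mx 0 i) (fun q aq => dF q j aq)).
  rewrite (dC_mulr oU Ud ap _ _ (stheta i)) (dC_mulr oU Ud ap _ _ (stheta j)).
  apply: mulfI; rewrite complexR_eq0 mulf_neq0 ?zeta_neq0 // oppr_eq0 pnatr_eq0 //.
pose tens k l := cc k *m (cc l *m v a p).
have Tk k l : herm Q (cl_contract_torsion J a p (delta_mx 0 k) *m (cc l *m v a p)) (phi a p) =
    - (2^-1)%:C%C * h (T *m tens k l).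
  have := congr1 (fun B => h (B *m (cc l *m v a p))) (cl_torsion_anticomm (delta_mx 0 k) ap).
  rewrite -/(cc k) -/T /h mulmxDl hermDl -!mulmxA (cl_torsion_vec _ _ ap) mulmx0 herm0l addr0.
  have c2 : (- 2%:R : R[i])^* = (- 2)%:C%C by rewrite rmorphN /= conjC_nat rmorphN rmorph_nat.
  rewrite -[in X in _ = X -> _]scalemxAl hermZl c2 => ->.
  rewrite mulrA -[LHS]mul1r; congr (_ * _).
  by rewrite -rmorphN -rmorphM -[LHS](rmorph1 (real_complex R)); congr (_%:C%C); field.
have deriv_theta k l : dC (patch_chart a) (delta_mx 0 l) (theta k) p =
    \sum_r ((connection_mx g (patch_chart a) p (delta_mx 0 l) *m coframe_mx a p) k r)%:C%C *
       herm Q (gamma r *m v a p) (phi a p) +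
    (sg (~~ e) * tau / 4)%:C%C * h (tens k l) +
    (- ((zeta e s)%:C%C * h (tens l k)) - (s / 2)%:C%C * h (T *m tens l k)).
  rewrite /theta (deriv_herm_cl_vec (m := 7) Hgamma ap Qskew sv sphi).
  rewrite ((phi_killing (~~ e)).2 _ _ _ ap); congr (_ + _ + _).
    by rewrite -scalemxAr hermZl conjC_real.
  have -> : nabla_spin phi a p (delta_mx 0 l) =
      (zeta e s)%:C%C *: (cc l *m phi a p) -
      s%:C%C *: (cl_contract_torsion J a p (delta_mx 0 l) *m phi a p).
    by rewrite -(K _ _ _ ap) addrK.
  rewrite hermBr !hermZr -[herm Q _ (cc l *m _)]opprK -herm_cl_vec mulrN; congr (_ + _).
  rewrite -mulrN -[X in _ * X](herm_cl2 (m := 7) Hgamma Qskew) Tk mulrA mulrN mulNr -rmorphM.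
  by [].
rewrite !deriv_theta in comm.
have conn : \sum_r ((connection_mx g (patch_chart a) p (delta_mx 0 j) *m coframe_mx a p) i r)%:C%C *
       herm Q (gamma r *m v a p) (phi a p) =
   \sum_r ((connection_mx g (patch_chart a) p (delta_mx 0 i) *m coframe_mx a p) j r)%:C%C *
       herm Q (gamma r *m v a p) (phi a p).
  by apply: eq_bigr => r _; rewrite christoffel_connection.
rewrite conn in comm.
have S0 : (s / 2)%:C%C != 0 :> R[i].
  rewrite complexR_eq0; apply: mulf_neq0; first exact/eqP.
  by rewrite invr_eq0 pnatr_eq0.
have kz : (sg (~~ e) * tau / 4)%:C%C + (zeta e s)%:C%C =
    - ((s / 2)%:C%C * (sg e * (2 * tau))%:C%C) :> R[i].
  by rewrite -rmorphD -rmorphM -rmorphN sign_of_neg; congr (_%:C%C); field.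
have := antisymmetric_part_eq0 S0 kz comm.
have -> : ((sg e * (2 * tau))%:C%C%:M - T) *m (cc i *m cc j - cc j *m cc i) *m v a p =
    (sg e * (2 * tau))%:C%C *: (tens i j - tens j i) - (T *m tens i j - T *m tens j i).
  have e1 : (cc i *m cc j - cc j *m cc i) *m v a p = tens i j - tens j i.
    by rewrite mulmxBl /tens !mulmxA.
  by rewrite -mulmxA e1 mulmxBl mul_scalar_mx mulmxBr.
by rewrite hermBl hermZl conjC_real 2!hermBl.
Qed.

Lemma killing_torsion_frame_commutator e s phi : s <> 0 -> s <> 1 / 4 -> spinor_field phi ->
  killing_torsion J s (zeta e s) phi -> forall a p (k l : 'I_6), patch_dom a p ->
  herm Q (((sg e * (2 * tau))%:C%C%:M - cl_torsion J a p) *m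
     (gamma k *m gamma l - gamma l *m gamma k) *m phi_ (~~ e) a p) (phi a p) = 0.
Proof.
move=> s0 s4 sphi K a p k l ap.
pose cc i := cl_vec a p (delta_mx 0 i).
have gE r : gamma r = \sum_i (patch_frame a p r i)%:C%C *: cc i.
  rewrite -(cl_vec_frame r ap) -cl_vec_sum; congr cl_vec.
  by rewrite /frame_vec {1}[row r _]row_sum_delta; apply: eq_bigr => i _; rewrite mxE.
have -> : gamma k *m gamma l - gamma l *m gamma k =
   \sum_i \sum_j (patch_frame a p k i * patch_frame a p l j)%:C%C *:
      (cc i *m cc j - cc j *m cc i).
  have e2 r u : gamma r *m gamma u = \sum_i \sum_j
     (patch_frame a p r i * patch_frame a p u j)%:C%C *: (cc i *m cc j).
    rewrite (gE r) (gE u) mulmx_suml; apply: eq_bigr => i _; rewrite mulmx_sumr.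
    by apply: eq_bigr => j _; rewrite -scalemxAl -scalemxAr scalerA rmorphM.
  rewrite (e2 k l) (e2 l k) [X in _ - X]exchange_big -sumrB; apply: eq_bigr => i _.
  rewrite -sumrB; apply: eq_bigr => j _.
  by rewrite (mulrC (patch_frame a p l j)) -scalerBr.
rewrite mulmx_sumr mulmx_suml herm_suml big1 // => i _.
rewrite mulmx_sumr mulmx_suml herm_suml big1 // => j _.
by rewrite -scalemxAr -scalemxAl hermZl (killing_torsion_commutator s0 s4 sphi K) ?mulr0.
Qed.

Lemma killing_of_killing_torsion e s phi : s <> 0 -> s <> 1 / 4 -> spinor_field phi ->
  killing_torsion J s (zeta e s) phi -> riemannian_killing (sg e * tau / 4) phi.
Proof.
move=> s0 s4 sphi K.
pose v := phi_ e; have sv : spinor_field v := (Hphi e).1.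
pose v' := phi_ (~~ e); have sv' : spinor_field v' := (Hphi (~~ e)).1.
have span a p : patch_dom a p -> exists z w, phi a p = z *: v a p + w *: v' a p.
  move=> ap.
  have nk := three_form_no_kernel Hgamma Qu Qskew (eigenvalue_neq0 e) (torsion_sum e ap)
    (phi_neq0 e ap) (HTphi e ap) (phi_neq0 (~~ e) ap) (HTphi_neg e ap) (phi := phi a p).
  apply: (three_form_span Hgamma Qu Qskew (eigenvalue_neq0 e) (torsion_sum e ap)
    (phi_neq0 e ap) (HTphi e ap) (phi_neq0 (~~ e) ap) (HTphi_neg e ap)).
  apply: nk => [l|i j]; last exact: (killing_torsion_frame_commutator s0 s4 sphi K).
  have := phi_contract (~~ e) (frame_vec a l p) ap; rewrite (cl_vec_frame l ap).
  rewrite -[LHS]/(cl2 gamma (torsion_frame J a p l) *m phi_ (~~ e) a p) => ->.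
  by rewrite sign_of_neg; congr (_%:C%C *: _); field.
have Tsa a p := herm_cl3 (m := 7) Hgamma Qskew (torsion_frame J a p).
have c0 : (sg e * (2 * tau))%:C%C != 0 :> R[i] by rewrite complexR_eq0 eigenvalue_neq0.
have orth a p : patch_dom a p -> herm Q (v a p) (v' a p) = 0.
  move=> ap; have := Tsa a p (v a p) (v' a p).
  rewrite -/(cl_torsion J a p) (HTphi e ap) (HTphi_neg e ap) hermZl hermZr conjC_real mulNr.
  move/eqP; rewrite -addr_eq0 -mulr2n mulrn_eq0 /= mulf_eq0 (negbTE c0) => /eqP //.
have orthX a p X : patch_dom a p -> herm Q (cl_vec a p X *m v' a p) (phi a p) = 0.
  move=> ap; have [z [w ->]] := span a p ap; rewrite hermDr !hermZr.
  have o b : herm Q (cl_vec a p X *m v' a p) (phi_ b a p) = 0.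
    have cb0 : (sg b * (2 * tau))%:C%C != 0 :> R[i] by rewrite complexR_eq0 eigenvalue_neq0.
    have := Tsa a p (cl_vec a p X *m v' a p) (phi_ b a p).
    rewrite -/(cl_torsion J a p) (cl_torsion_vec _ _ ap) herm0l (HTphi b ap) hermZr.
    by move/esym/eqP; rewrite mulf_eq0 (negbTE cb0) => /eqP.
  by rewrite !o !mulr0 addr0.
apply: (killing_of_nabla_s (e := e) (s := s)) => // a p ap.
pose N q := herm Q (v a q) (v a q); pose N' q := herm Q (v' a q) (v' a q).
pose F q := herm Q (v a q) (phi a q); pose F' q := herm Q (v' a q) (phi a q).
have oU : open (patch_dom a) by exact: patch_dom_open.
have Ud : patch_dom a `<=` chart_dom (chart_at (patch_chart a)) by exact: patch_dom_sub.
have sN : smooth_inC (patch_chart a) (patch_dom a) N := smooth_herm_spinor a Q sv sv.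
have sN' : smooth_inC (patch_chart a) (patch_dom a) N' := smooth_herm_spinor a Q sv' sv'.
have sF : smooth_inC (patch_chart a) (patch_dom a) F := smooth_herm_spinor a Q sv sphi.
have sF' : smooth_inC (patch_chart a) (patch_dom a) F' := smooth_herm_spinor a Q sv' sphi.
have Feq q : patch_dom a q -> (N q * N' q) *: phi a q =
    (N' q * F q) *: v a q + (N q * F' q) *: v' a q.
  move=> aq; have [z [w hz]] := span a q aq.
  have orth' : herm Q (v' a q) (v a q) = 0 by rewrite -hermC orth // rmorph0.
  rewrite /F /F' hz !hermDr !hermZr orth // orth' !mulr0 addr0 add0r.
  rewrite scalerDr !scalerA; congr (_ *: _ + _ *: _); rewrite -/(N q) -/(N' q); ring.
have nv b X q : patch_dom a q -> nabla_s J s (phi_ b) a q X =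
   (zeta b s)%:C%C *: (cl_vec a q X *m phi_ b a q).
  exact: (killing_nabla_s s (Hphi b).1 (phi_killing b)).
have dF X : dC (patch_chart a) X F p = 0.
  rewrite /F (deriv_herm_s J ap (m := 7) Hgamma Qskew s _ sphi sv) (nv _ _ _ ap) (K _ _ _ ap).
  by rewrite hermZl hermZr conjC_real herm_cl_vec mulrN addNr.
have dF' X : dC (patch_chart a) X F' p = 0.
  rewrite /F' (deriv_herm_s J ap (m := 7) Hgamma Qskew s _ sphi sv') (nv _ _ _ ap) (K _ _ _ ap).
  rewrite hermZl hermZr -[herm Q (v' a p) _]opprK -herm_cl_vec orthX //.
  by rewrite oppr0 !mulr0 addr0.
have dN X : dC (patch_chart a) X N p = 0 by exact: phi_norm_deriv.
have dN' X : dC (patch_chart a) X N' p = 0 by exact: phi_norm_deriv.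
have N0 : N p != 0 := phi_norm_neq0 e ap.
have N'0 : N' p != 0 := phi_norm_neq0 (~~ e) ap.
have F'0 : F' p = 0.
  have dM f1 f2 X : smooth_inC (patch_chart a) (patch_dom a) f1 ->
      smooth_inC (patch_chart a) (patch_dom a) f2 ->
      dC (patch_chart a) X f1 p = 0 -> dC (patch_chart a) X f2 p = 0 ->
      dC (patch_chart a) X (fun q => f1 q * f2 q) p = 0.
    by move=> s1 s2 d1 d2; rewrite (dCM oU Ud ap X s1 s2) d1 d2 mul0r mulr0 addr0.
  have sM f1 f2 := smooth_inCM oU Ud (f := f1) (g := f2).
  have sphi' := smooth_spinor a sphi.
  have sva := smooth_spinor a sv; have sva' := smooth_spinor a sv'.
  pose Y := frame_vec a 0 p.
  have Z := zeta_neq0 e s4.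
  have L0 := nabla_s_scale J ap s Y (sM _ _ sN sN') sphi'.
  have L1 := nabla_s_scale J ap s Y (sM _ _ sN' sF) sva.
  have L2 := nabla_s_scale J ap s Y (sM _ _ sN sF') sva'.
  rewrite (dM _ _ Y sN sN' (dN Y) (dN' Y)) scale0r add0r (K a p Y ap) (cl_vec_frame 0 ap) in L0.
  rewrite (dM _ _ Y sN' sF (dN' Y) (dF Y)) scale0r add0r (nv e Y p ap) (cl_vec_frame 0 ap) in L1.
  rewrite (dM _ _ Y sN sF' (dN Y) (dF' Y)) scale0r add0r (nv (~~ e) Y p ap)
    (cl_vec_frame 0 ap) in L2.
  pose v1 : spinor S := fun b q => (N' q * F q) *: v b q.
  pose v2 : spinor S := fun b q => (N q * F' q) *: v' b q.
  have LD := nabla_sD J (phi := v1) (psi := v2) ap s Y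
    (smooth_in_cv_scale oU Ud (sM _ _ sN' sF) sva)
    (smooth_in_cv_scale oU Ud (sM _ _ sN sF') sva').
  have E := etrans (esym L0) (etrans (nabla_s_eq J (psi := fun b q => v1 b q + v2 b q) ap s Y Feq)
    (etrans LD (congr2 +%R L1 L2))).
  have ZN : (zeta (~~ e) s)%:C%C = - (zeta e s)%:C%C :> R[i].
    by rewrite -rmorphN sign_of_neg; congr (_%:C%C); ring.
  have g0 : gamma 0 *m v' a p != 0.
    apply/eqP => /(congr1 (mulmx (gamma 0))); rewrite mulmxA gamma_sqr mulNmx mul1mx mulmx0.
    by move/eqP; rewrite oppr_eq0 (negbTE (phi_neq0 (~~ e) ap)).
  have G := congr1 (mulmx (gamma 0)) (Feq p ap).
  rewrite mulmxDr -!scalemxAr in G.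
  have Zc : (zeta e s)%:C%C != 0 :> R[i] by rewrite complexR_eq0.
  have b0 : N p * F' p = 0.
    apply: (opposite_part_eq0 (complex_two_neq0 R) Zc g0 G).
    rewrite -ZN -[RHS]E; move: (gamma 0 *m phi a p) => y.
    by rewrite !scalerA mulrC.
  by move/eqP: b0; rewrite mulf_eq0 (negbTE N0) => /eqP.
have quot (x y z : R[i]) : x != 0 -> y * z = x * y * (z / x) by move=> x0; field.
exists (F p / N p); apply: (scalerI (mulf_neq0 N0 N'0)).
rewrite (Feq p ap) F'0 mulr0 scale0r addr0 scalerA; congr (_ *: _).
exact: (quot (N p) (N' p) (F p) N0).
Qed.

End NearlyKahlerSpinors.

Theorem theorem4p1 (R : realType) (M : manifold R 6) (g : riemannian_metric M)
    (J : almost_complex M) (gamma : 'I_6 -> 'M[R[i]]_8)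
    (S : spin_structure g gamma) (tau : R) (phi_ : bool -> spinor S)
    (Hgamma : clifford_rep gamma)
    (HnK : strict_nearly_kahler g J)
    (* tau is the (constant) norm of T *)
    (Htau : forall (a : spin_patch S) (p : M), patch_dom a p -> torsion_norm J a p = tau)
    (* phi_ true = phi^+ and phi_ false = phi^- *)
    (Hphi : forall e, spinor_field (phi_ e) /\ nonzero_spinor (phi_ e))
    (Hkilling : forall e phi, spinor_field phi ->
       (riemannian_killing (sign_of R e * tau / 4) phi <-> in_line phi (phi_ e)))
    (HTphi : forall e, in_eigenbundle J (sign_of R e * (2 * tau)) (phi_ e))
    (Hparallel : forall phi, spinor_field phi ->
       (parallel_c J phi <-> in_span2 phi (phi_ true) (phi_ false))) :
  forall (e : bool) (phi : spinor S), spinor_field phi ->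
  [/\ (forall s : R, s <> 1 / 4 ->
         (twistor_torsion J s phi /\
          in_eigenbundle J (sign_of R e * (2 * tau)) phi) <->
         riemannian_killing (sign_of R e * tau / 4) phi),
      (forall s : R, s <> 0 -> s <> 1 / 4 ->
         killing_torsion J s (- sign_of R e * ((4 * s - 1) / 4) * tau) phi <->
         riemannian_killing (sign_of R e * tau / 4) phi)
    & (riemannian_killing (sign_of R e * tau / 4) phi <->
       parallel_c J phi /\ in_line phi (phi_ e))].
Proof.
move=> e phi sphi.
have [Q Qu Qskew] := clifford_skew_form (m := 7) Hgamma.
have [span1 span2] := Hparallel phi sphi; have [line1 line2] := Hkilling e phi sphi.
split=> [s s4|s s0 s4|].
- split=> [[tw eig]|K].
    exact: (killing_of_twistor Hgamma HnK Htau Hphi Hkilling HTphi Hparallel Qu Qskew s4).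
  split.
    apply: (killing_twistor (tau := tau) (e := e) Hgamma).
    exact: (killing_nabla_s Hphi Hkilling Hparallel).
  move=> a p ap; have [z ->] := killing_line Hkilling sphi K ap.
  by rewrite -scalemxAr HTphi // !scalerA mulrC.
- split=> K; last exact: (killing_nabla_s Hphi Hkilling Hparallel).
  exact: (killing_of_killing_torsion Hgamma HnK Htau Hphi Hkilling HTphi Hparallel Qu Qskew s0 s4).
- split=> [K|[_ /line2]//]; split; last exact: line1.
  apply: span2; have [z hz] := line1 K; case: e {Hkilling line1 line2 K} hz => hz.
    by exists z, 0 => a p ap; rewrite hz // scale0r addr0.
  by exists 0, z => a p ap; rewrite hz // scale0r add0r.
Qed.
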